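(* Let $\ell\in\mathbb R^m$. The $\ell$-error $\hat\sigma(T,\ell)$ is finite if and only if there exist $z\in\mathbb L_2(t_0,T,\mathbb R^m)$ and $u\in\mathbb L_2(t_0,T,\mathbb R^p)$ satisfying $$\frac{d(F'z)}{dt}=-C'(t)z(t)+H'(t)u(t),\qquad F'z(T)=F'\ell. \qquad ( * )$$ Moreover, if $\hat\sigma(T,\ell)<+\infty$ and $(z,u)$ is any pair satisfying $( * )$, then $$\sigma(T,\ell,u)=\min_{v,d}\Big\{\big\|\tilde Q_0^{-\frac12}(z(t_0)-v(t_0))-Q_0^{-\frac12}d\big\|^2+\int_{t_0}^T\|Q^{-\frac12}(z-v)\|^2dt\Big\}+\int_{t_0}^T\|R^{-\frac12}u\|^2dt,$$ where $\tilde Q_0^{-\frac12}:=Q_0^{-\frac12}(F')^+F'$, and the minimum is taken over all $d\in\mathbb R^m$ with $F'd=0$ and all $v\in\mathbb L_2(t_0,T,\mathbb R^m)$ satisfying $( * )$ with $u=0$ and $\ell=0$, i.e. $\frac{d(F'v)}{dt}=-C'(t)v(t)$, $F'v(T)=0$. The minimum is attained at some $(\tilde v,\tilde d)$, so that $$\sigma(T,\ell,u)=\big\|\tilde Q_0^{-\frac12}(z(t_0)-\tilde v(t_0))-Q_0^{-\frac12}\tilde d\big\|^2+\int_{t_0}^T\big(\|Q^{-\frac12}(z-\tilde v)\|^2+\|R^{-\frac12}u\|^2\big)dt.$$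
   Context: Notation. A prime denotes the transpose of a matrix, $F^+$ is the Moore–Penrose pseudoinverse, $Q^{\frac12}$ is the square root of a symmetric nonnegative matrix, $E$ is expectation, $\|\cdot\|$ is the Euclidean norm. $\mathbb L_2(t_0,T,\mathbb R^k)$ is the space of square-integrable $\mathbb R^k$-valued functions on $[t_0,T]$, and $\mathbb H_1(t_0,T,\mathbb R^k)$ is the space of absolutely continuous $\mathbb R^k$-valued functions with derivative in $\mathbb L_2$. Data. $t_0<T$ are real numbers; $F\in\mathbb R^{m\times n}$ is a constant matrix; $C(t)\in\mathbb R^{m\times n}$ and $H(t)\in\mathbb R^{p\times n}$ are continuous in $t\in[t_0,T]$; $Q_0,Q(t)\in\mathbb R^{m\times m}$ and $R(t)\in\mathbb R^{p\times p}$ are symmetric positive definite, with $Q(t),Q^{-1}(t),R(t),R^{-1}(t)$ continuous on $[t_0,T]$. State equation and observations: $$\frac{d(Fx)}{dt}=C(t)x(t)+f(t),\quad Fx(t_0)=x_0,\qquad y(t)=H(t)x(t)+\eta(t),$$ with $x_0\in\mathbb R^m$, $f\in\mathbb L_2(t_0,T,\mathbb R^m)$. A solution is a function $x\in\mathbb L_2(t_0,T,\mathbb R^n)$ such that $Fx\in\mathbb H_1(t_0,T,\mathbb R^m)$ (i.e. $Fx$ has an absolutely continuous representative, whose value at $t$ is denoted $Fx(t)$), the equation holds almost everywhere and the initial condition holds. Neither existence nor uniqueness of a solution is assumed. Likewise, a solution $z\in\mathbb L_2(t_0,T,\mathbb R^m)$ of a differential equation for $F'z$ is required to satisfy $F'z\in\mathbb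 H_1(t_0,T,\mathbb R^n)$, and the equation is understood almost everywhere. Only $F'z(t)$, not $z(t)$, is well defined pointwise; $\tilde Q_0^{-\frac12}z(t_0)$ means $Q_0^{-\frac12}(F')^+\big(F'z(t_0)\big)$. Uncertainty. $(x_0,f)$ is unknown and belongs to $$\mathscr G=\Big\{(x_0,f):\langle Q_0x_0,x_0\rangle+\int_{t_0}^T\langle Q(t)f(t),f(t)\rangle dt\le1\Big\}.$$ $\eta$ is a realization of an $\mathbb R^p$-valued random process with $E\eta(t)=0$ on $[t_0,T]$ and unknown correlation function $\mathcal R_\eta(t,s)=E\eta(t)\eta'(s)$ belonging to $$W=\Big\{\mathcal R_\eta:\int_{t_0}^T\mathrm{tr}\,(R(t)\mathcal R_\eta(t,t))dt\le1\Big\}.$$ Minimax estimation. For $\ell\in\mathbb R^m$, $u\in\mathbb L_2(t_0,T,\mathbb R^p)$ let $u(y)=\int_{t_0}^T\langle u(t),y(t)\rangle dt$ and define the mean-squared worst-case error $$\sigma(T,\ell,u)=\sup_{x,\,(x_0,f)\in\mathscr G,\,\mathcal R_\eta\in W}E\big[\langle\ell,Fx(T)\rangle-u(y)\big]^2\in[0,+\infty],$$ the supremum being over all $(x_0,f)\in\mathscr G$, all solutions $x$ of the state equation for $(x_0,f)$, and all admissible noises. The $\ell$-error (minimax mean-squared a priori error in the direction $\ell$) is $\hat\sigma(T,\ell)=\inf_{u}\sigma(T,\ell,u)$, the infimum being over $u\in\mathbb L_2(t_0,T,\mathbb R^p)$; any $\hat u$ attaining it is called an $\ell$-estimate. *)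

(* Defs.v *)
From HB Require Import structures.
From mathcomp Require Import all_boot all_order all_algebra.
From mathcomp Require Import all_classical all_reals all_analysis.

Set Implicit Arguments.
Unset Strict Implicit.
Unset Printing Implicit Defensive.

Import Order.TTheory GRing.Theory Num.Theory.
Import numFieldNormedType.Exports.

Local Open Scope classical_set_scope.
Local Open Scope ring_scope.

Definition dotv (R : realType) (k : nat) (a b : 'cV[R]_k) : R :=
  \sum_(i < k) a i 0 * b i 0.

(* Euclidean norm; the library's `|a| on matrices is the max norm. *)
Definition enorm (R : realType) (k : nat) (a : 'cV[R]_k) : R :=
  Num.sqrt (dotv a a).

Definition posdefmx (R : realType) (k : nat) (A : 'M[R]_k) : Prop :=
  A^T = A /\ forall a : 'cV[R]_k, a != 0 -> 0 < dotv (A *m a) a.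

Definition nonnegmx (R : realType) (k : nat) (A : 'M[R]_k) : Prop :=
  A^T = A /\ forall a : 'cV[R]_k, 0 <= dotv (A *m a) a.

(* The symmetric nonnegative square root exists and is unique when A is itself
   symmetric nonnegative; the default 0 is only reached for other A. *)
Definition sqrtmx (R : realType) (k : nat) (A : 'M[R]_k) : 'M[R]_k :=
  xget 0 [set S | nonnegmx S /\ S *m S = A].

Definition invsqrtmx (R : realType) (k : nat) (A : 'M[R]_k) : 'M[R]_k :=
  invmx (sqrtmx A).

(* Moore-Penrose pseudoinverse, characterized by the four Penrose equations
   (the library's pinvmx only provides a generalized inverse). *)
Definition mppinv (R : realType) (k l : nat) (A : 'M[R]_(k, l)) :
    'M[R]_(l, k) :=
  xget 0 [set X | [/\ A *m X *m A = A, X *m A *m X = X,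
                      (A *m X)^T = A *m X & (X *m A)^T = X *m A]].

Definition L2fun (R : realType) (t0 T : R) (k : nat) (f : R -> 'cV[R]_k) :
    Prop :=
  (forall i, measurable_fun `[t0, T] (fun t => f t i 0)) /\
  (\int[lebesgue_measure]_(t in `[t0, T]) (enorm (f t) ^+ 2)%:E < +oo)%E.

Definition abs_continuous (R : realType) (t0 T : R) (k : nat)
    (g : R -> 'cV[R]_k) : Prop :=
  forall e : R, 0 < e -> exists2 d : R, 0 < d &
    forall (N : nat) (a b : 'I_N -> R),
      (forall i, [/\ t0 <= a i, a i <= b i & b i <= T]) ->
      trivIset setT (fun i => [set` `]a i, b i[]) ->
      \sum_(i < N) (b i - a i) < d ->
      \sum_(i < N) enorm (g (b i) - g (a i)) < e.

Definition ae_derivative (R : realType) (t0 T : R) (k : nat)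
    (g w : R -> 'cV[R]_k) : Prop :=
  {ae lebesgue_measure, forall t : R, t \in `[t0, T]%R ->
     forall i, is_derive t 1 (fun s => g s i 0) (w t i 0)}.

Definition H1fun (R : realType) (t0 T : R) (k : nat) (g : R -> 'cV[R]_k) :
    Prop :=
  abs_continuous t0 T g /\
  exists2 w : R -> 'cV[R]_k, L2fun t0 T w & ae_derivative t0 T g w.

(* x is a solution of d(Ax)/dt = w. Since x is only defined almost everywhere,
   the absolutely continuous representative of Ax is the separate argument Ax;
   it is unique on [t0, T], and pointwise values of Ax are values of Ax. *)
Definition descriptor_solution (R : realType) (t0 T : R) (k l : nat)
    (A : 'M[R]_(k, l)) (w : R -> 'cV[R]_k)
    (x : R -> 'cV[R]_l) (Ax : R -> 'cV[R]_k) : Prop :=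
  [/\ L2fun t0 T x, H1fun t0 T Ax,
      {ae lebesgue_measure, forall t : R, t \in `[t0, T]%R ->
         Ax t = A *m x t} &
      ae_derivative t0 T Ax w].

Definition state_solution (R : realType) (t0 T : R) (m n : nat)
    (F : 'M[R]_(m, n)) (C : R -> 'M[R]_(m, n))
    (x0 : 'cV[R]_m) (f : R -> 'cV[R]_m)
    (x : R -> 'cV[R]_n) (Fx : R -> 'cV[R]_m) : Prop :=
  descriptor_solution t0 T F (fun t => C t *m x t + f t) x Fx /\ Fx t0 = x0.

Definition adjoint_solution (R : realType) (t0 T : R) (m n p : nat)
    (F : 'M[R]_(m, n)) (C : R -> 'M[R]_(m, n)) (H : R -> 'M[R]_(p, n))
    (l : 'cV[R]_m) (u : R -> 'cV[R]_p)
    (z : R -> 'cV[R]_m) (Fz : R -> 'cV[R]_n) : Prop :=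
  descriptor_solution t0 T F^T
    (fun t => - ((C t)^T *m z t) + (H t)^T *m u t) z Fz /\
  Fz T = F^T *m l.

Definition uncertainty_set (R : realType) (t0 T : R) (m : nat)
    (Q0 : 'M[R]_m) (Q : R -> 'M[R]_m) :
    set ('cV[R]_m * (R -> 'cV[R]_m)) :=
  [set x0f | L2fun t0 T x0f.2 /\
     ((dotv (Q0 *m x0f.1) x0f.1)%:E +
      \int[lebesgue_measure]_(t in `[t0, T])
        (dotv (Q t *m x0f.2 t) (x0f.2 t))%:E <= 1)%E].

(* Zero-mean second-order process on [t0, T]; joint measurability is what makes
   the functional u(y), an integral over [t0, T], a random variable. *)
Definition centered_process (R : realType) (t0 T : R) (p : nat)
    (d : measure_display) (Om : measurableType d) (P : probability Om R)
    (eta : R -> Om -> 'cV[R]_p) : Prop :=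
  [/\ forall i, measurable_fun (`[t0, T] `*` [set: Om])
        (fun tw : measurableTypeR R * Om => eta tw.1 tw.2 i 0),
      forall t i, t \in `[t0, T]%R ->
        ('E_P[(fun w => eta t w i 0 ^+ 2)%R] < +oo)%E &
      forall t i, t \in `[t0, T]%R ->
        ('E_P[(fun w => eta t w i 0)%R] = 0)%E].

Definition correlation (R : realType) (p : nat)
    (d : measure_display) (Om : measurableType d) (P : probability Om R)
    (eta : R -> Om -> 'cV[R]_p) (t s : R) : 'M[R]_p :=
  \matrix_(i, j) fine ('E_P[(fun w => eta t w i 0 * eta s w j 0)%R])%E.

Definition correlation_set (R : realType) (t0 T : R) (p : nat)
    (Rn : R -> 'M[R]_p) : set (R -> R -> 'M[R]_p) :=
  [set K | (\int[lebesgue_measure]_(t in `[t0, T])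
              (\tr (Rn t *m K t t))%:E <= 1)%E].

Definition observation (R : realType) (n p : nat) (Om : Type)
    (H : R -> 'M[R]_(p, n)) (x : R -> 'cV[R]_n) (eta : R -> Om -> 'cV[R]_p)
    (w : Om) (t : R) : 'cV[R]_p :=
  H t *m x t + eta t w.

Definition estimate (R : realType) (t0 T : R) (p : nat)
    (u y : R -> 'cV[R]_p) : R :=
  \int[lebesgue_measure]_(t in `[t0, T]) dotv (u t) (y t).

(* The noise ranges over processes on all probability spaces. *)
Definition worst_error (R : realType) (t0 T : R) (m n p : nat)
    (F : 'M[R]_(m, n)) (C : R -> 'M[R]_(m, n)) (H : R -> 'M[R]_(p, n))
    (Q0 : 'M[R]_m) (Q : R -> 'M[R]_m) (Rn : R -> 'M[R]_p)
    (l : 'cV[R]_m) (u : R -> 'cV[R]_p) : \bar R :=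
  ereal_sup [set e : \bar R |
    exists (x0 : 'cV[R]_m) (f : R -> 'cV[R]_m)
           (x : R -> 'cV[R]_n) (Fx : R -> 'cV[R]_m)
           (d : measure_display) (Om : measurableType d)
           (P : probability Om R) (eta : R -> Om -> 'cV[R]_p),
      [/\ uncertainty_set t0 T Q0 Q (x0, f),
          state_solution t0 T F C x0 f x Fx,
          centered_process t0 T P eta,
          correlation_set t0 T Rn (correlation P eta) &
          e = ('E_P[(fun w =>
            (dotv l (Fx T) - estimate t0 T u (observation H x eta w)) ^+ 2)%R])%E]].

Definition minimax_error (R : realType) (t0 T : R) (m n p : nat)
    (F : 'M[R]_(m, n)) (C : R -> 'M[R]_(m, n)) (H : R -> 'M[R]_(p, n))
    (Q0 : 'M[R]_m) (Q : R -> 'M[R]_m) (Rn : R -> 'M[R]_p)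
    (l : 'cV[R]_m) : \bar R :=
  ereal_inf [set worst_error t0 T F C H Q0 Q Rn l u |
             u in [set u : R -> 'cV[R]_p | L2fun t0 T u]].

(* || Q0~^(-1/2) (z(t0) - v(t0)) - Q0^(-1/2) d ||^2, a function of the values
   a = F'z(t0) and b = F'v(t0). *)
Definition initial_cost (R : realType) (m n : nat)
    (F : 'M[R]_(m, n)) (Q0 : 'M[R]_m) (a b : 'cV[R]_n) (d : 'cV[R]_m) : R :=
  enorm (invsqrtmx Q0 *m (mppinv F^T *m (a - b)) - invsqrtmx Q0 *m d) ^+ 2.

Definition dual_cost (R : realType) (t0 T : R) (m n : nat)
    (F : 'M[R]_(m, n)) (Q0 : 'M[R]_m) (Q : R -> 'M[R]_m)
    (z : R -> 'cV[R]_m) (Fz : R -> 'cV[R]_n)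
    (v : R -> 'cV[R]_m) (Fv : R -> 'cV[R]_n) (d : 'cV[R]_m) : \bar R :=
  ((initial_cost F Q0 (Fz t0) (Fv t0) d)%:E +
   \int[lebesgue_measure]_(t in `[t0, T])
     (enorm (invsqrtmx (Q t) *m (z t - v t)) ^+ 2)%:E)%E.

Definition dual_feasible (R : realType) (t0 T : R) (m n p : nat)
    (F : 'M[R]_(m, n)) (C : R -> 'M[R]_(m, n)) (H : R -> 'M[R]_(p, n))
    (v : R -> 'cV[R]_m) (Fv : R -> 'cV[R]_n) (d : 'cV[R]_m) : Prop :=
  adjoint_solution t0 T F C H 0 (fun=> 0) v Fv /\ F^T *m d = 0.

(* Main.v *)
Require Import Defs.
From HB Require Import structures.
From mathcomp Require Import all_boot all_order all_algebra.
From mathcomp Require Import all_classical all_reals all_analysis.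
From mathcomp Require Import measurable_realfun.
From mathcomp Require Import complex spectral.
From mathcomp Require Import ring lra.

Set Implicit Arguments.
Unset Strict Implicit.
Unset Printing Implicit Defensive.

Import Order.TTheory GRing.Theory Num.Theory.
Import numFieldNormedType.Exports.

Local Open Scope classical_set_scope.
Local Open Scope ring_scope.

(** Everything happens in the Hilbert space of the data [(x0, f)], normed by the
    quadratic form [weight] that defines the uncertainty set. Two independent
    quantities make up the worst error of [u].

    The first is the noise. It enters the error through an integral with zero
    mean, whose variance is at most [noise_energy u], the integral of
    [dotv (invmx (Rn t) *m u t) (u t)]. This is a Cauchy-Schwarz inequality in time
    combined with Fubini's theorem ([noise_upper_bound]), and it is attained by a
    deterministic noise with a random sign ([noise_attained]). So the worst error is
    [noise_energy u] plus the supremum of the squared [estimation_gap] over the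
    trajectories with data in the unit ball.

    The second is that supremum. By Green's formula ([green_formula]), a solution
    [(z, u)] of the adjoint equation represents the gap as a linear functional of
    the data, and so does every [z - v] corrected by a [d], for feasible [(v, d)].
    By the Cauchy-Schwarz inequality the dual cost of each feasible pair bounds the
    supremum from above; in particular the worst error is finite
    ([adjoint_worst_error_le]).

    Conversely, if the worst error is finite, then the gap is a bounded functional
    of the data. Riesz's theorem on the closure of the admissible data represents it
    by some [r] whose squared norm is exactly the supremum ([gap_representation]). The
    equation is not assumed to be solvable for all data, so [r] is found as the limit
    of data of a minimizing sequence of trajectories. Applied to trajectories with
    an absolutely continuous state, this representation is the weak form of the
    adjoint equation, and du Bois-Reymond's lemma makes it a genuine solution
    ([representation_adjoint]). This proves that the adjoint equation is solvable.
    The difference between a given solution and this one is feasible, and its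
    dual cost is the squared norm of [r]; so it is a minimizer and the bound is
    attained.

    The analysis underneath is the fundamental theorem of calculus for absolutely
    continuous functions ([ac_FTC]) and the Riesz-Fischer theorem
    ([riesz_fischer]); the weights are turned into quadratic forms of inverses by
    the existence of square roots ([posdef_sqrt_ex]) and pseudoinverses
    ([mppinvP]). *)

(** * Positive definite matrices and pseudoinverses *)

Section Dot.
Context (R : realType).

Lemma dotvE k (a b : 'cV[R]_k) : dotv a b = (a^T *m b) 0 0.
Proof. by rewrite mxE; apply: eq_bigr => i _; rewrite mxE. Qed.

Lemma dotvC k (a b : 'cV[R]_k) : dotv a b = dotv b a.
Proof. by apply: eq_bigr => i _; rewrite mulrC. Qed.

Lemma dotvDl k (a b c : 'cV[R]_k) : dotv (a + b) c = dotv a c + dotv b c.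
Proof. by rewrite /dotv -big_split; apply: eq_bigr => i _; rewrite mxE mulrDl. Qed.

Lemma dotvZl k x (a b : 'cV[R]_k) : dotv (x *: a) b = x * dotv a b.
Proof. by rewrite /dotv mulr_sumr; apply: eq_bigr => i _; rewrite mxE mulrA. Qed.

Lemma dotvNl k (a b : 'cV[R]_k) : dotv (- a) b = - dotv a b.
Proof. by rewrite -scaleN1r dotvZl mulN1r. Qed.

Lemma dotvDr k (a b c : 'cV[R]_k) : dotv a (b + c) = dotv a b + dotv a c.
Proof. by rewrite !(dotvC a) dotvDl. Qed.

Lemma dotvZr k x (a b : 'cV[R]_k) : dotv a (x *: b) = x * dotv a b.
Proof. by rewrite !(dotvC a) dotvZl. Qed.

Lemma dotvNr k (a b : 'cV[R]_k) : dotv a (- b) = - dotv a b.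
Proof. by rewrite !(dotvC a) dotvNl. Qed.

Lemma dotvBl k (a b c : 'cV[R]_k) : dotv (a - b) c = dotv a c - dotv b c.
Proof. by rewrite dotvDl dotvNl. Qed.

Lemma dotvBr k (a b c : 'cV[R]_k) : dotv a (b - c) = dotv a b - dotv a c.
Proof. by rewrite dotvDr dotvNr. Qed.

Lemma dotv0l k (a : 'cV[R]_k) : dotv 0 a = 0.
Proof. by rewrite /dotv big1 // => i _; rewrite mxE mul0r. Qed.

Lemma dotv0r k (a : 'cV[R]_k) : dotv a 0 = 0.
Proof. by rewrite dotvC dotv0l. Qed.

Lemma dotv_mul k l (A : 'M[R]_(k, l)) a b : dotv (A *m a) b = dotv a (A^T *m b).
Proof. by rewrite !dotvE trmx_mul mulmxA. Qed.

Lemma dotv_ge0 k (a : 'cV[R]_k) : 0 <= dotv a a.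
Proof. by apply: sumr_ge0 => i _; rewrite -expr2 sqr_ge0. Qed.

Lemma dotv_eq0 k (a : 'cV[R]_k) : dotv a a = 0 -> a = 0.
Proof.
move=> a0; apply/colP => i; rewrite [RHS]mxE; apply/eqP; rewrite -sqrf_eq0.
move/eqP: a0; rewrite psumr_eq0; last first.
  by move=> j _; rewrite -expr2 sqr_ge0.
by move=> /allP /(_ i); rewrite mem_index_enum -expr2 /= => /(_ isT) ->.
Qed.

Lemma enorm_sqr k (a : 'cV[R]_k) : enorm a ^+ 2 = dotv a a.
Proof. by rewrite /enorm sqr_sqrtr ?dotv_ge0. Qed.

End Dot.

Section PositiveDefinite.
Context (R : realType).

Lemma interpolation (s : seq R) (g : R -> R) :
  exists q : {poly R}, forall x, x \in s -> q.[x] = g x.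
Proof.
elim: s => [|x s [q qP]]; first by exists 0.
have [xs|xs] := boolP (x \in s).
  by exists q => y; rewrite inE => /predU1P[->|]; exact: qP.
set p := \prod_(y <- s) ('X - y%:P).
have px : p.[x] != 0 by rewrite -/(root p x) root_prod_XsubC.
exists (q + ((g x - q.[x]) / p.[x])%:P * p) => y.
rewrite hornerD hornerM hornerC inE => /predU1P[->|ys].
  by rewrite divfK // addrC subrK.
suff -> : p.[y] = 0 by rewrite mulr0 addr0 qP.
by apply/eqP; rewrite -/(root p y) root_prod_XsubC.
Qed.

Lemma posdef_eigen_gt0 k (A : 'M[R]_k) (x : R) :
  posdefmx A -> eigenvalue A x -> 0 < x.
Proof.
move=> [symA posA] /eigenvalueP[v vA v0].
have vT0 : v^T != 0 by rewrite -(inj_eq trmx_inj) trmxK trmx0.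
have := posA _ vT0; rewrite -{1}symA -trmx_mul vA linearZ /= dotvZl.
have := dotv_ge0 v^T; rewrite le_eqVlt => /predU1P[/esym/dotv_eq0 v'|vv].
  by rewrite v' eqxx in vT0.
by rewrite pmulr_lgt0.
Qed.

(** A square root can be found among the polynomials in the matrix, which keeps
    it real and symmetric: over the complex field the matrix is diagonalizable
    with positive eigenvalues, so it suffices to interpolate on the spectrum.
    Interpolating the fourth root, then squaring, gives a nonnegative matrix for
    free. *)
Lemma posdef_sqrt_ex k (A : 'M[R]_k) : posdefmx A ->
  exists S : 'M[R]_k, nonnegmx S /\ S *m S = A.
Proof.
case: k A => [A _|k A posA].
  exists 0; split; last by rewrite [A]flatmx0 [LHS]flatmx0.
  split; first by rewrite trmx0.
  by move=> a; rewrite mul0mx dotv0l.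
have [symA _] := posA.
pose toC := map_mx (real_complex R) : 'M[R]_k.+1 -> 'M[R[i]]_k.+1.
have Areal : toC A \is a realmx.
  by apply/mxOverP => i j; rewrite mxE complex_real.
have Aherm : toC A \is hermsymmx.
  apply: realsym_hermsym => //.
  apply/is_hermitianmxP; rewrite expr0 scale1r map_mx_id // map_trmx symA //.
have /hermitian_normalmx/orthomx_spectralP := Aherm.
set P := spectralmx _; set sp := spectral_diag _ => AE.
have Pu : P \in unitmx by exact: spectral_unit.
have spR i : exists x : R, sp 0 i = (x%:C)%C.
  have /mxOverP/(_ 0 i) := hermitian_spectral_diag_real Aherm.
  by move/complex_realP => [x ->]; exists x.
have /choice[d dE] := spR.
have d_gt0 i : 0 < d i.
  apply: (posdef_eigen_gt0 posA)=> /=.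
  rewrite eigenvalue_root_char -(fmorph_root (real_complex R)).
  rewrite -/(toC A) map_char_poly -eigenvalue_root_char -/(toC A).
  apply/eigenvalueP; exists (row i P).
    rewrite -row_mul AE !mulmxA mulmxV // mul1mx row_mul.
    by rewrite row_diag_mx -scalemxAl -rowE dE.
  apply/eqP => Pi0; have : row i P *m invmx P = 0 by rewrite Pi0 mul0mx.
  rewrite -row_mul mulmxV // => /rowP /(_ i); rewrite !mxE eqxx => /eqP.
  by rewrite oner_eq0.
have [q qP] := interpolation [seq d i | i : 'I_k.+1]
  (fun x => Num.sqrt (Num.sqrt x)).
have qd i : q.[d i] ^+ 4 = d i.
  rewrite qP; last by apply/mapP; exists i; rewrite ?mem_enum.
  by rewrite (exprM _ 2 2) !sqr_sqrtr ?sqrtr_ge0 // ltW.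
pose S : 'M[R]_k.+1 := horner_mx A q.
have symS : S^T = S.
  rewrite /S; elim/poly_ind: q {qP qd S} => [|q c IHq]; first by rewrite !rmorph0 trmx0.
  rewrite rmorphD rmorphM /= horner_mx_X horner_mx_C linearD /= tr_scalar_mx.
  by rewrite -mulmxE trmx_mul IHq symA (comm_horner_mx q (comm_mx_refl A)).
have S4 : (S *m S) *m (S *m S) = A.
  have -> : S *m S *m (S *m S) = horner_mx A (q ^+ 4).
    by rewrite rmorphXn !mulmxE !exprS expr0 mulr1 !mulrA.
  apply: (@map_mx_inj _ _ (real_complex R)).
  rewrite map_horner_mx -/(toC A) [in LHS]AE horner_mx_uconjC // horner_mx_diag.
  suff -> : map_mx (horner (map_poly (real_complex R) (q ^+ 4))) sp = sp.
    by rewrite -AE.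
  by apply/rowP => i; rewrite mxE dE horner_map /= horner_exp qd.
exists (S *m S : 'M[R]_k.+1); split => //; split; first by rewrite trmx_mul symS.
by move=> a; rewrite -mulmxA dotv_mul symS dotv_ge0.
Qed.

Lemma posdef_unitmx k (A : 'M[R]_k) : posdefmx A -> A \in unitmx.
Proof.
move=> [symA posA]; rewrite -row_free_unit; apply: inj_row_free => v vA.
apply: trmx_inj; rewrite trmx0; apply/eqP/contraT => /posA.
by rewrite -{1}symA -trmx_mul vA trmx0 dotv0l ltxx.
Qed.

Lemma posdef_ge0 k (A : 'M[R]_k) a : posdefmx A -> 0 <= dotv (A *m a) a.
Proof.
move=> [_ posA]; have [->|/posA/ltW //] := eqVneq a 0.
by rewrite dotv0r.
Qed.

Lemma posdef_inv k (A : 'M[R]_k) : posdefmx A -> posdefmx (invmx A).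
Proof.
move=> posA; have uA := posdef_unitmx posA; have [symA gt0A] := posA.
split=> [|a a0]; first by rewrite trmx_inv symA.
have b0 : invmx A *m a != 0.
  by apply: contra_neq a0 => /(congr1 (mulmx A)); rewrite mulKVmx // mulmx0.
by have := gt0A _ b0; rewrite mulKVmx // dotvC.
Qed.

Lemma enorm_invsqrtmx k (A : 'M[R]_k) (a : 'cV[R]_k) : posdefmx A ->
  enorm (invsqrtmx A *m a) ^+ 2 = dotv (invmx A *m a) a.
Proof.
move=> posA; have uA := posdef_unitmx posA; rewrite /invsqrtmx.
have [/= [symS _] SS] : [set S | nonnegmx S /\ S *m S = A] (sqrtmx A).
  by have [S SP] := posdef_sqrt_ex posA; apply: (@xgetPex _ 0); exists S.
move: SS symS; set S := sqrtmx A => SS symS.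
have uS : S \in unitmx by move: uA; rewrite -SS unitmx_mul andbb.
rewrite enorm_sqr dotv_mul trmx_inv symS dotvC; congr (dotv _ a).
apply: (can_inj (mulKmx uA)); rewrite mulKVmx // -{1}SS.
by rewrite -mulmxA !mulKVmx.
Qed.

(** Young's inequality for the dual pair of quadratic forms of a positive
    definite matrix and its inverse. Integrated with a free parameter it yields
    the weighted Cauchy-Schwarz inequality without any square root. *)
Lemma posdef_young k (A : 'M[R]_k) (a b : 'cV[R]_k) x : posdefmx A ->
  2 * x * dotv a b <= dotv (A *m a) a + x ^+ 2 * dotv (invmx A *m b) b.
Proof.
move=> posA; have uA := posdef_unitmx posA; have [symA _] := posA.
have := posdef_ge0 (a - x *: (invmx A *m b)) posA.
rewrite mulmxBr -scalemxAr mulKVmx // !(dotvBl, dotvBr, dotvZl, dotvZr).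
rewrite (dotv_mul A a (invmx A *m b)) symA mulKVmx // (dotvC b a) (dotvC b (invmx _ *m _)).
by move=> h; rewrite -subr_ge0; apply: (le_trans h); rewrite le_eqVlt; apply/orP; left; apply/eqP; ring.
Qed.

Lemma gram_unitmx k l (B : 'M[R]_(k, l)) : row_free B -> B *m B^T \in unitmx.
Proof.
move=> freeB; rewrite -row_free_unit; apply: inj_row_free => v vB.
apply: (row_free_inj freeB); rewrite mul0mx; apply: trmx_inj; rewrite trmx0.
apply: dotv_eq0; rewrite dotvE trmxK trmx_mul.
by rewrite -!mulmxA (mulmxA B) mulmxA vB mul0mx mxE.
Qed.

(** A rank factorization of the matrix gives its pseudoinverse explicitly. *)
Lemma mppinvP k l (A : 'M[R]_(k, l)) (X := mppinv A) :
  [/\ A *m X *m A = A, X *m A *m X = X,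
      (A *m X)^T = A *m X & (X *m A)^T = X *m A].
Proof.
rewrite /X /mppinv; case: xgetP => [Y _ //|noX]; exfalso; move: noX => {X}.
have [r [C [B [-> uB uC]]]] : exists r (C : 'M[R]_(k, r)) (B : 'M[R]_(r, l)),
    [/\ A = C *m B, B *m B^T \in unitmx & C^T *m C \in unitmx].
  exists (\rank A), (col_base A), (row_base A); split; first by rewrite mulmx_base.
    exact/gram_unitmx/row_base_free.
  rewrite -{2}(trmxK (col_base A)); apply: gram_unitmx.
  by rewrite /row_free mxrank_tr -/(row_full _) col_base_full.
set BB := B *m B^T in uB; set CC := C^T *m C in uC.
move=> /(_ (B^T *m invmx BB *m (invmx CC *m C^T))); apply.
have AX : C *m B *m (B^T *m invmx BB *m (invmx CC *m C^T)) = C *m (invmx CC *m C^T).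
  by rewrite -!mulmxA (mulmxA B) -/BB (mulmxA BB) mulmxV // mul1mx.
have XA : B^T *m invmx BB *m (invmx CC *m C^T) *m (C *m B) = B^T *m invmx BB *m B.
  by rewrite -!mulmxA (mulmxA C^T) -/CC (mulmxA (invmx CC)) mulVmx // mul1mx.
have symI j (D : 'M[R]_(j, j)) : D^T = D -> (invmx D)^T = invmx D.
  by move=> DT; rewrite trmx_inv DT.
have symBB : BB^T = BB by rewrite trmx_mul trmxK.
have symCC : CC^T = CC by rewrite trmx_mul trmxK.
split => /=.
- by rewrite AX -!mulmxA (mulmxA C^T) -/CC (mulmxA (invmx CC)) mulVmx // mul1mx.
- by rewrite XA -!mulmxA (mulmxA B) -/BB (mulmxA BB) mulmxV // mul1mx.
- by rewrite AX !trmx_mul trmxK symI // mulmxA.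
- by rewrite XA !trmx_mul trmxK symI // mulmxA.
Qed.

Lemma mppinv_tr_mulmx k l (A : 'M[R]_(k, l)) : mppinv A^T *m A^T *m A = A.
Proof.
have [AGA _ _] := mppinvP A^T; move: (mppinv A^T) AGA => G AGA symGA.
by rewrite -symGA trmx_mul trmxK -mulmxA -[in RHS](trmxK A) -AGA !trmx_mul trmxK !mulmxA.
Qed.

End PositiveDefinite.

(** * Riesz representation by minimizing sequences *)

Section AbstractRiesz.
Context (R : realType) (V : lmodType R) (L : set V) (B : V -> V -> R) (phi : V -> R).
Hypothesis L0 : L 0.
Hypothesis LD : forall x y, L x -> L y -> L (x + y).
Hypothesis LZ : forall a x, L x -> L (a *: x).
Hypothesis BC : forall x y, B x y = B y x.
Hypothesis BD : forall x y z, L x -> L y -> L z -> B (x + y) z = B x z + B y z.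
Hypothesis BZ : forall a x z, L x -> L z -> B (a *: x) z = a * B x z.
Hypothesis B_ge0 : forall x, L x -> 0 <= B x x.
Hypothesis phiD : forall x y, L x -> L y -> phi (x + y) = phi x + phi y.
Hypothesis phiZ : forall a x, L x -> phi (a *: x) = a * phi x.

(** Take [h] minimizing for the energy [B x x / 2 - phi x]. It is Cauchy by the
    parallelogram identity, and the first variation of the energy vanishes in the
    limit, so that [B (h k)] tends to [phi]. The rates are explicit because the
    limit is taken with [riesz_fischer], which needs fast convergence. *)
Lemma riesz_minimizing_sequence (c : R) (e : nat -> R) : 0 <= c ->
  (forall x, L x -> phi x ^+ 2 <= c * B x x) ->
  (forall k, 0 < e k) -> (forall k, e k.+1 <= e k) ->
  exists h : nat -> V, [/\ forall k, L (h k),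
    forall k, B (h k.+1 - h k) (h k.+1 - h k) <= 8 * e k &
    forall k x, L x -> (B (h k) x - phi x) ^+ 2 <= 2 * e k * B x x].
Proof.
move=> c0 phic e0 e_ni.
pose J x := B x x / 2 - phi x.
have BDr x y z : L x -> L y -> L z -> B x (y + z) = B x y + B x z.
  by move=> Lx Ly Lz; rewrite BC BD // !(BC _ x).
have BZr a x y : L x -> L y -> B x (a *: y) = a * B x y.
  by move=> Lx Ly; rewrite BC BZ // (BC _ x).
have Bsqr a x y : L x -> L y ->
    B (x + a *: y) (x + a *: y) = B x x + 2 * a * B x y + a ^+ 2 * B y y.
  move=> Lx Ly; have Lay := LZ a Ly; rewrite BDr ?BD ?BZr ?BZ //; last exact: LD.
  by rewrite (BC y x); ring.
have J_lb x : L x -> - (c / 2) <= J x.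
  move=> Lx; have Bx := B_ge0 Lx.
  suff : phi x <= (B x x + c) / 2 by rewrite /J; lra.
  apply: (le_trans (ler_norm _)).
  rewrite -ler_sqr ?nnegrE ?divr_ge0 ?addr_ge0 // real_normK ?num_real //.
  by apply: (le_trans (phic x Lx)); have := sqr_ge0 ((B x x - c) / 2); lra.
have infJ : has_inf [set J x | x in L].
  split; first by exists (J 0), 0.
  by exists (- (c / 2)) => _ [x Lx <-]; exact: J_lb.
set I := inf [set J x | x in L].
have IJ x : L x -> I <= J x by move=> Lx; apply: ge_inf; [case: infJ | exists x].
have near_min k : exists x, L x /\ J x < I + e k.
  by have [_ [x Lx <-] xI] := inf_adherent (e0 k) infJ; exists x.
have [h hP] := choice near_min.
exists h; split=> [k|k|k x Lx]; first by case: (hP k).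
  have [L1 J1] := hP k.+1; have [L2 J2] := hP k.
  have := IJ _ (LZ 2^-1 (LD L1 L2)).
  have := Bsqr 1 _ _ L1 L2; rewrite scale1r => B_sum.
  rewrite /J BZr ?BZ ?B_sum ?phiZ ?phiD //; do ?[exact: LD | exact/LZ/LD].
  rewrite -(scaleN1r (h k)) Bsqr //.
  by move: J1 J2; rewrite /J; have := e_ni k; lra.
have [Lh Jh] := hP k; set b := B (h k) x - phi x.
have var a : 0 <= a ^+ 2 * B x x + 2 * a * b + 2 * e k.
  have := IJ _ (LD Lh (LZ a Lx)).
  rewrite /J Bsqr // phiD ?phiZ //; last exact: LZ.
  by move: Jh; rewrite /J /b; lra.
have [B0|Bx] := eqVneq (B x x) 0.
  rewrite B0 mulr0; have [->|b0] := eqVneq b 0; first by rewrite expr0n.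
  have := var (- (e k + 1) / b); rewrite B0 mulr0 add0r mulrA divfK //.
  by have := e0 k; lra.
have Bp : 0 < B x x by rewrite lt_def Bx B_ge0.
have := var (- b / B x x); rewrite -(ler_pM2r Bp) mul0r.
have -> : ((- b / B x x) ^+ 2 * B x x + 2 * (- b / B x x) * b + 2 * e k) * B x x
  = 2 * e k * B x x - b ^+ 2 by field.
by rewrite subr_ge0.
Qed.

End AbstractRiesz.

(** * Absolutely continuous functions *)

Section AbsolutelyContinuous.
Context (R : realType) (t0 T : R).
Implicit Types f g : R -> R.
Local Notation mu := (@lebesgue_measure R).
Local Notation D := `[t0, T]%classic.

(** The scalar form of [abs_continuous]: vector functions are handled one
    coordinate at a time. *)
Definition ac g := forall e : R, 0 < e -> exists2 d : R, 0 < d &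
  forall (N : nat) (a b : 'I_N -> R),
    (forall i, [/\ t0 <= a i, a i <= b i & b i <= T]) ->
    trivIset setT (fun i => [set` `]a i, b i[]) ->
    \sum_(i < N) (b i - a i) < d ->
    \sum_(i < N) `|g (b i) - g (a i)| < e.

Lemma ac_uniform g : ac g -> forall e, 0 < e -> exists2 d, 0 < d &
  forall a b, t0 <= a -> a <= b -> b <= T -> b - a < d -> `|g b - g a| < e.
Proof.
move=> acg e /acg[d d0 dP]; exists d => // a b ta ab bT bad.
have := dP 1%N (fun=> a) (fun=> b); rewrite !big_ord1; apply => //.
by move=> i j _ _ _; rewrite !ord1.
Qed.

Lemma acZ c g : ac g -> ac (fun t => c * g t).
Proof.
move=> acg e e0; have [|d d0 dP] := acg (e / (`|c| + 1)).
  by rewrite divr_gt0 // ltr_wpDl.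
exists d => // N a b abP ab_disj abd.
under eq_bigr do rewrite -mulrBr normrM.
rewrite -mulr_sumr; have := dP N a b abP ab_disj abd.
rewrite ltr_pdivlMr ?ltr_wpDl // mulrC; apply: le_lt_trans.
by rewrite ler_wpM2r ?lerDl ?sumr_ge0.
Qed.

Lemma acD f g : ac f -> ac g -> ac (fun t => f t + g t).
Proof.
move=> acf acg e e0; have e20 : 0 < e / 2 by rewrite divr_gt0.
have [d d0 dP] := acf _ e20; have [d' d'0 d'P] := acg _ e20.
exists (Num.min d d'); first by rewrite lt_min d0.
move=> N a b abP ab_disj; rewrite lt_min => /andP[abd abd'].
rewrite [e]splitr.
apply: le_lt_trans (ltrD (dP N a b abP ab_disj abd) (d'P N a b abP ab_disj abd')).
rewrite -big_split; apply: ler_sum => i _; apply: le_trans (ler_normD _ _).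
by rewrite le_eqVlt; apply/orP; left; apply/eqP; congr (`| _ |); ring.
Qed.

Lemma acN g : ac g -> ac (fun t => - g t).
Proof.
move=> acg; have := acZ (-1) acg.
by under eq_fun do rewrite mulN1r.
Qed.

Lemma acB f g : ac f -> ac g -> ac (fun t => f t - g t).
Proof. by move=> acf acg; apply: acD acf (acN acg). Qed.

Lemma ac_cst c : ac (fun=> c).
Proof.
move=> e e0; exists 1 => // N a b _ _ _.
by rewrite big1 // => i _; rewrite subrr normr0.
Qed.

Lemma ac_sum (I : Type) (r : seq I) (G : I -> R -> R) :
  (forall i, ac (G i)) -> ac (fun t => \sum_(i <- r) G i t).
Proof.
move=> acG; elim: r => [|i r IHr].
  rewrite (_ : (fun t => _) = fun=> 0); first exact: ac_cst.
  by apply/funext => t; rewrite big_nil.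
rewrite (_ : (fun t => _) = fun t => G i t + \sum_(j <- r) G j t); first exact: acD.
by apply/funext => t; rewrite big_cons.
Qed.

Lemma ac_continuous g : ac g -> {within D, continuous g}.
Proof.
move=> /ac_uniform acg; apply/subspace_continuousP => x; rewrite /= in_itv /= => /andP[tx xT].
apply/cvgrPdist_lt => e /acg[d d0 dP].
rewrite near_withinE; near=> y; rewrite /= in_itv /= => /andP[ty yT].
have : `|x - y| < d by near: y; exact: nbhsx_ballx.
have [xy|/ltW yx] := leP x y.
  rewrite distrC ger0_norm ?subr_ge0 // => /dP; rewrite distrC; exact.
by rewrite ger0_norm ?subr_ge0 // => /dP; exact.
Unshelve. all: by end_near. Qed.

Lemma within_continuous_bounded g : {within D, continuous g} ->
  exists2 M, 0 < M & forall t, D t -> `|g t| <= M.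
Proof.
move=> gc; have := continuous_compact gc (@segment_compact _ t0 T).
move=> /compact_bounded[M [_ MP]]; exists (`|M| + 1); first by rewrite ltr_wpDl.
move=> t Dt; apply: MP; last by exists t.
by rewrite (le_lt_trans (ler_norm M)) ?ltrDl.
Qed.

Lemma acM f g : ac f -> ac g -> ac (fun t => f t * g t).
Proof.
move=> acf acg e e0.
have [Mf Mf0 fM] := within_continuous_bounded (ac_continuous acf).
have [Mg Mg0 gM] := within_continuous_bounded (ac_continuous acg).
have [|d d0 dP] := acf (e / 2 / Mg); first by rewrite !divr_gt0.
have [|d' d'0 d'P] := acg (e / 2 / Mf); first by rewrite !divr_gt0.
exists (Num.min d d'); first by rewrite lt_min d0.
move=> N a b abP ab_disj; rewrite lt_min => /andP[abd abd'].
have := dP N a b abP ab_disj abd; rewrite ltr_pdivlMr // mulr_suml => hf.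
have := d'P N a b abP ab_disj abd'; rewrite ltr_pdivlMr // mulr_suml => hg.
rewrite [e]splitr.
apply: le_lt_trans (ltrD hf hg); rewrite -big_split; apply: ler_sum => i _ /=.
have [ta ab bT] := abP i.
have -> : f (b i) * g (b i) - f (a i) * g (a i) =
  (f (b i) - f (a i)) * g (b i) + (g (b i) - g (a i)) * f (a i) by ring.
apply: le_trans (ler_normD _ _) _; rewrite !normrM lerD // ler_wpM2l //.
  by apply: gM; rewrite /= in_itv /= bT (le_trans ta ab).
by apply: fM; rewrite /= in_itv /= ta (le_trans ab bT).
Qed.

(** Going from [t0] to [t], an interval inside [U] may be counted; [len] and [var]
    are the total length of the counted intervals and the total increment of [g]
    over them. Building the family of intervals from left to right makes it
    disjoint by construction. *)
Inductive sweep (U : set R) g : R -> R -> R -> Prop :=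
| sweep_start : sweep U g t0 0 0
| sweep_skip t t' len var : sweep U g t len var -> t <= t' ->
    sweep U g t' len var
| sweep_count t t' len var : sweep U g t len var -> t <= t' ->
    `]t, t'[ `<=` U ->
    sweep U g t' (len + (t' - t)) (var + `|g t' - g t|).

Lemma sweep_family U g t len var : sweep U g t len var ->
  t0 <= t /\ exists N (a b : nat -> R),
    [/\ forall i, (i < N)%N -> [/\ t0 <= a i, a i <= b i & b i <= t],
      forall i j, (i < N)%N -> (j < N)%N -> `]a i, b i[ `&` `]a j, b j[ !=set0 -> i = j,
      \sum_(i < N) (b i - a i) = len &
      \sum_(i < N) `|g (b i) - g (a i)| = var].
Proof.
elim=> {t len var} [|t t' len var _ [t0t [N [a [b [abP disj <- <-]]]]] tt'|
  t t' len var _ [t0t [N [a [b [abP disj <- <-]]]]] tt' _].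
- split=> //; exists 0%N, (fun=> 0), (fun=> 0).
  by split=> //; rewrite big_ord0.
- split; first exact: le_trans tt'.
  exists N, a, b; split=> // i /abP[? ? ?]; split => //; exact: le_trans tt'.
split; first exact: le_trans tt'.
exists N.+1, (fun i => if i == N then t else a i), (fun i => if i == N then t' else b i).
split.
- move=> i; rewrite ltnS leq_eqVlt; case: eqP => [_ _|_ /= /abP[? ? ?]] //.
  by split => //; exact: le_trans tt'.
- move=> i j; rewrite !ltnS (leq_eqVlt i) (leq_eqVlt j); case: eqP => [->|_] /=; case: eqP => [->|_] //=.
  + move=> _ /abP[_ _ bt] [x []]; rewrite /= !in_itv /= => /andP[tx _] /andP[_ xb].
    by have := lt_trans tx xb; rewrite ltNge bt.
  + move=> /abP[_ _ bt] _ [x []]; rewrite /= !in_itv /= => /andP[_ xb] /andP[tx _].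
    by have := lt_trans tx xb; rewrite ltNge bt.
  + exact: disj.
- rewrite big_ord_recr /= eqxx; congr (_ + _); apply: eq_bigr => i _.
  by rewrite ltn_eqF.
- rewrite big_ord_recr /= eqxx; congr (_ + _); apply: eq_bigr => i _.
  by rewrite ltn_eqF.
Qed.

Lemma sweep_len_le (U : set R) g t len var : open U -> sweep U g t len var ->
  (len%:E <= mu (U `&` `]t0, t]))%E.
Proof.
move=> oU sw; have mU : measurable U by exact: open_measurable.
elim: sw => {t len var} [|t t' len var sw IH tt'|t t' len var sw IH tt' tU].
- exact: measure_ge0.
- apply: (le_trans IH); apply: le_measure; rewrite ?inE; do ?exact: measurableI.
  by apply: setIS => x; rewrite /= !in_itv /= => /andP[-> /le_trans]; exact.
have [t0t _] := sweep_family sw.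
have -> : (len + (t' - t))%:E = (len%:E + mu `]t, t'[)%E.
  rewrite lebesgue_measure_itv /= lte_fin; case: ltP => // t't.
  have -> : t' = t by apply: le_anti; rewrite t't tt'.
  by rewrite subrr addr0 adde0.
apply: (le_trans (leeD2r _ IH)); rewrite -measureU //; last 2 first.
- exact: measurableI.
- apply/seteqP; split => // x [[_]]; rewrite /= !in_itv /= => /andP[_ xt] /andP[tx _].
  by have := lt_le_trans tx xt; rewrite ltxx.
apply: le_measure; rewrite ?inE; first by apply: measurableU => //; exact: measurableI.
  exact: measurableI.
move=> x [[Ux]|xt]; rewrite /= in_itv /=.
  by move=> /andP[tx xt]; split => //; rewrite /= in_itv /= tx (le_trans xt tt').
split; first exact: tU.
by move: xt; rewrite /= !in_itv /= => /andP[tx xt']; rewrite (le_lt_trans t0t tx) ltW.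
Qed.

Lemma derive0_dist g (t e : R) : is_derive t 1 g 0 -> 0 < e ->
  exists2 d : R, 0 < d & forall y, `|y - t| < d -> `|g y - g t| <= e * `|y - t|.
Proof.
move=> [/cvg_ex[l gl] dg] e0.
have l0 : l = 0 by rewrite -dg; apply/esym/cvg_lim.
move: gl; rewrite {}l0 => /cvgrPdist_lt /(_ e e0).
rewrite near_withinE => /nbhs_ballP[d /= d0 dP]; exists d => // y yt.
have [->|neq] := eqVneq y t; first by rewrite !subrr normr0 mulr0.
have yt0 : y - t != 0 by rewrite subr_eq0.
have := dP (y - t); rewrite /ball /= sub0r normrN => /(_ yt yt0).
rewrite sub0r normrN normrZ normfV /= /shift /= scaler1 subrK.
by rewrite ltr_pdivrMl ?normr_gt0 // mulrC => /ltW.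
Qed.

End AbsolutelyContinuous.

Section FTC.
Context (R : realType) (t0 T : R).
Implicit Types f g : R -> R.
Local Notation mu := (@lebesgue_measure R).
Local Notation D := `[t0, T]%classic.

(** A null set is covered by an open set too small for an absolutely continuous
    function to vary on it, and off that null set the slope is negligible at
    small scale. A point up to which the increment of [g] is controlled by a
    sweep of that open set can therefore always be pushed further right, so the
    supremum of such points is the right end. *)
Lemma ac_derive0_eq g : t0 <= T -> ac t0 T g ->
  {ae mu, forall t, D t -> is_derive t 1 g 0} -> g T = g t0.
Proof.
move=> tT acg /negligible_outer_measure outer0.
suff key (e : R) : 0 < e -> `|g T - g t0| <= e * (T - t0) + e.
  apply/eqP; rewrite -subr_eq0 -normr_le0; apply/ler_addgt0Pr => e e0.
  have tT1 : 0 < T - t0 + 1 by rewrite ltr_wpDl // subr_ge0.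
  rewrite add0r; apply: (le_trans (key (e / (T - t0 + 1)) _)); first exact: divr_gt0.
  by rewrite -[X in _ + X]mulr1 -mulrDr divfK // gt_eqF.
move=> e0; have [d d0 dP] := acg e e0.
have [|U [oU AU Ud]] := outer_measure_open_le (~` [set t | D t -> is_derive t 1 g 0]) (_ : 0 < d / 2).
  exact: divr_gt0.
rewrite outer0 add0r in Ud.
have good x : D x -> exists2 r : R, 0 < r & forall a b, a <= x -> x <= b ->
    x - r < a -> b < x + r -> `|g b - g a| <= e * (b - a) \/ `]a, b[ `<=` U.
  move=> Dx; have [dx|ndx] := pselect (is_derive x 1 g 0).
    have [r r0 rP] := derive0_dist dx e0; exists r => // a b ax xb ra br; left.
    have ga : `|g a - g x| <= e * (x - a).
      by rewrite -(@ger0_norm _ (x - a)) ?subr_ge0 // (distrC x); apply: rP;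
        rewrite distrC ger0_norm ?subr_ge0 // ltrBlDr -ltrBlDl.
    have gb : `|g b - g x| <= e * (b - x).
      rewrite -(@ger0_norm _ (b - x)) ?subr_ge0 //; apply: rP.
      by rewrite ger0_norm ?subr_ge0 // ltrBlDl.
    rewrite (_ : b - a = (b - x) + (x - a)); last by ring.
    rewrite mulrDr -(subrKA (g x)); apply: (le_trans (ler_normD _ _)).
    by rewrite lerD // distrC.
  have : U x by apply: AU => /= /(_ Dx).
  move=> /oU /nbhs_ballP[r /= r0 rU]; exists r => // a b ax xb ra br; right.
  move=> y /=; rewrite in_itv /= => /andP[ay yb]; apply: rU.
  rewrite /ball /= ltr_norml; apply/andP; split; lra.
pose S := [set t | t0 <= t <= T /\ exists len var, sweep t0 U g t len var /\
  `|g t - g t0| <= e * (t - t0) + var].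
have St0 : S t0.
  split; first by rewrite lexx.
  exists 0, 0; split; first exact: sweep_start.
  by rewrite !subrr normr0 mulr0 addr0.
have step x y : S x -> x <= y -> y <= T ->
    (`|g y - g x| <= e * (y - x) \/ `]x, y[ `<=` U) -> S y.
  move=> [/andP[t0x xT] [len [var [sw gx]]]] xy yT gU.
  split; first by rewrite yT (le_trans t0x).
  have gy : `|g y - g t0| <= `|g y - g x| + `|g x - g t0|.
    by rewrite -(subrKA (g x)) ler_normD.
  case: gU => [gxy|xyU].
    exists len, var; split; first exact: sweep_skip xy.
    apply: (le_trans gy); lra.
  exists (len + (y - x)), (var + `|g y - g x|).
  split; first exact: sweep_count.
  have : 0 <= e * (y - x) by rewrite mulr_ge0 ?subr_ge0 // ltW.
  lra.
have supS : has_sup S.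
  by split; [exists t0 | exists T => x [/andP[]]].
set s := sup S.
have t0s : t0 <= s by apply: ub_le_sup => //; case: supS.
have sT : s <= T by apply: ge_sup; [exists t0 | move=> x [/andP[]]].
have Ds : D s by rewrite /= in_itv /= t0s.
have [r r0 rP] := good s Ds.
have [x Sx sx] : exists2 x, S x & s - r < x.
  by have [x Sx sx] := sup_adherent r0 supS; exists x.
have xs : x <= s by apply: ub_le_sup => //; case: supS.
pose y := Num.min T (s + r / 2).
have sy : s <= y by rewrite le_min sT lerDl divr_ge0 // ltW.
have Sy : S y.
  apply: (step x) => //; [exact: le_trans sy | by rewrite ge_min lexx |].
  by apply: rP => //; rewrite gt_min ltrD2l; apply/orP; right; lra.
have yT : y = T.
  have : y <= s by apply: ub_le_sup => //; case: supS.
  by rewrite ge_min => /orP[Ts|]; [apply/le_anti; rewrite ge_min lexx /= (le_trans Ts) |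
    rewrite gerDl leNgt divr_gt0].
have [_ [len [var [sw gT]]]] := Sy; rewrite yT in sw gT.
apply: (le_trans gT); rewrite lerD2l.
have [_ [N [a [b [abP disj lenE <-]]]]] := sweep_family sw.
have lend : len < d.
  rewrite -lte_fin; apply: (le_lt_trans (sweep_len_le oU sw)).
  apply: (@le_lt_trans _ _ (mu U)).
    apply: le_measure; rewrite ?inE; [|exact: open_measurable|exact: subIsetl].
    by apply: measurableI => //; exact: open_measurable.
  by apply: (le_lt_trans Ud); rewrite lte_fin; lra.
apply/ltW/dP.
- by move=> i; have := abP i (ltn_ord i).
- by move=> i j _ _ /(disj i j (ltn_ord i) (ltn_ord j)) /val_inj.
- by rewrite lenE.
Qed.

End FTC.

(** * Square-integrable functions and their primitives *)

Section RealIntegrable.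
Context d (X : measurableType d) (R : realType) (mu : {measure set X -> \bar R}).
Context (A : set X) (mA : measurable A).
Implicit Types f g : X -> R.

Lemma integrable_dominated f g : measurable_fun A f ->
  mu.-integrable A (EFin \o g) -> (forall t, A t -> `|f t| <= g t) ->
  mu.-integrable A (EFin \o f).
Proof.
move=> mf ig fg; apply: le_integrable ig => //.
  exact/measurable_EFinP.
by move=> t At; rewrite /= lee_fin (le_trans (fg t At)) // ler_norm.
Qed.

Lemma integrable_add f g :
  mu.-integrable A (EFin \o f) -> mu.-integrable A (EFin \o g) ->
  mu.-integrable A (EFin \o (fun t => f t + g t)).
Proof.
move=> fi gi; rewrite (_ : EFin \o _ = (EFin \o f) \+ (EFin \o g)) //.
exact: integrableD.
Qed.

Lemma integrable_scale c f :
  mu.-integrable A (EFin \o f) -> mu.-integrable A (EFin \o (fun t => c * f t)).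
Proof.
move=> fi; rewrite (_ : EFin \o _ = (fun t => c%:E * (EFin \o f) t)%E) //.
exact: integrableZl.
Qed.

Lemma integrable_sum_fin (I : Type) (r : seq I) (G : I -> X -> R) :
  (forall i, mu.-integrable A (EFin \o G i)) ->
  mu.-integrable A (EFin \o (fun t => \sum_(i <- r) G i t)).
Proof.
move=> Gi; elim: r => [|i r IHr].
  rewrite (_ : EFin \o _ = cst 0%E); first exact: integrable0.
  by apply/funext => t; rewrite /= big_nil.
rewrite (_ : (fun t => _) = fun t => G i t + \sum_(j <- r) G j t).
  exact: integrable_add.
by apply/funext => t; rewrite big_cons.
Qed.

Lemma Rintegral_sum (I : Type) (r : seq I) (G : I -> X -> R) :
  (forall i, mu.-integrable A (EFin \o G i)) ->
  \int[mu]_(t in A) (\sum_(i <- r) G i t) = \sum_(i <- r) \int[mu]_(t in A) G i t.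
Proof.
move=> Gi; elim: r => [|i r IHr].
  by under eq_Rintegral do rewrite big_nil; rewrite Rintegral_cst // mul0r big_nil.
under eq_Rintegral do rewrite big_cons.
by rewrite big_cons RintegralD // ?IHr //; exact: integrable_sum_fin.
Qed.

Lemma integrable_mul f g : measurable_fun A f -> measurable_fun A g ->
  mu.-integrable A (EFin \o (fun t => f t ^+ 2)) ->
  mu.-integrable A (EFin \o (fun t => g t ^+ 2)) ->
  mu.-integrable A (EFin \o (fun t => f t * g t)).
Proof.
move=> mf mg f2 g2; apply: integrable_dominated (integrable_add f2 g2) _.
  exact: measurable_funM.
move=> t _; rewrite normrM.
rewrite -[f t ^+ 2]real_normK ?num_real // -[g t ^+ 2]real_normK ?num_real //.
have := sqr_ge0 (`|f t| - `|g t|); have := normr_ge0 (f t); have := normr_ge0 (g t).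
nra.
Qed.

Lemma integrable_sqr f : measurable_fun A f ->
  (\int[mu]_(t in A) (f t ^+ 2)%:E < +oo)%E ->
  mu.-integrable A (EFin \o (fun t => f t ^+ 2)).
Proof.
move=> mf If; apply/integrableP; split.
  exact/measurable_EFinP/measurable_funX.
under eq_integral do rewrite /= ger0_norm ?sqr_ge0 //; exact: If.
Qed.

End RealIntegrable.

Section SquareIntegrable.
Context (R : realType) (t0 T : R).
Implicit Types f g : R -> R.
Local Notation mu := (@lebesgue_measure R).
Local Notation D := `[t0, T]%classic.

Lemma ae_imply (P Q : R -> Prop) : (forall t, P t -> Q t) ->
  {ae mu, forall t, P t} -> {ae mu, forall t, Q t}.
Proof. by move=> PQ; apply: filterS PQ; exact: (ae_filter_ringOfSetsType mu). Qed.

Lemma ae_imply2 (P Q S : R -> Prop) : (forall t, P t -> Q t -> S t) ->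
  {ae mu, forall t, P t} -> {ae mu, forall t, Q t} -> {ae mu, forall t, S t}.
Proof. by move=> PQ; apply: filterS2 PQ; exact: (ae_filter_ringOfSetsType mu). Qed.

Let mD : measurable (D : set (measurableTypeR R)) := measurable_itv _.

Definition sqint f :=
  measurable_fun D f /\ (\int[mu]_(t in D) (f t ^+ 2)%:E < +oo)%E.

Lemma itv_integrable_cst (a b : bool) (x y c : R) :
  mu.-integrable [set` Interval (BSide a x) (BSide b y)] (EFin \o cst c).
Proof.
apply: measurable_bounded_integrable => //=.
  rewrite lebesgue_measure_itv /=; case: ifP => _ //; rewrite -EFinB; exact: ltry.
exact: bounded_cst.
Qed.

Lemma sqint_sqr f : sqint f -> mu.-integrable D (EFin \o (fun t => f t ^+ 2)).
Proof. by move=> [mf If]; exact: integrable_sqr. Qed.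

Lemma sqint_dominated f g : measurable_fun D f ->
  mu.-integrable D (EFin \o g) -> (forall t, D t -> f t ^+ 2 <= g t) ->
  sqint f.
Proof.
move=> mf ig fg; split=> //.
have /integrableP[_] : mu.-integrable D (EFin \o (fun t => f t ^+ 2)).
  apply: integrable_dominated ig _ => //; first exact: measurable_funX.
  by move=> t Dt; rewrite ger0_norm ?sqr_ge0 // fg.
by under eq_integral do rewrite /= ger0_norm ?sqr_ge0 //.
Qed.

Lemma sqint_cst c : sqint (fun=> c).
Proof.
apply: (sqint_dominated _ (itv_integrable_cst _ _ _ _ (c ^+ 2))) => //.
Qed.

Lemma sqintM f g : sqint f -> sqint g ->
  mu.-integrable D (EFin \o (fun t => f t * g t)).
Proof.
by move=> sf sg; apply: integrable_mul; [|case: sf|case: sg|exact: sqint_sqr|exact: sqint_sqr].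
Qed.

Lemma sqint_integrable f : sqint f -> mu.-integrable D (EFin \o f).
Proof.
by move=> /(sqintM (sqint_cst 1)); apply: eq_integrable => // t _ /=; rewrite mul1r.
Qed.

Lemma sqintD f g : sqint f -> sqint g -> sqint (fun t => f t + g t).
Proof.
move=> sf sg; have [mf _] := sf; have [mg _] := sg.
apply: sqint_dominated (integrable_scale mD 2 (integrable_add mD (sqint_sqr sf) (sqint_sqr sg))) _.
  exact: measurable_funD.
by move=> t _; have := sqr_ge0 (f t - g t); nra.
Qed.

Lemma sqintM_bounded (c : R -> R) M f : measurable_fun D c ->
  (forall t, D t -> `|c t| <= M) -> sqint f -> sqint (fun t => c t * f t).
Proof.
move=> mc cM sf; have [mf _] := sf.
apply: sqint_dominated (integrable_scale mD (M ^+ 2) (sqint_sqr sf)) _.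
  exact: measurable_funM.
move=> t Dt; rewrite exprMn ler_wpM2r ?sqr_ge0 //.
rewrite -[c t ^+ 2]real_normK ?num_real //.
by rewrite ler_pXn2r ?nnegrE ?cM // (le_trans _ (cM t Dt)).
Qed.

Lemma sqintZ c f : sqint f -> sqint (fun t => c * f t).
Proof. by apply: (@sqintM_bounded _ `|c|). Qed.

Lemma sqintN f : sqint f -> sqint (fun t => - f t).
Proof. by move=> /(sqintZ (-1)); under eq_fun do rewrite mulN1r. Qed.

Lemma sqintB f g : sqint f -> sqint g -> sqint (fun t => f t - g t).
Proof. by move=> sf sg; apply: sqintD sf (sqintN sg). Qed.

Lemma sqint_sum (I : Type) (r : seq I) (G : I -> R -> R) :
  (forall i, sqint (G i)) -> sqint (fun t => \sum_(i <- r) G i t).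
Proof.
move=> sG; elim: r => [|i r IHr].
  rewrite (_ : (fun t => _) = fun=> 0); first exact: sqint_cst.
  by apply/funext => t; rewrite big_nil.
rewrite (_ : (fun t => _) = fun t => G i t + \sum_(j <- r) G j t); first exact: sqintD.
by apply/funext => t; rewrite big_cons.
Qed.

Lemma within_continuous_measurable g : {within D, continuous g} ->
  measurable_fun D g.
Proof. by move=> gc; apply: subspace_continuous_measurable_fun. Qed.

Lemma sqintM_continuous (c : R -> R) f : {within D, continuous c} ->
  sqint f -> sqint (fun t => c t * f t).
Proof.
move=> cc; have [M _ cM] := within_continuous_bounded cc.
apply: (sqintM_bounded (within_continuous_measurable cc) cM).
Qed.

Lemma sqint_continuous g : {within D, continuous g} -> sqint g.
Proof.
move=> /sqintM_continuous /(_ (sqint_cst 1)).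
by under eq_fun do rewrite mulr1.
Qed.

Lemma sqint_ac g : ac t0 T g -> sqint g.
Proof. by move=> /ac_continuous; exact: sqint_continuous. Qed.

Lemma eq_sqint f g : (forall t, D t -> f t = g t) -> sqint f -> sqint g.
Proof.
move=> fg [mf If]; split.
  by apply: eq_measurable_fun mf => t; rewrite inE; exact: fg.
congr (_ < _)%E: If; apply: eq_integral => t; rewrite inE => /fg -> //.
Qed.

(** The integrand is extended by zero, so that the primitive is defined, and
    differentiable almost everywhere, on both sides of the interval. *)
Definition primitive f (x : R) := \int[mu]_(t in `[t0, x]) (f \_ D) t.

Lemma restrict_integrable f (A : set R) : measurable A -> sqint f ->
  mu.-integrable A (EFin \o (f \_ D)).
Proof.
move=> mA /sqint_integrable fi.
apply: (@integrableS _ _ _ _ setT) => //.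
by rewrite -restrict_EFin; apply/integrable_restrict => //; rewrite setTI.
Qed.

Lemma primitive_start f : primitive f t0 = 0.
Proof. by rewrite /primitive set_itv1 Rintegral_set1. Qed.

Lemma primitive_end f : primitive f T = \int[mu]_(t in D) f t.
Proof. by rewrite /primitive; apply: eq_Rintegral => t tD; rewrite patchE tD. Qed.

Lemma primitive_derive f : sqint f ->
  {ae mu, forall t, D t -> is_derive t 1 (primitive f) (f t)}.
Proof.
move=> sf.
have neq : {ae mu, forall t, t <> t0}.
  exists [set t0]; split; [exact: measurable_set1|exact: lebesgue_measure_set1|].
  by move=> t /= /contrapT.
have := @FTC1 R (f \_ D) (BLeft t0) (fun y => restrict_integrable _ sf).
have int_loc : locally_integrable [set: R] (f \_ D).
  by apply: open_integrable_locally; [exact: openT|exact: restrict_integrable].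
move=> /(_ (fun=> measurable_itv _) int_loc); apply: ae_imply2 neq => t tt0 dt Dt.
have [|d1 d2] := dt.
  move: Dt; rewrite /= in_itv /= lte_fin lt_def => /andP[-> _].
  by rewrite andbT; apply/eqP.
apply: DeriveDef; first exact: d1.
by rewrite -derive1E d2 patchE mem_set.
Qed.

(** Young's inequality replaces the Cauchy-Schwarz inequality here: over a set of
    measure [d] the integral of [`|f|] is at most [x] times that of [f ^+ 2], plus
    [d / x]; first [x] is taken small, then [d]. *)
Lemma primitive_ac f : sqint f -> ac t0 T (primitive f).
Proof.
move=> sf e e0; pose w := f \_ D.
have wi A : measurable A -> mu.-integrable A (EFin \o w).
  by move=> mA; exact: restrict_integrable.
have w2i A : measurable A -> mu.-integrable A (EFin \o (fun t => w t ^+ 2)).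
  move=> mA; apply: (@integrableS _ _ _ _ setT) => //.
  have -> : EFin \o (fun t => w t ^+ 2) = (EFin \o (fun t => f t ^+ 2)) \_ D.
    by apply/funext => t; rewrite /= /w !patchE; case: ifP => // _; rewrite expr0n.
  by apply/integrable_restrict => //; rewrite setTI; exact: sqint_sqr.
pose I := \int[mu]_t (w t ^+ 2).
have I0 : 0 <= I by apply: Rintegral_ge0 => t _; exact: sqr_ge0.
have I1 : 0 < I + 1 by rewrite ltr_wpDl.
pose x := e / 2 / (I + 1); have x0 : 0 < x by rewrite !divr_gt0.
exists (x * (e / 2)); first by rewrite mulr_gt0 ?divr_gt0.
move=> N a b abP disj abd.
have incr i : `|primitive f (b i) - primitive f (a i)| <=
    x * \int[mu]_(t in `]a i, b i[) (w t ^+ 2) + x^-1 * (b i - a i).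
  have [ta ab bT] := abP i.
  rewrite /primitive Rintegral_itvB ?bnd_simp //; last exact: wi.
  rewrite -Rintegral_itv_bndo_bndc; last exact: wi.
  apply: (le_trans (le_normr_Rintegral _ _)) => //; first exact: wi.
  have -> : b i - a i = \int[mu]_(t in `]a i, b i[) 1.
    rewrite Rintegral_cst // mul1r [X in fine X]lebesgue_measure_itv /= lte_fin.
    by case: ltP => // ba; rewrite (@le_anti _ _ (a i) (b i)) ?ab // subrr.
  have i1 : mu.-integrable `]a i, b i[ (EFin \o cst 1).
    exact: itv_integrable_cst.
  rewrite -!RintegralZl //; last exact: w2i.
  have i1' : mu.-integrable `]a i, b i[ (EFin \o (fun t => x^-1 * 1)).
    exact: integrable_scale.
  have i2' : mu.-integrable `]a i, b i[ (EFin \o (fun t => x * w t ^+ 2)).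
    by apply: integrable_scale => //; exact: w2i.
  rewrite -RintegralD //; apply: le_Rintegral => //.
  - exact: integrable_norm (wi _ _).
  - exact: integrable_add.
  move=> t _; rewrite mulr1 -(ler_pM2l x0) mulrDr mulfV ?gt_eqF //.
  rewrite -[w t ^+ 2]real_normK ?num_real //.
  have := sqr_ge0 (x * `|w t| - 1); have := normr_ge0 (w t); nra.
apply: (le_lt_trans (ler_sum _ (fun i _ => incr i))).
rewrite big_split /= -!mulr_sumr [e]splitr.
apply: ler_ltD; last by rewrite ltr_pdivrMl // mulrC.
have IN : \sum_(i < N) \int[mu]_(t in `]a i, b i[) (w t ^+ 2) <= I.
  rewrite -lee_fin -sumEFin.
  have fineI A : measurable A -> (\int[mu]_(t in A) (w t ^+ 2))%:E = (\int[mu]_(t in A) (w t ^+ 2)%:E)%E.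
    by move=> mA; rewrite fineK //; exact: integrable_fin_num (w2i _ mA).
  rewrite fineI //; under eq_bigr do rewrite fineI //.
  rewrite -(@ge0_integral_bigsetU _ _ _ mu _ (fun i : 'I_N => `]a i, b i[%classic) (fun t => (w t ^+ 2)%:E)) //.
  - apply: ge0_subset_integral => //; first exact: bigsetU_measurable.
    + by have /measurable_int := w2i _ measurableT.
    + by move=> t _; rewrite lee_fin sqr_ge0.
  - exact: index_enum_uniq.
  - exact: sub_trivIset disj.
  - have /measurable_int := w2i _ measurableT; apply: measurable_funS => //.
  - by move=> t _; rewrite lee_fin sqr_ge0.
apply: (le_trans (ler_wpM2l (ltW x0) IN)).
rewrite /x mulrAC ler_pdivrMr // ler_pM2l ?divr_gt0 //.
by rewrite lerDl.
Qed.

(** Subtracting the primitive of the derivative leaves an absolutely continuous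
    function with zero derivative. *)
Lemma ac_FTC g f : t0 <= T -> ac t0 T g -> sqint f ->
  {ae mu, forall t, D t -> is_derive t 1 g (f t)} ->
  g T - g t0 = \int[mu]_(t in D) f t.
Proof.
move=> tT acg sf gf.
have := @ac_derive0_eq R t0 T (fun t => g t - primitive f t) tT.
rewrite primitive_start subr0 primitive_end => <-; first by ring.
  exact: acB (primitive_ac sf).
apply: ae_imply2 gf (primitive_derive sf) => t gt pt Dt.
by rewrite -(subrr (f t)); apply: is_deriveB (gt Dt) (pt Dt).
Qed.

Lemma ac_parts f f' g g' : t0 <= T -> ac t0 T f -> ac t0 T g ->
  sqint f' -> sqint g' ->
  {ae mu, forall t, D t -> is_derive t 1 f (f' t)} ->
  {ae mu, forall t, D t -> is_derive t 1 g (g' t)} ->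
  f T * g T - f t0 * g t0 = \int[mu]_(t in D) (f' t * g t + f t * g' t).
Proof.
move=> tT acf acg sf' sg' df dg.
apply: (@ac_FTC (fun t => f t * g t)) => //; first exact: acM.
  apply: sqintD; last exact/(sqintM_continuous (ac_continuous acf)).
  have := sqintM_continuous (ac_continuous acg) sf'.
  by under eq_fun do rewrite mulrC.
apply: ae_imply2 df dg => t ft gt Dt.
have := is_deriveM (ft Dt) (gt Dt).
by rewrite (mulrC (f' t)) addrC.
Qed.

End SquareIntegrable.

(** * The Riesz-Fischer theorem *)

Section RieszFischer.
Context (R : realType).
Local Notation half := (2^-1 : R).

(** The sequences [x k -+ 2 * r * half ^+ k] are monotone and enclose [x], so the
    limit is the supremum of the lower one. *)
Lemma geometric_nested_limit (x : nat -> R) (r : R) :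
  (forall k, `|x k.+1 - x k| <= r * half ^+ k) ->
  exists l, forall k, `|x k - l| <= 2 * r * half ^+ k.
Proof.
move=> xr; pose lo k := x k - 2 * r * half ^+ k; pose up k := x k + 2 * r * half ^+ k.
have r0 k : 0 <= r * half ^+ k := le_trans (normr_ge0 _) (xr k).
have lo_nd : {homo lo : i j / (i <= j)%N >-> i <= j}.
  apply: homo_leq => [||k]; [exact: lexx|exact: le_trans|].
  move: (xr k); rewrite /lo exprS ler_norml => /andP[]; lra.
have up_ni : {homo up : i j / (i <= j)%N >-> j <= i}.
  apply: (@homo_leq _ _ (fun a b => b <= a)) => [||k]; [exact: lexx|by move=> a b c ab /le_trans; apply|].
  move: (xr k); rewrite /up exprS ler_norml => /andP[]; lra.
have lo_up i j : lo i <= up j.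
  apply: (@le_trans _ _ (lo (maxn i j))); first exact/lo_nd/leq_maxl.
  apply: (@le_trans _ _ (up (maxn i j))); last exact/up_ni/leq_maxr.
  by rewrite /lo /up; have := r0 (maxn i j); lra.
have supE : has_sup (range lo).
  by split; [exists (lo 0%N), 0%N | exists (up 0%N) => _ [k _ <-]].
exists (sup (range lo)) => k; rewrite ler_norml; apply/andP; split.
  have : sup (range lo) <= up k by apply: ge_sup; [exists (lo 0%N), 0%N | move=> _ [j _ <-]].
  by rewrite /up; lra.
have : lo k <= sup (range lo) by apply: ub_le_sup; [case: supE | exists k].
by rewrite /lo; lra.
Qed.

Lemma geometric_nested_limit_sqr (x : nat -> R) (s : R) : 0 <= s ->
  (forall k, 4 ^+ k * (x k.+1 - x k) ^+ 2 <= s) ->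
  exists l, forall k, (x k - l) ^+ 2 <= 4 * (half ^+ k) ^+ 2 * s.
Proof.
move=> s0 xs; have [k|l lP] := @geometric_nested_limit x (Num.sqrt s).
  have h0 : 0 <= half ^+ k by rewrite exprn_ge0.
  rewrite -ler_sqr ?nnegrE ?mulr_ge0 ?sqrtr_ge0 // real_normK ?num_real //.
  rewrite exprMn sqr_sqrtr // -exprM mulnC exprM exprVn -natrX /=.
  by rewrite exprVn ler_pdivlMr ?exprn_gt0 // mulrC.
exists l => k; have h0 : 0 <= half ^+ k by rewrite exprn_ge0.
have := lP k; rewrite -ler_sqr ?nnegrE ?mulr_ge0 ?sqrtr_ge0 // real_normK ?num_real //.
by rewrite !exprMn sqr_sqrtr // -mulrA (mulrC s) mulrA (_ : 2 ^+ 2 = 4) // expr2; ring.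
Qed.

Context (t0 T : R).
Local Notation mu := (@lebesgue_measure R).
Local Notation D := `[t0, T]%classic.

(** The sum [S] of the squared increments weighted by powers of 4 is still
    integrable, hence finite almost everywhere. It bounds every tail
    geometrically, so it serves both for pointwise convergence and as a
    dominating function. *)
Lemma riesz_fischer (f : nat -> R -> R) (c : R) : (forall k, sqint t0 T (f k)) ->
  (forall k, \int[mu]_(t in D) (f k.+1 t - f k t) ^+ 2 <= c * (8^-1) ^+ k) ->
  exists2 g, sqint t0 T g &
    forall k, \int[mu]_(t in D) (f k t - g t) ^+ 2 <= 8 * c * (4^-1) ^+ k.
Proof.
move=> sf fc; have mf k := proj1 (sf k).
pose h k t : \bar R := (4 ^+ k * (f k.+1 t - f k t) ^+ 2)%:E.
have h0 k t : (0 <= h k t)%E by rewrite lee_fin mulr_ge0 ?sqr_ge0 ?exprn_ge0.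
have mh k : measurable_fun D (h k).
  by apply/measurable_EFinP/measurable_funM => //; apply/measurable_funX/measurable_funB.
pose S t : \bar R := (\sum_(k <oo) h k t)%E.
have S0 t : (0 <= S t)%E by apply: nneseries_ge0.
have mS : measurable_fun D S.
  exact: (@ge0_emeasurable_sum _ _ _ _ _ xpredT).
have IS : (\int[mu]_(t in D) S t <= (2 * c)%:E)%E.
  rewrite integral_nneseries //.
  have -> : (2 * c)%:E = (\sum_(k <oo) ((2 * c) / (2 ^ (k + 1))%:R)%:E)%E.
    by have := @cvg_geometric_eseries_half R (2 * c) 0; rewrite expr0 divr1 => /cvg_lim <- //.
  apply: lee_nneseries => [k _ _|k _]; first exact: integral_ge0.
  have sd := sqint_sqr (sqintB (sf k.+1) (sf k)).
  have -> : (\int[mu]_(t in D) h k t)%E = (4 ^+ k * \int[mu]_(t in D) (f k.+1 t - f k t) ^+ 2)%:E.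
    rewrite -RintegralZl // fineK //; apply: integrable_fin_num => //.
    exact: integrable_scale.
  rewrite lee_fin; apply: (le_trans (ler_wpM2l _ (fc k))); first exact: exprn_ge0.
  rewrite natrX addn1 exprS mulrCA -exprMn.
  rewrite (_ : 4 * 8^-1 = 2^-1 :> R); last by lra.
  by rewrite exprVn invfM mulrACA mulfV // mul1r.
have Sfin : {ae mu, forall t, D t -> S t \is a fin_num}.
  apply: integrable_ae => //; apply/integrableP; split=> //.
  under eq_integral do rewrite gee0_abs //.
  by apply: (le_lt_trans IS); rewrite ltry.
have [N [mN N0 subN]] := Sfin.
(* Zeroing the sequence on the null set where S is infinite makes it converge
   everywhere, which gives a measurable limit. *)
pose fN k t := f k t * \1_(~` N) t.
have NE t : D t -> ~ N t -> S t \is a fin_num.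
  by move=> Dt Nt; apply: contrapT => /= nS; apply: Nt; apply: subN => /(_ Dt).
have lim_ex t : exists l, D t -> forall k,
    (fN k t - l) ^+ 2 <= 4 * (half ^+ k) ^+ 2 * fine (S t).
  have [Nt|Nt] := pselect (N t).
    exists 0 => _ k; rewrite /fN indicE memNset ?mulr0 ?subr0 ?expr0n; last by move=> /(_ Nt).
    by rewrite !mulr_ge0 ?fine_ge0 ?exprn_ge0.
  have [Dt|nDt] := pselect (D t); last by exists 0.
  have fNE k : fN k t = f k t by rewrite /fN indicE mem_set // mulr1.
  have [k|l lP] := @geometric_nested_limit_sqr (fN ^~ t) _ (fine_ge0 (S0 t)).
    rewrite !fNE -lee_fin fineK; last exact: NE.
    apply: (le_trans _ (@nneseries_lim_ge _ (h ^~ t) xpredT 0 k.+1 _)) => //.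
    rewrite big_nat_recr //=; apply: leeDr; exact: sume_ge0.
  by exists l.
have [g gP] := choice lim_ex.
have mfN k : measurable_fun D (fN k).
  apply: measurable_funM => //; apply: measurable_indic; exact: measurableC.
have half_cvg : (fun k => half ^+ k) @ \oo --> 0.
  by apply: cvg_expr; rewrite ger0_norm ?invf_lt1 // ltr1n.
have mg : measurable_fun D g.
  apply: (measurable_fun_cvg mfN) => t Dt.
  apply/subr_cvg0/norm_cvg0P.
  pose r := 2 * Num.sqrt (fine (S t)).
  apply: (@squeeze_cvgr _ _ _ _ (fun=> 0) (fun k => half ^+ k * r)).
  - apply: nearW => k; rewrite normr_ge0 /=.
    have h0' : 0 <= half ^+ k by rewrite exprn_ge0.
    rewrite -ler_sqr ?nnegrE ?mulr_ge0 ?sqrtr_ge0 // real_normK ?num_real //.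
    rewrite /r !exprMn sqr_sqrtr ?fine_ge0 // (_ : 2 ^+ 2 = 4); last by rewrite expr2; ring.
    by rewrite mulrA (mulrC _ 4); exact: gP.
  - exact: cvg_cst.
  - by rewrite -[X in _ --> X](mul0r r); apply: cvgMl.
have c0 : 0 <= c.
  have := fc 0%N; rewrite expr0 mulr1; apply: le_trans.
  by apply: Rintegral_ge0 => t _; rewrite sqr_ge0.
have dist k : (\int[mu]_(t in D) ((f k t - g t) ^+ 2)%:E <= (8 * c * 4^-1 ^+ k)%:E)%E.
  have mfg : measurable_fun D (fun t => (f k t - g t) ^+ 2).
    by apply/measurable_funX/measurable_funB.
  have q0 : 0 <= 4 * (half ^+ k) ^+ 2 by rewrite mulr_ge0 ?sqr_ge0.
  apply: (@le_trans _ _ (\int[mu]_(t in D) ((4 * (half ^+ k) ^+ 2)%:E * S t))%E).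
    apply: ae_ge0_le_integral => //.
    - by move=> t _; rewrite lee_fin sqr_ge0.
    - exact/measurable_EFinP.
    - by move=> t _; rewrite mule_ge0.
    - exact: measurable_funeM.
    exists N; split => // t /= nt; apply: contrapT => Nt; apply: nt => Dt.
    rewrite -(fineK (NE t Dt Nt)) -EFinM lee_fin.
    by have := gP t Dt k; rewrite /fN indicE mem_set // mulr1.
  rewrite ge0_integralZl //; apply: (le_trans (lee_wpmul2l _ IS)) => //.
  rewrite -EFinM lee_fin -exprM mulnC exprM (_ : half ^+ 2 = 4^-1); last by lra.
  by rewrite le_eqVlt; apply/orP; left; apply/eqP; ring.
have sfg k : sqint t0 T (fun t => f k t - g t).
  by split; [exact: measurable_funB|exact: (le_lt_trans (dist k) (ltry _))].
exists g => [|k].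
  have := sqintB (sf 0%N) (sfg 0%N); apply: eq_sqint => t _; ring.
rewrite -lee_fin fineK //; exact: integrable_fin_num (sqint_sqr (sfg k)).
Qed.

End RieszFischer.

(** * Vector-valued functions *)

Section VectorFunctions.
Context (R : realType) (t0 T : R).
Local Notation mu := (@lebesgue_measure R).
Local Notation D := `[t0, T]%classic.

Lemma L2funP k (f : R -> 'cV[R]_k) :
  L2fun t0 T f <-> forall i, sqint t0 T (fun t => f t i 0).
Proof.
split=> [[mf If] i|sf].
  have mn : measurable_fun D (fun t => enorm (f t) ^+ 2).
    rewrite (_ : (fun t => _) = fun t => dotv (f t) (f t)).
      by apply: measurable_sum => j; exact: measurable_funM.
    by apply/funext => t; rewrite enorm_sqr.
  apply: (@sqint_dominated _ _ _ _ (fun t => enorm (f t) ^+ 2)) => //.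
    apply/integrableP; split; first exact/measurable_EFinP.
    by under eq_integral do rewrite /= ger0_norm ?sqr_ge0 //.
  move=> t _; rewrite enorm_sqr /dotv (bigD1 i) //= -expr2 lerDl.
  by apply: sumr_ge0 => j _; rewrite -expr2 sqr_ge0.
split=> [i|]; first by have [] := sf i.
under eq_integral do rewrite enorm_sqr /dotv -sumEFin.
rewrite integral_sum //; last first.
  by move=> i; apply: eq_integrable (sqint_sqr (sf i)) => // t _ /=; rewrite expr2.
apply: lte_sum_pinfty => i _; have [_] := sf i.
by congr (_ < _)%E; apply: eq_integral => t _; rewrite expr2.
Qed.

Lemma enorm_coord k (a : 'cV[R]_k) i : `|a i 0| <= enorm a.
Proof.
rewrite -ler_sqr ?nnegrE ?sqrtr_ge0 // real_normK ?num_real // enorm_sqr.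
rewrite /dotv (bigD1 i) //= -expr2 lerDl.
by apply: sumr_ge0 => j _; rewrite -expr2 sqr_ge0.
Qed.

Lemma enorm_le_sum k (a : 'cV[R]_k) : enorm a <= \sum_i `|a i 0|.
Proof.
have s0 : 0 <= \sum_i `|a i 0| by apply: sumr_ge0.
rewrite -ler_sqr ?nnegrE ?sqrtr_ge0 // enorm_sqr [leRHS]expr2 mulr_suml.
apply: ler_sum => i _; rewrite -expr2 -real_normK ?num_real // expr2.
by rewrite ler_wpM2l // (bigD1 i) //= lerDl sumr_ge0.
Qed.

(** The converse needs one threshold for all coordinates; the inverse of one plus
    the sum of the inverses lies below each of them. *)
Lemma abs_continuousP k (g : R -> 'cV[R]_k) :
  abs_continuous t0 T g <-> forall i, ac t0 T (fun t => g t i 0).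
Proof.
split=> [acg i e /acg[d d0 dP]|acg e e0].
  exists d => // N a b abP disj abd; apply: le_lt_trans (dP N a b abP disj abd).
  by apply: ler_sum => j _; have := enorm_coord (g (b j) - g (a j)) i; rewrite !mxE.
have k0 : 0 < k.+1%:R :> R by rewrite ltr0n.
have e1 : 0 < e / k.+1%:R by rewrite divr_gt0.
have /choice[d dP] i : exists d, 0 < d /\ forall (N : nat) (a b : 'I_N -> R),
    (forall i, [/\ t0 <= a i, a i <= b i & b i <= T]) ->
    trivIset setT (fun i => [set` `]a i, b i[]) ->
    \sum_(i < N) (b i - a i) < d ->
    \sum_(j < N) `|g (b j) i 0 - g (a j) i 0| < e / k.+1%:R.
  by have [d d0 dP] := acg i _ e1; exists d.
have s0 : 0 < 1 + \sum_i (d i)^-1.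
  by rewrite ltr_pwDl // sumr_ge0 // => i _; rewrite invr_ge0 ltW //; have [] := dP i.
exists (1 + \sum_i (d i)^-1)^-1; first by rewrite invr_gt0.
move=> N a b abP disj abd.
apply: (@le_lt_trans _ _ (\sum_(i < k) \sum_(j < N) `|g (b j) i 0 - g (a j) i 0|)).
  rewrite exchange_big; apply: ler_sum => j _; apply: (le_trans (enorm_le_sum _)).
  by apply: ler_sum => i _; rewrite !mxE.
apply: (@le_lt_trans _ _ (\sum_(i < k) e / k.+1%:R)).
  apply: ler_sum => i _; apply/ltW; have [d0 dPi] := dP i.
  apply: dPi => //; apply: (lt_le_trans abd); rewrite invf_ple ?posrE //.
  rewrite (bigD1 i) //= addrCA lerDl addr_ge0 ?sumr_ge0 // => j _.
  by rewrite invr_ge0 ltW //; have [] := dP j.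
rewrite sumr_const card_ord -[_ *+ k]mulr_natr -mulrA gtr_pMr //.
by rewrite mulrC ltr_pdivrMr // mul1r ltr_nat.
Qed.

Lemma ae_derivativeP k (g w : R -> 'cV[R]_k) :
  ae_derivative t0 T g w <-> forall i,
    {ae mu, forall t, D t -> is_derive t 1 (fun s => g s i 0) (w t i 0)}.
Proof.
split=> [gw i|gw]; first by apply: ae_imply gw => t gt Dt; exact: gt.
have := @filter_forall R _ (fun i t => D t -> is_derive t 1 (fun s => g s i 0) (w t i 0)) _
  (ae_filter_ringOfSetsType mu) gw.
by apply: ae_imply => t gt Dt i; exact: gt.
Qed.

Lemma continuous_entry k l (A : R -> 'M[R]_(k, l)) i j :
  {within D, continuous A} -> {within D, continuous (fun t => A t i j)}.
Proof.
move=> Ac t; have := @continuous_comp _ _ _ (A : subspace D -> _) (fun M : 'M[R]_(k, l) => M i j).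
by apply; [exact: Ac | exact: coord_continuous].
Qed.

Lemma L2fun_mulmx_entries k l (A : R -> 'M[R]_(k, l)) f :
  (forall i j, {within D, continuous (fun t => A t i j)}) ->
  L2fun t0 T f -> L2fun t0 T (fun t => A t *m f t).
Proof.
move=> Ac /L2funP sf; apply/L2funP => i.
under eq_fun do rewrite mxE; apply: sqint_sum => j.
exact: sqintM_continuous.
Qed.

Lemma L2fun_mulmx k l (A : R -> 'M[R]_(k, l)) f :
  {within D, continuous A} -> L2fun t0 T f -> L2fun t0 T (fun t => A t *m f t).
Proof. by move=> Ac; apply: L2fun_mulmx_entries => i j; exact: continuous_entry. Qed.

Lemma L2fun_trmulmx k l (A : R -> 'M[R]_(k, l)) f :
  {within D, continuous A} -> L2fun t0 T f -> L2fun t0 T (fun t => (A t)^T *m f t).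
Proof.
move=> Ac; apply: L2fun_mulmx_entries => i j.
have -> : (fun t => (A t)^T i j) = (fun t => A t j i) by apply/funext => t; rewrite mxE.
exact: continuous_entry.
Qed.

Lemma L2funD k (f g : R -> 'cV[R]_k) :
  L2fun t0 T f -> L2fun t0 T g -> L2fun t0 T (fun t => f t + g t).
Proof.
move=> /L2funP sf /L2funP sg; apply/L2funP => i.
by under eq_fun do rewrite mxE; exact: sqintD.
Qed.

Lemma L2funZ k c (f : R -> 'cV[R]_k) :
  L2fun t0 T f -> L2fun t0 T (fun t => c *: f t).
Proof.
move=> /L2funP sf; apply/L2funP => i.
by under eq_fun do rewrite mxE; exact: sqintZ.
Qed.

Lemma L2funN k (f : R -> 'cV[R]_k) : L2fun t0 T f -> L2fun t0 T (fun t => - f t).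
Proof. by move=> /(L2funZ (-1)); under eq_fun do rewrite scaleN1r. Qed.

Lemma L2funB k (f g : R -> 'cV[R]_k) :
  L2fun t0 T f -> L2fun t0 T g -> L2fun t0 T (fun t => f t - g t).
Proof. by move=> sf sg; apply: L2funD sf (L2funN sg). Qed.

Lemma L2fun_cst k (a : 'cV[R]_k) : L2fun t0 T (fun=> a).
Proof. by apply/L2funP => i; exact: sqint_cst. Qed.

Definition L2dot k (f g : R -> 'cV[R]_k) := \int[mu]_(t in D) dotv (f t) (g t).

Lemma dotv_integrable k (f g : R -> 'cV[R]_k) : L2fun t0 T f -> L2fun t0 T g ->
  mu.-integrable D (EFin \o (fun t => dotv (f t) (g t))).
Proof.
by move=> /L2funP sf /L2funP sg; apply: integrable_sum_fin => [|i]; [exact: measurable_itv|exact: sqintM].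
Qed.

Lemma L2dotC k (f g : R -> 'cV[R]_k) : L2dot f g = L2dot g f.
Proof. by apply: eq_Rintegral => t _; rewrite dotvC. Qed.

Lemma L2dotDl k (f g h : R -> 'cV[R]_k) : L2fun t0 T f -> L2fun t0 T g ->
  L2fun t0 T h -> L2dot (fun t => f t + g t) h = L2dot f h + L2dot g h.
Proof.
move=> sf sg sh; rewrite /L2dot -RintegralD //; try exact: dotv_integrable.
by apply: eq_Rintegral => t _; rewrite dotvDl.
Qed.

Lemma L2dotZl k c (f h : R -> 'cV[R]_k) : L2fun t0 T f -> L2fun t0 T h ->
  L2dot (fun t => c *: f t) h = c * L2dot f h.
Proof.
move=> sf sh; rewrite /L2dot -RintegralZl //; last exact: dotv_integrable.
by apply: eq_Rintegral => t _; rewrite dotvZl.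
Qed.

Lemma L2dotBl k (f g h : R -> 'cV[R]_k) : L2fun t0 T f -> L2fun t0 T g ->
  L2fun t0 T h -> L2dot (fun t => f t - g t) h = L2dot f h - L2dot g h.
Proof.
move=> sf sg sh; rewrite /L2dot -RintegralB //; try exact: dotv_integrable.
by apply: eq_Rintegral => t _; rewrite dotvBl.
Qed.

Lemma L2dotDr k (f g h : R -> 'cV[R]_k) : L2fun t0 T f -> L2fun t0 T g ->
  L2fun t0 T h -> L2dot h (fun t => f t + g t) = L2dot h f + L2dot h g.
Proof. by move=> sf sg sh; rewrite !(L2dotC h) L2dotDl. Qed.

Lemma L2dotZr k c (f h : R -> 'cV[R]_k) : L2fun t0 T f -> L2fun t0 T h ->
  L2dot h (fun t => c *: f t) = c * L2dot h f.
Proof. by move=> sf sh; rewrite !(L2dotC h) L2dotZl. Qed.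

Lemma L2dotBr k (f g h : R -> 'cV[R]_k) : L2fun t0 T f -> L2fun t0 T g ->
  L2fun t0 T h -> L2dot h (fun t => f t - g t) = L2dot h f - L2dot h g.
Proof. by move=> sf sg sh; rewrite !(L2dotC h) L2dotBl. Qed.

Lemma L2dot_mulmx k l (A : R -> 'M[R]_(k, l)) f g :
  L2dot (fun t => A t *m f t) g = L2dot f (fun t => (A t)^T *m g t).
Proof. by apply: eq_Rintegral => t _; rewrite dotv_mul. Qed.

Lemma L2dot_ge0 k (f : R -> 'cV[R]_k) : 0 <= L2dot f f.
Proof. by apply: Rintegral_ge0 => t _; exact: dotv_ge0. Qed.

Lemma ae_eq_Rintegral (f g : R -> R) : measurable_fun D f -> measurable_fun D g ->
  {ae mu, forall t, D t -> f t = g t} ->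
  \int[mu]_(t in D) f t = \int[mu]_(t in D) g t.
Proof.
move=> mf mg fg; congr fine; apply: ae_eq_integral => //.
- exact/measurable_EFinP.
- exact/measurable_EFinP.
by apply: ae_imply fg => t fgt Dt; rewrite fgt.
Qed.

Lemma L2dot_ae k l (f g : R -> 'cV[R]_k) (f' g' : R -> 'cV[R]_l) :
  L2fun t0 T f -> L2fun t0 T f' -> L2fun t0 T g -> L2fun t0 T g' ->
  {ae mu, forall t, D t -> dotv (f t) (g t) = dotv (f' t) (g' t)} ->
  L2dot f g = L2dot f' g'.
Proof.
move=> sf sf' sg sg'; apply: ae_eq_Rintegral.
  by have /measurable_int/measurable_EFinP := dotv_integrable sf sg.
by have /measurable_int/measurable_EFinP := dotv_integrable sf' sg'.
Qed.

Lemma ac_parts_vector k (f f' g g' : R -> 'cV[R]_k) : t0 <= T ->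
  abs_continuous t0 T f -> abs_continuous t0 T g ->
  L2fun t0 T f' -> L2fun t0 T g' ->
  ae_derivative t0 T f f' -> ae_derivative t0 T g g' ->
  dotv (f T) (g T) - dotv (f t0) (g t0) = L2dot f' g + L2dot f g'.
Proof.
move=> tT /abs_continuousP acf /abs_continuousP acg /L2funP sf' /L2funP sg'.
move=> /ae_derivativeP df /ae_derivativeP dg.
have sf : L2fun t0 T f by apply/L2funP => i; exact: sqint_ac.
have sg : L2fun t0 T g by apply/L2funP => i; exact: sqint_ac.
have /L2funP L2f' := sf'; have /L2funP L2g' := sg'.
rewrite /L2dot -RintegralD //; try exact: dotv_integrable.
under eq_Rintegral do rewrite /dotv -big_split.
rewrite /dotv -sumrB Rintegral_sum //.
  by apply: eq_bigr => i _; exact: (ac_parts tT (acf i) (acg i) (sf' i) (sg' i) (df i) (dg i)).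
have /L2funP sfi := sf; have /L2funP sgi := sg.
by move=> i; apply: integrable_add => //; exact: sqintM.
Qed.

Lemma is_derive_unique (g : R -> R) (t a b : R) :
  is_derive t 1 g a -> is_derive t 1 g b -> a = b.
Proof. by move=> [_ <-] [_ <-]. Qed.

Lemma continuous_ae_eq (f g : R -> R) : t0 < T ->
  {within D, continuous f} -> {within D, continuous g} ->
  {ae mu, forall t, D t -> f t = g t} -> forall t, D t -> f t = g t.
Proof.
move=> tT fc gc [N [mN N0 subN]] t Dt; apply/eqP/contraT => /eqP neq.
have fgc : {within D, continuous (fun s => `|f s - g s|)}.
  move=> s; apply: (@continuous_comp _ _ _ (fun s : subspace D => f s - g s) (fun y : R => `|y|)).
    by apply: continuousB; [exact: fc|exact: gc].
  exact: norm_continuous.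
have e0 : 0 < `|f t - g t| by rewrite normr_gt0 subr_eq0; apply/eqP.
have /subspace_continuousP/(_ t Dt)/cvgrPdist_lt/(_ _ e0) := fgc.
rewrite near_withinE => /nbhs_ballP[d /= d0 dP].
pose a := Num.max t0 (t - d); pose b := Num.min T (t + d).
have [t0t tT'] : t0 <= t /\ t <= T by move: Dt; rewrite /= in_itv => /andP.
have ab : a < b.
  rewrite lt_min !gt_max tT /=; apply/andP; split; last by apply/andP; split; lra.
  lra.
have abN : `]a, b[ `<=` N.
  move=> s; rewrite /= in_itv /= lt_min gt_max => /andP[/andP[t0s ds] /andP[sT sd]].
  apply: subN => /= fgs.
  have Ds : D s by rewrite /= in_itv /= !ltW.
  have : ball t d s by rewrite /ball /= ltr_norml; apply/andP; split; lra.
  by move=> /dP /(_ Ds) ; rewrite /from_subspace (fgs Ds) subrr normr0 subr0 normr_id ltxx.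
have : (mu `]a, b[ <= mu N)%E by apply: le_measure; rewrite ?inE.
by rewrite N0 [X in (X <= _)%E]lebesgue_measure_itv /= lte_fin ab lee_fin leNgt subr_gt0 ab.
Qed.

End VectorFunctions.

(** * Green's formula and test functions for descriptor systems *)

Section Descriptor.
Context (R : realType) (t0 T : R).
Hypothesis tT : t0 < T.
Local Notation mu := (@lebesgue_measure R).
Local Notation D := `[t0, T]%classic.

Lemma abs_continuous_mulmx k l (M : 'M[R]_(k, l)) g :
  abs_continuous t0 T g -> abs_continuous t0 T (fun t => M *m g t).
Proof.
move=> /abs_continuousP acg; apply/abs_continuousP => i.
rewrite (_ : (fun t => _) = fun t => \sum_j M i j * g t j 0).
  by apply: ac_sum => j; exact: acZ.
by apply/funext => t; rewrite mxE.
Qed.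

Lemma abs_continuousD k (f g : R -> 'cV[R]_k) : abs_continuous t0 T f ->
  abs_continuous t0 T g -> abs_continuous t0 T (fun t => f t + g t).
Proof.
move=> /abs_continuousP acf /abs_continuousP acg; apply/abs_continuousP => i.
rewrite (_ : (fun t => _) = fun t => f t i 0 + g t i 0); first exact: acD.
by apply/funext => t; rewrite mxE.
Qed.

Lemma abs_continuousZ k c (g : R -> 'cV[R]_k) : abs_continuous t0 T g ->
  abs_continuous t0 T (fun t => c *: g t).
Proof.
move=> /abs_continuousP acg; apply/abs_continuousP => i.
rewrite (_ : (fun t => _) = fun t => c * g t i 0); first exact: acZ.
by apply/funext => t; rewrite mxE.
Qed.

Lemma ae_derivative_mulmx k l (M : 'M[R]_(k, l)) g w :
  ae_derivative t0 T g w ->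
  ae_derivative t0 T (fun t => M *m g t) (fun t => M *m w t).
Proof.
apply: ae_imply => t gt /gt{}gt i.
have := is_derive_sum (fun j => is_deriveZ (M i j) (gt j)).
rewrite mxE; congr is_derive.
by apply/funext => s; rewrite mxE fct_sumE.
Qed.

Lemma ae_derivativeD k (f g v w : R -> 'cV[R]_k) : ae_derivative t0 T f v ->
  ae_derivative t0 T g w ->
  ae_derivative t0 T (fun t => f t + g t) (fun t => v t + w t).
Proof.
apply: ae_imply2 => t ft gt Dt i; have := is_deriveD (ft Dt i) (gt Dt i).
by rewrite mxE; congr is_derive; apply/funext => s; rewrite mxE.
Qed.

Lemma ae_derivativeZ k c (f v : R -> 'cV[R]_k) : ae_derivative t0 T f v ->
  ae_derivative t0 T (fun t => c *: f t) (fun t => c *: v t).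
Proof.
apply: ae_imply => t ft Dt i; have := is_deriveZ c (ft Dt i).
by rewrite mxE; congr is_derive; apply/funext => s; rewrite mxE.
Qed.

Lemma ae_derivative_cst k (a : 'cV[R]_k) :
  ae_derivative t0 T (fun=> a) (fun=> 0).
Proof. by apply: aeW => t Dt i; rewrite mxE; exact: is_derive_cst. Qed.

(** Off the two end points the function vanishes on a neighbourhood. *)
Lemma ae_derivative_zero k (g w : R -> 'cV[R]_k) :
  (forall t, D t -> g t = 0) -> ae_derivative t0 T g w ->
  {ae mu, forall t, D t -> w t = 0}.
Proof.
move=> g0.
have neq (a : R) : {ae mu, forall t, t <> a}.
  exists [set a]; split; [exact: measurable_set1|exact: lebesgue_measure_set1|].
  by move=> t /= /contrapT.
have := ae_imply2 (fun t (a : t <> t0) (b : t <> T) => conj a b) (neq t0) (neq T).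
apply: ae_imply2 => t [tt0 tT'] gt Dt; apply/colP => i; rewrite mxE.
apply: is_derive_unique (gt Dt i) _.
have inD : \forall s \near t, (fun=> 0) s = g s i 0.
  have : t \in `]t0, T[.
    move: Dt; rewrite /= !in_itv /= => /andP[a b].
    by rewrite !lt_neqAle a b !andbT eq_sym; apply/andP; split; apply/eqP.
  move=> /near_in_itvoo; apply: filterS => s; rewrite in_itv /= => /andP[a b].
  by rewrite g0 ?mxE // /= in_itv /= !ltW.
by apply: (near_eq_is_derive inD); exact: is_derive_cst.
Qed.

Lemma continuous_ae_zero k (g : R -> 'cV[R]_k) : abs_continuous t0 T g ->
  {ae mu, forall t, D t -> g t = 0} -> forall t, D t -> g t = 0.
Proof.
move=> /abs_continuousP acg g0 t Dt; apply/colP => i; rewrite mxE.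
apply: (continuous_ae_eq tT (ac_continuous (acg i)) (ac_continuous (@ac_cst _ t0 T 0))) => //.
by apply: ae_imply g0 => s gs /gs ->; rewrite mxE.
Qed.

(** [M *m g - g] vanishes almost everywhere, hence everywhere by continuity, and
    then its derivative vanishes as well. *)
Lemma ae_derivative_projection k l (M : 'M[R]_k) (A : 'M[R]_(k, l)) g w x :
  M *m A = A -> abs_continuous t0 T g -> ae_derivative t0 T g w ->
  {ae mu, forall t, D t -> g t = A *m x t} ->
  (forall t, D t -> M *m g t = g t) /\ {ae mu, forall t, D t -> M *m w t = w t}.
Proof.
move=> MA acg gw gx.
have acMg : abs_continuous t0 T (fun t => M *m g t + (-1) *: g t).
  by apply: abs_continuousD; [exact: abs_continuous_mulmx|exact: abs_continuousZ].
have Mg0 : forall t, D t -> M *m g t + (-1) *: g t = 0.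
  apply: continuous_ae_zero => //; apply: ae_imply gx => t gx /gx ->.
  by rewrite mulmxA MA scaleN1r subrr.
split=> [t /Mg0|].
  by rewrite scaleN1r => /eqP; rewrite subr_eq0 => /eqP.
have := ae_derivativeD (ae_derivative_mulmx M gw) (ae_derivativeZ (-1) gw).
move=> /(ae_derivative_zero Mg0); apply: ae_imply => t h /h.
by rewrite scaleN1r => /eqP; rewrite subr_eq0 => /eqP.
Qed.

Lemma descriptor_solutionP k l (A : 'M[R]_(k, l)) w x Ax : L2fun t0 T w ->
  descriptor_solution t0 T A w x Ax <->
  [/\ L2fun t0 T x, abs_continuous t0 T Ax,
     {ae mu, forall t, D t -> Ax t = A *m x t} & ae_derivative t0 T Ax w].
Proof.
by move=> sw; split=> [[? [? _] ? ?]|[? ? ? ?]]; split => //; split => //; exists w.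
Qed.

(** The candidate [P] is the primitive of [p] with the prescribed final value, and
    constant test functions give its initial value. Integrating by parts, the
    primitive of the defect [q - P], used as a test function, shows that the
    defect has zero norm. *)
Lemma primitive_test (q p : R -> R) (a b : R) : sqint t0 T q -> sqint t0 T p ->
  (forall x xi, ac t0 T x -> sqint t0 T xi ->
    {ae mu, forall t, D t -> is_derive t 1 x (xi t)} ->
    a * x T = b * x t0 + \int[mu]_(t in D) (q t * xi t) + \int[mu]_(t in D) (p t * x t)) ->
  exists P, [/\ ac t0 T P, {ae mu, forall t, D t -> is_derive t 1 P (p t)},
    {ae mu, forall t, D t -> P t = q t}, P T = a & P t0 = b].
Proof.
move=> sq sp test; have t0T := ltW tT.
pose P t := primitive t0 T p t + (a - \int[mu]_(t in D) p t).
have PT : P T = a by rewrite /P primitive_end addrC subrK.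
have acP : ac t0 T P by apply: acD (primitive_ac sp) _; exact: ac_cst.
have dP : {ae mu, forall t, D t -> is_derive t 1 P (p t)}.
  apply: ae_imply (primitive_derive sp) => t h /h pt.
  by rewrite -[p t]addr0; apply: is_deriveD.
have sP := sqint_ac acP.
have Pt0 : P t0 = b.
  rewrite /P primitive_start add0r.
  have := test (fun=> 1) (fun=> 0) (@ac_cst _ t0 T 1) (@sqint_cst _ t0 T 0).
  have -> : \int[mu]_(t in D) (q t * 0) = 0.
    by under eq_Rintegral do rewrite mulr0; rewrite Rintegral_cst // mul0r.
  have -> : \int[mu]_(t in D) (p t * 1) = \int[mu]_(t in D) p t.
    by apply: eq_Rintegral => t _; rewrite mulr1.
  rewrite addr0 !mulr1 => -> //; first by rewrite addrK.
  by apply: aeW => t _; exact: is_derive_cst.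
exists P; split => //.
pose xi t := q t - P t; have sxi : sqint t0 T xi by exact: sqintB.
have dx := primitive_derive sxi; have acx := primitive_ac sxi.
set x := primitive t0 T xi in dx acx; have sx := sqint_ac acx.
have := test x xi acx sxi dx; have := ac_parts t0T acP acx sp sxi dP dx.
rewrite PT RintegralD //; [|exact: sqintM|exact: sqintM].
have -> : x t0 = 0 by exact: primitive_start.
rewrite !mulr0 => E1 E2.
have {}E : \int[mu]_(t in D) (xi t ^+ 2) = 0.
  under eq_Rintegral do rewrite expr2 {1}/xi mulrBl.
  by rewrite RintegralB //; [lra|exact: sqintM|exact: sqintM].
have xi2 := sqint_sqr sxi.
have [+ _] := ae_eq_integral_abs mu (measurable_itv `[t0, T]) (measurable_int _ xi2).
case=> [|N [mN N0 subN]].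
  under eq_integral do rewrite /= ger0_norm ?sqr_ge0 //.
  by rewrite -[LHS]fineK ?[X in X%:E]E //; exact: integrable_fin_num xi2.
exists N; split => // t nt; apply: subN => /= xit; apply: nt => Dt.
have /eqP := xit Dt; rewrite eqe sqrf_eq0 subr_eq0 => /eqP -> //.
Qed.

(** The scalar case, with test functions along the coordinate axes. *)
Lemma du_bois_reymond k (q p : R -> 'cV[R]_k) (a b : 'cV[R]_k) :
  L2fun t0 T q -> L2fun t0 T p ->
  (forall x xi, abs_continuous t0 T x -> L2fun t0 T xi -> ae_derivative t0 T x xi ->
    dotv a (x T) = dotv b (x t0) + L2dot t0 T q xi + L2dot t0 T p x) ->
  exists P, [/\ abs_continuous t0 T P, ae_derivative t0 T P p,
    {ae mu, forall t, D t -> P t = q t}, P T = a & P t0 = b].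
Proof.
move=> /L2funP sq /L2funP sp test.
have dotE (c : 'cV[R]_k) y i : dotv c (y *: delta_mx i 0) = c i 0 * y.
  rewrite dotvZr /dotv (bigD1 i) //= big1 ?addr0 => [|j ji].
    by rewrite mxE !eqxx mulr1 mulrC.
  by rewrite mxE (negPf ji) mulr0.
have /choice[P PP] i : exists P, [/\ ac t0 T P, {ae mu, forall t, D t -> is_derive t 1 P (p t i 0)},
    {ae mu, forall t, D t -> P t = q t i 0}, P T = a i 0 & P t0 = b i 0].
  apply: primitive_test => // x xi acx sxi dx.
  have := test (fun t => x t *: delta_mx i 0) (fun t => xi t *: delta_mx i 0).
  rewrite /L2dot !dotE.
  under eq_Rintegral do rewrite dotE; under [X in _ + X]eq_Rintegral do rewrite dotE.
  apply.
  - apply/abs_continuousP => j; under eq_fun do rewrite !mxE mulrC; exact: acZ.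
  - apply/L2funP => j; under eq_fun do rewrite !mxE mulrC; exact: sqintZ.
  - apply: ae_imply dx => t xt /xt{}xt j.
    have := is_deriveZ ((j == i)%:R : R) xt; rewrite !mxE eqxx andbT mulrC.
    by congr is_derive; apply/funext => s; rewrite !mxE eqxx andbT mulrC.
exists (fun t => \col_i P i t); split.
- apply/abs_continuousP => i; have [h _ _ _ _] := PP i.
  by under eq_fun do rewrite mxE.
- apply/ae_derivativeP => i; have [_ h _ _ _] := PP i.
  apply: ae_imply h => t h /h; congr is_derive.
  by apply/funext => s; rewrite mxE.
- have h i : {ae mu, forall t, D t -> P i t = q t i 0} by have [] := PP i.
  have := @filter_forall R _ (fun i t => D t -> P i t = q t i 0) _
    (ae_filter_ringOfSetsType mu) h.
  by apply: ae_imply => t ht Dt; apply/colP => i; rewrite mxE ht.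
- by apply/colP => i; rewrite mxE; have [] := PP i.
- by apply/colP => i; rewrite mxE; have [] := PP i.
Qed.

Context (m n p : nat) (F : 'M[R]_(m, n)) (C : R -> 'M[R]_(m, n)) (H : R -> 'M[R]_(p, n)).
Hypothesis C_cont : {within D, continuous C}.
Hypothesis H_cont : {within D, continuous H}.

Lemma L2fun_ac k (g : R -> 'cV[R]_k) : abs_continuous t0 T g -> L2fun t0 T g.
Proof.
by move=> /abs_continuousP acg; apply/L2funP => i; exact: sqint_ac.
Qed.

Lemma L2fun_cmulmx k l (M : 'M[R]_(k, l)) g : L2fun t0 T g ->
  L2fun t0 T (fun t => M *m g t).
Proof. by apply: L2fun_mulmx => t; exact: cst_continuous. Qed.

Lemma state_rate_L2 x f : L2fun t0 T x -> L2fun t0 T f ->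
  L2fun t0 T (fun t => C t *m x t + f t).
Proof. by move=> sx sf; apply: L2funD sf; exact: L2fun_mulmx. Qed.

Lemma adjoint_rate_L2 z u : L2fun t0 T z -> L2fun t0 T u ->
  L2fun t0 T (fun t => - ((C t)^T *m z t) + (H t)^T *m u t).
Proof.
by move=> sz su; apply: L2funD; [apply: L2funN|]; exact: L2fun_trmulmx.
Qed.

(** Green's formula. The pairing of [F x] with [F' z] is only defined up to the
    pseudoinverse, which is harmless because both functions and both rates stay
    in the ranges of [F] and [F'], where it acts as an inverse. *)
Lemma green_formula l u z Fz x0 f x Fx :
  L2fun t0 T u -> L2fun t0 T f ->
  adjoint_solution t0 T F C H l u z Fz ->
  state_solution t0 T F C x0 f x Fx ->
  dotv l (Fx T) - L2dot t0 T u (fun t => H t *m x t) =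
  dotv (mppinv F^T *m Fz t0) x0 + L2dot t0 T z f.
Proof.
move=> su sf [[sz [acz _] Fzz dz] zT] [[sx [acx _] Fxx dx] <-].
set G := mppinv F^T; have [FGF _ symFG symGF] := mppinvP F^T; rewrite -/G in FGF symFG symGF.
have GFF : G *m F^T *m F = F by exact: mppinv_tr_mulmx.
have GTF : G^T *m F = F^T *m G by rewrite -symFG trmx_mul trmxK.
have sw := state_rate_L2 sx sf; have sv := adjoint_rate_L2 sz su.
have [Px Pw] := ae_derivative_projection GFF acx dx Fxx.
have [_ Pv] := ae_derivative_projection FGF acz dz Fzz.
have t0T := ltW tT.
have DT : D T by rewrite /= in_itv /= t0T lexx.
have := ac_parts_vector t0T (abs_continuous_mulmx G acz) acx (L2fun_cmulmx G sv) sw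
  (ae_derivative_mulmx G dz) dx.
set v := fun t => _ in sv Pv *; set w := fun t => _ in sw Pw *.
have -> : L2dot t0 T (fun t => G *m v t) Fx = L2dot t0 T v x.
  apply: L2dot_ae => //; [exact: L2fun_cmulmx|exact: L2fun_ac|].
  apply: ae_imply2 Fxx Pv => t Fxt Pvt Dt.
  rewrite (Fxt Dt) dotv_mul mulmxA GTF.
  have vE : F^T *m G *m v t = v t := Pvt Dt.
  by rewrite -[in RHS]vE dotv_mul symFG.
have -> : L2dot t0 T (fun t => G *m Fz t) w = L2dot t0 T z w.
  apply: L2dot_ae => //; first exact/L2fun_cmulmx/L2fun_ac.
  apply: ae_imply2 Fzz Pw => t Fzt Pwt Dt.
  have wE : G *m F^T *m w t = w t := Pwt Dt.
  by rewrite (Fzt Dt) mulmxA dotv_mul symGF wE.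
have -> : dotv (G *m Fz T) (Fx T) = dotv l (Fx T).
  by rewrite zT mulmxA dotv_mul symGF (Px _ DT).
have sCx := L2fun_mulmx C_cont sx.
have sCz : L2fun t0 T (fun t => (C t)^T *m z t) by exact: L2fun_trmulmx.
have sHu : L2fun t0 T (fun t => (H t)^T *m u t) by exact: L2fun_trmulmx.
rewrite /w L2dotDr // /v L2dotDl //; last exact: L2funN.
have -> : L2dot t0 T (fun t => - ((C t)^T *m z t)) x = - L2dot t0 T z (fun t => C t *m x t).
  rewrite (_ : (fun t => - _) = fun t => (-1) *: ((C t)^T *m z t)).
    rewrite L2dotZl // L2dot_mulmx mulN1r; congr (- L2dot _ _ _ _).
    by apply/funext => t; rewrite trmxK.
  by apply/funext => t; rewrite scaleN1r.
have -> : L2dot t0 T (fun t => (H t)^T *m u t) x = L2dot t0 T u (fun t => H t *m x t).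
  by rewrite L2dot_mulmx; congr L2dot; apply/funext => t; rewrite trmxK.
lra.
Qed.

End Descriptor.

(** * The contribution of the noise to the error *)

Section Noise.
Context (R : realType).

(** [integral_bernoulli_prob] is about nonnegative functions; a constant is added
    to [f] to reach that case. *)
Lemma fair_coin (f : bool -> R) :
  (\int[bernoulli_prob (2^-1 : R)]_b (f b)%:E = ((f true + f false) / 2)%:E)%E.
Proof.
pose c := `|f true| + `|f false|.
have fi (g : bool -> R) : (bernoulli_prob (2^-1 : R)).-integrable setT (EFin \o g).
  apply: measurable_bounded_integrable => //.
    by apply: (le_lt_trans (probability_le1 _ _)) => //; exact: ltry.
  exists (`|g true| + `|g false|); split; first exact: num_real.
  by move=> M cM [] _ /=; apply/ltW; apply: le_lt_trans cM; rewrite ?lerDl ?lerDr.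
have p01 : (0 : R) <= (2^-1 : R) <= 1 by apply/andP; split; lra.
under eq_integral => b _ do rewrite -(addrK c (f b)) EFinB.
rewrite (@integralB_EFin _ _ _ _ _ (fun b => f b + c) (fun=> c)) //.
rewrite !(integral_bernoulli_prob p01).
- by rewrite -!EFinM -!EFinD; congr _%:E; rewrite /unstable.onem; field.
- by move=> b; rewrite lee_fin /c addr_ge0.
- move=> [] /=; rewrite lee_fin /c.
    by have := ler_norm (- f true); rewrite normrN; have := normr_ge0 (f false); lra.
  by have := ler_norm (- f false); rewrite normrN; have := normr_ge0 (f true); lra.
Qed.

(** The cross term of the square has zero mean, and the square of the centered
    part is dominated by [K * S]. *)
Lemma second_moment_bound d (Om : measurableType d) (P : probability Om R)
    (M : Om -> R) (S : Om -> \bar R) (b c K : R) :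
  measurable_fun setT M -> measurable_fun setT S -> (forall w, 0 <= S w)%E ->
  (\int[P]_w S w <= 1)%E -> 0 <= K -> (\int[P]_w (M w - b)%:E = 0)%E ->
  {ae P, forall w, (((M w - b) ^+ 2)%:E <= K%:E * S w)%E} ->
  (\int[P]_w ((c - M w) ^+ 2)%:E <= ((c - b) ^+ 2 + K)%:E)%E.
Proof.
move=> mM mS S0 S1 K0 Mb MS; pose X w := M w - b.
have mX : measurable_fun setT X by exact: measurable_funB.
have X2K : (\int[P]_w (X w ^+ 2)%:E <= K%:E)%E.
  apply: (@le_trans _ _ (\int[P]_w (K%:E * S w))%E).
    apply: ae_ge0_le_integral => //.
    - by move=> w _; rewrite lee_fin sqr_ge0.
    - exact/measurable_EFinP/measurable_funX.
    - by move=> w _; rewrite mule_ge0.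
    - exact: measurable_funeM.
    - by apply: filterS MS.
  by rewrite ge0_integralZl // -[leRHS]mule1; apply: lee_wpmul2l.
have X2i : P.-integrable setT (EFin \o (fun w => X w ^+ 2)).
  by apply: integrable_sqr => //; exact: (le_lt_trans X2K (ltry _)).
have csti r : P.-integrable setT (EFin \o (fun=> r)) by exact: finite_measure_integrable_cst.
have Xi : P.-integrable setT (EFin \o X).
  have -> : X = (fun w => X w * 1) by apply/funext => w; rewrite mulr1.
  by apply: integrable_mul => //; rewrite expr1n; exact: csti.
pose a := c - b.
have -> : (fun w => ((c - M w) ^+ 2)%:E) = EFin \o (fun w => (a ^+ 2 + (- 2 * a) * X w) + X w ^+ 2).
  by apply/funext => w; congr _%:E; rewrite /a /X; ring.
have i1 : P.-integrable setT (EFin \o (fun w => (- 2 * a) * X w)) by exact: integrable_scale.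
have i2 : P.-integrable setT (EFin \o (fun w => a ^+ 2 + (- 2 * a) * X w)).
  by apply: integrable_add => //; exact: csti.
rewrite (@integralD_EFin _ _ _ P setT _ _ _ i2 X2i) //.
rewrite (@integralD_EFin _ _ _ P setT _ (fun=> a ^+ 2) _ (csti _) i1) //.
have cstI : (\int[P]_w (EFin \o (fun=> (a ^+ 2)%R)) w = (a ^+ 2)%:E)%E.
  by have := expectation_cst P (a ^+ 2); rewrite unlock.
rewrite {}cstI.
have -> : (\int[P]_w ((- 2 * a) * X w)%:E = 0)%E.
  under eq_integral do rewrite EFinM.
  by rewrite integralZl // Mb mule0.
by rewrite adde0 EFinD; apply: leeD2l.
Qed.

End Noise.

Section NoiseBounds.
Context (R : realType) (t0 T : R) (p : nat).
Local Notation mu := (@lebesgue_measure R).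
Local Notation D := `[t0, T]%classic.
Context (Rn : R -> 'M[R]_p).
Hypothesis Rn_pos : forall t, t \in `[t0, T] -> posdefmx (Rn t).
Hypothesis Rn_cont : {within D, continuous Rn}.
Hypothesis Rninv_cont : {within D, continuous (fun t => invmx (Rn t))}.
Context (u y : R -> 'cV[R]_p).
Hypothesis u_L2 : L2fun t0 T u.
Hypothesis y_L2 : L2fun t0 T y.

Definition noise_energy := L2dot t0 T (fun t => invmx (Rn t) *m u t) u.

Let mD : measurable (D : set (measurableTypeR R)) := measurable_itv _.

Lemma invu_L2 : L2fun t0 T (fun t => invmx (Rn t) *m u t).
Proof. exact: L2fun_mulmx. Qed.

Lemma noise_energy_ge0 : 0 <= noise_energy.
Proof.
apply: Rintegral_ge0 => t Dt; apply: posdef_ge0; apply: posdef_inv; exact: Rn_pos.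
Qed.

(** Extension by zero, so that Fubini's theorem applies on the whole product of
    the time line with the sample space. *)
Definition cut k l (f : R -> 'M[R]_(k, l)) (t : R) : 'M[R]_(k, l) :=
  if t \in `[t0, T] then f t else 0.

Lemma cut_in k l (f : R -> 'M[R]_(k, l)) t : D t -> cut f t = f t.
Proof. by rewrite /cut /= => ->. Qed.

Lemma cut_measurable k l (f : R -> 'M[R]_(k, l)) i j :
  measurable_fun D (fun t => f t i j) ->
  measurable_fun [set: measurableTypeR R] (fun t => cut f t i j).
Proof.
move=> /(measurable_restrictT _ mD).1.
congr measurable_fun; apply/funext => t; rewrite patchE /cut mem_setE.
by case: ifP => //; rewrite mxE.
Qed.

Lemma integral_cut (g h : R -> \bar R) : (forall t, D t -> g t = h t) ->
  (forall t, ~ D t -> h t = 0%E) ->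
  (\int[mu]_(t in D) g t = \int[mu]_t h t)%E.
Proof.
move=> gh h0; rewrite integral_mkcond; apply: eq_integral => t _.
rewrite patchE; case: ifPn => [/set_mem/gh //|/negP tD].
by rewrite h0 // => Dt; apply: tD; rewrite inE.
Qed.

Section Process.
Context d (Om : measurableType d) (P : probability Om R) (eta : R -> Om -> 'cV[R]_p).
Hypothesis eta_centered : centered_process t0 T P eta.
Hypothesis eta_corr : correlation_set t0 T Rn (correlation P eta).

Let e (tw : measurableTypeR R * Om) : 'cV[R]_p := cut (eta ^~ tw.2) tw.1.

Lemma cut_process_measurable i :
  measurable_fun [set: measurableTypeR R * Om] (fun tw => e tw i 0).
Proof.
have [me _ _] := eta_centered.
have mDO : measurable (D `*` [set: Om] : set (measurableTypeR R * Om)).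
  exact: measurableX.
have /(measurable_restrictT _ mDO).1 := me i.
congr measurable_fun; apply/funext => -[t w]; rewrite patchE /e /cut /=.
rewrite -(_ : ((t, w) \in D `*` setT) = (t \in `[t0, T])).
  by case: ifP => //; rewrite mxE.
by apply/idP/idP => [/set_mem[]|tD] //; rewrite inE; split.
Qed.

Lemma cut_fst_measurable k l (f : R -> 'M[R]_(k, l)) i j :
  measurable_fun D (fun t => f t i j) ->
  measurable_fun [set: measurableTypeR R * Om] (fun tw => cut f tw.1 i j).
Proof.
move=> /cut_measurable mf.
exact: (measurableT_comp mf (@measurable_fst _ _ (measurableTypeR R) Om)).
Qed.

Lemma process_section_measurable t i : D t -> measurable_fun setT (fun w => eta t w i 0).
Proof.
move=> Dt; have := measurableT_comp (cut_process_measurable i) (pair1_measurable t).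
by congr measurable_fun; apply/funext => w; rewrite /= /e /= cut_in.
Qed.

Lemma process_mul_integrable t i j : D t ->
  P.-integrable setT (EFin \o (fun w => eta t w i 0 * eta t w j 0)).
Proof.
move=> Dt; have [_ e2 _] := eta_centered.
have sq k : P.-integrable setT (EFin \o (fun w => eta t w k 0 ^+ 2)).
  apply: integrable_sqr => //; first exact: process_section_measurable.
  by have := e2 t k Dt; rewrite unlock.
by apply: integrable_mul => //; exact: process_section_measurable.
Qed.

Lemma process_integrable t i : D t ->
  P.-integrable setT (EFin \o (fun w => eta t w i 0)).
Proof.
move=> Dt; have [_ e2 _] := eta_centered.
rewrite (_ : (fun w => _) = (fun w => eta t w i 0 * 1)); last by apply/funext => w; rewrite mulr1.
apply: integrable_mul => //; first exact: process_section_measurable.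
  apply: integrable_sqr => //; first exact: process_section_measurable.
  by have := e2 t i Dt; rewrite unlock.
by rewrite expr1n; exact: finite_measure_integrable_cst.
Qed.

Let S (tw : measurableTypeR R * Om) : R := dotv (cut Rn tw.1 *m e tw) (e tw).

Lemma noise_form_measurable : measurable_fun setT S.
Proof.
apply: measurable_sum => i; apply: measurable_funM; last exact: cut_process_measurable.
rewrite (_ : (fun tw => _) = fun tw => \sum_j cut Rn tw.1 i j * e tw j 0).
  apply: measurable_sum => j; apply: measurable_funM; last exact: cut_process_measurable.
  apply: cut_fst_measurable; apply: within_continuous_measurable; exact: continuous_entry.
by apply/funext => tw; rewrite mxE.
Qed.

Lemma noise_form_ge0 tw : 0 <= S tw.
Proof.
rewrite /S /e /cut; case: ifP => [Dt|_]; first exact/posdef_ge0/Rn_pos.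
by rewrite mulmx0 dotv0l.
Qed.

Lemma noise_form_mean t : D t ->
  (\int[P]_w (S (t, w))%:E = (\tr (Rn t *m correlation P eta t t))%:E)%E.
Proof.
move=> Dt.
have SE w : S (t, w) = \sum_i \sum_j Rn t i j * (eta t w j 0 * eta t w i 0).
  rewrite /S /e /= !cut_in // /dotv; apply: eq_bigr => i _; rewrite mxE mulr_suml.
  by apply: eq_bigr => j _; rewrite mulrA.
under eq_integral do rewrite SE.
have ij i j := integrable_scale measurableT (Rn t i j) (process_mul_integrable j i Dt).
have ii i := integrable_sum_fin measurableT (index_enum 'I_p) (ij i).
have iall := integrable_sum_fin measurableT (index_enum 'I_p) ii.
rewrite -[LHS]fineK; last exact: integrable_fin_num iall.
congr _%:E; rewrite -/(Rintegral P setT _) Rintegral_sum //.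
rewrite /mxtrace; apply: eq_bigr => i _; rewrite Rintegral_sum // mxE.
apply: eq_bigr => j _; rewrite RintegralZl //; last exact: process_mul_integrable.
by rewrite mxE unlock.
Qed.

Lemma noise_form_total : (\int[mu]_t \int[P]_w (S (t, w))%:E <= 1)%E.
Proof.
apply: (le_trans _ eta_corr); rewrite le_eqVlt; apply/orP; left; apply/eqP/esym.
apply: integral_cut => t Dt; first by rewrite noise_form_mean.
rewrite integral0_eq // => w _; rewrite /S /e /cut /=.
by move/negP/negPf : Dt => -> ; rewrite mulmx0 dotv0l.
Qed.

Let f (tw : measurableTypeR R * Om) : R := dotv (cut u tw.1) (cut y tw.1 + e tw).

Lemma pairing_measurable : measurable_fun setT f.
Proof.
have /L2funP su := u_L2; have /L2funP sy := y_L2.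
apply: measurable_sum => i; apply: measurable_funM.
  by apply: cut_fst_measurable; have [] := su i.
rewrite (_ : (fun tw => _) = fun tw => cut y tw.1 i 0 + e tw i 0).
  apply: measurable_funD; last exact: cut_process_measurable.
  by apply: cut_fst_measurable; have [] := sy i.
by apply/funext => tw; rewrite mxE.
Qed.

Lemma cut_dotv (k : nat) (g h : R -> 'cV[R]_k) : L2fun t0 T g -> L2fun t0 T h ->
  mu.-integrable setT (EFin \o (fun t => dotv (cut g t) (cut h t))) /\
  \int[mu]_t dotv (cut g t) (cut h t) = L2dot t0 T g h.
Proof.
move=> sg sh.
have E : EFin \o (fun t => dotv (cut g t) (cut h t)) = (EFin \o (fun t => dotv (g t) (h t))) \_ D.
  apply/funext => t; rewrite patchE /= mem_setE /cut.
  by case: ifP => // _; rewrite dotv0l.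
split; first by rewrite E; apply/(integrable_mkcond _ mD).1; exact: dotv_integrable.
rewrite /L2dot /Rintegral; congr fine.
rewrite [in RHS]integral_mkcond; apply: eq_integral => t _; exact: (congr1 (fun F => F t) E).
Qed.

Let U t := dotv (cut (fun t => invmx (Rn t) *m u t) t) (cut u t).

Lemma pairing_young x t w :
  2 * x * dotv (cut u t) (e (t, w)) <= S (t, w) + x ^+ 2 * U t.
Proof.
rewrite /S /U /e /cut /=; case: ifP => [Dt|_]; last by rewrite !dotv0l dotv0r !mulr0 addr0.
by rewrite (dotvC (u t)); have := posdef_young (eta t w) (u t) x (Rn_pos Dt).
Qed.

Let U_int := cut_dotv invu_L2 u_L2.
Let uy_int := cut_dotv u_L2 y_L2.

Let msection t : measurable_fun [set: Om] (fun w => (t, w) : measurableTypeR R * Om).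
Proof. exact: pair1_measurable. Qed.

Let msection2 w : measurable_fun [set: measurableTypeR R] (fun t => (t, w) : measurableTypeR R * Om).
Proof. exact: pair2_measurable. Qed.

(** Young's inequality bounds the pairing of [u] with the noise by two terms: one
    depends on time only, and the other is the quadratic form [S] of the noise,
    whose total is bounded by the constraint on the correlation. *)
Lemma pairing_integrable : (mu \x P)%E.-integrable setT (EFin \o f).
Proof.
have mf : measurable_fun setT (EFin \o f) by apply/measurable_EFinP; exact: pairing_measurable.
apply/(integrable12ltyP mu P mf).
have mS : measurable_fun setT (EFin \o S) by apply/measurable_EFinP; exact: noise_form_measurable.
have S0 tw : (0 <= (EFin \o S) tw)%E by rewrite lee_fin noise_form_ge0.
pose g t := `|dotv (cut u t) (cut y t)| + 2^-1 * U t.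
have gi : mu.-integrable setT (EFin \o g).
  apply: integrable_add => //; first exact: integrable_norm (proj1 uy_int).
  exact: integrable_scale (proj1 U_int).
have U0 t : 0 <= U t.
  rewrite /U /cut; case: ifP => [Dt|_]; last by rewrite dotv0l.
  exact/posdef_ge0/posdef_inv/Rn_pos.
have g0 t : 0 <= g t by rewrite addr_ge0 ?mulr_ge0.
have fS t w : `|f (t, w)| <= g t + 2^-1 * S (t, w).
  rewrite /f /= dotvDr -/(e (t, w)); apply: (le_trans (ler_normD _ _)).
  rewrite /g -addrA lerD2l ler_norml.
  have := pairing_young 1 t w; have := pairing_young (- 1) t w.
  by rewrite sqrrN !expr1n !mul1r => h1 h2; apply/andP; split; lra.
apply: (@le_lt_trans _ _ (\int[mu]_t ((g t)%:E + 2^-1%:E * \int[P]_w (S (t, w))%:E))%E).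
  apply: ge0_le_integral => //.
  - by move=> t _; apply: integral_ge0.
  - apply: (measurable_fun_fubini_tonelli_F (abse \o (EFin \o f))) => //.
      exact: measurableT_comp.
    by move=> tw; exact: abse_ge0.
  - apply: emeasurable_funD; first exact: measurable_int gi.
    by apply: measurable_funeM; exact: (measurable_fun_fubini_tonelli_F (EFin \o S)).
  - move=> t _.
    apply: (@le_trans _ _ (\int[P]_w ((g t)%:E + 2^-1%:E * (S (t, w))%:E))%E).
      apply: ge0_le_integral => //.
      + by apply: measurableT_comp => //; apply: (measurableT_comp mf); exact: msection.
      + apply: emeasurable_funD => //; apply: measurable_funeM.
        by apply: (measurableT_comp mS); exact: msection.
      + by move=> w _; rewrite -EFinM -EFinD lee_fin.
    rewrite ge0_integralD //.
    + rewrite ge0_integralZl //.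
      * have := expectation_cst P (g t); rewrite unlock /= => ->; exact: lexx.
      * by apply: (measurableT_comp mS); exact: msection.
      * by move=> w _; exact: S0.
    + by move=> w _; rewrite lee_fin.
    + by move=> w _; rewrite mule_ge0 // S0.
    + by apply: measurable_funeM; apply: (measurableT_comp mS); exact: msection.
rewrite ge0_integralD //; last 4 first.
- by move=> t _; rewrite lee_fin.
- exact: measurable_int gi.
- by move=> t _; rewrite mule_ge0 // integral_ge0 // => w _; exact: S0.
- by apply: measurable_funeM; exact: (measurable_fun_fubini_tonelli_F (EFin \o S)).
apply: lte_add_pinfty.
  by rewrite -ge0_fin_numE ?integral_ge0 // => [|t _]; [exact: integrable_fin_num gi|rewrite lee_fin].
rewrite ge0_integralZl //; last 2 first.
- exact: (measurable_fun_fubini_tonelli_F (EFin \o S)).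
- by move=> t _; rewrite integral_ge0 // => w _; exact: S0.
apply: (@le_lt_trans _ _ (2^-1%:E * 1)%E); last by rewrite mule1 ltry.
apply: lee_wpmul2l; [by rewrite lee_fin|exact: noise_form_total].
Qed.

Let b := L2dot t0 T u y.
Let M w := estimate t0 T u (fun t => y t + eta t w).
Let G w := (\int[mu]_t (f (t, w))%:E)%E.

Lemma estimateE w : M w = fine (G w).
Proof.
rewrite /M /estimate /Rintegral /G; congr fine; apply: integral_cut => t Dt.
  by rewrite /f /e /= !cut_in.
by rewrite /f /= /cut; move/negP/negPf : Dt => ->; rewrite dotv0l.
Qed.

Lemma estimate_ae : {ae P, forall w, mu.-integrable setT (fun t => (f (t, w))%:E) /\ (M w)%:E = G w}.
Proof.
have := ae_integrable2 pairing_integrable; apply: filterS => w fi; split=> //.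
by rewrite estimateE fineK //; exact: integrable_fin_num fi.
Qed.

Lemma estimate_measurable : measurable_fun setT M.
Proof.
rewrite (_ : M = fine \o G); last by apply/funext => w; rewrite estimateE.
apply: measurableT_comp => //; exact: measurable_fubini_G pairing_integrable.
Qed.

Lemma estimate_integrable : P.-integrable setT (EFin \o M).
Proof.
have mf : measurable_fun setT (EFin \o f) by apply/measurable_EFinP; exact: pairing_measurable.
apply/integrableP; split; first exact/measurable_EFinP/estimate_measurable.
apply: (le_lt_trans _ ((integrable21ltyP mu P mf).1 pairing_integrable)).
apply: ge0_le_integral => //.
- by apply: measurableT_comp => //; apply/measurable_EFinP; exact: estimate_measurable.
- apply: (measurable_fun_fubini_tonelli_G (abse \o (EFin \o f))) => //.
    exact: measurableT_comp.
  by move=> tw; exact: abse_ge0.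
move=> w _; rewrite /= estimateE.
apply: (@le_trans _ _ `|G w|%E).
  by case: (G w) => //= ; rewrite normr0 leey.
by apply: le_abse_integral => //; apply: (measurableT_comp mf); exact: msection2.
Qed.

Lemma estimate_mean : (\int[P]_w (M w)%:E = b%:E)%E.
Proof.
transitivity (\int[P]_w G w)%E.
  apply: ae_eq_integral => //.
  - by apply/measurable_EFinP; exact: estimate_measurable.
  - exact: measurable_fubini_G pairing_integrable.
  - by apply: filterS estimate_ae => w [].
rewrite -(Fubini pairing_integrable) /=.
have [iuy iuyE] := uy_int; rewrite /b -iuyE.
rewrite /Rintegral fineK; last exact: integrable_fin_num iuy.
apply: eq_integral => t _; rewrite /f /=.
have [Dt|nDt] := pselect (D t); last first.
  move/negP/negPf : nDt => nDt; rewrite /cut nDt integral0_eq ?dotv0l // => w _.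
  by rewrite dotv0l.
have [_ _ e1] := eta_centered.
have ei i := process_integrable i Dt.
have si i := integrable_scale measurableT (u t i 0) (ei i).
have sumi := integrable_sum_fin measurableT (index_enum 'I_p) si.
have csti : P.-integrable setT (EFin \o cst (dotv (cut u t) (cut y t))).
  exact: finite_measure_integrable_cst.
under eq_integral do rewrite dotvDr /e /= !(cut_in _ Dt) {2}/dotv.
rewrite (@integralD_EFin _ _ _ P setT _ _ _ _ sumi) //; last first.
  by move: csti; rewrite !cut_in.
have := expectation_cst P (dotv (cut u t) (cut y t)); rewrite unlock !cut_in // => ->.
rewrite -[X in (_ + X)%E]fineK; last exact: integrable_fin_num sumi.
rewrite -/(Rintegral P setT _) Rintegral_sum // big1 ?adde0 // => i _.
rewrite RintegralZl // /Rintegral.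
by have := e1 t i Dt; rewrite unlock => ->; rewrite mulr0.
Qed.

(** A nonnegative quadratic polynomial has a nonpositive discriminant. This turns
    each integrated Young inequality into a Cauchy-Schwarz inequality. *)
Lemma discriminant (N s K : R) : (forall x, 2 * x * N <= s + x ^+ 2 * K) ->
  0 <= K -> N ^+ 2 <= K * s.
Proof.
move=> h; rewrite le_eqVlt => /predU1P[K0|K0].
  rewrite -K0 mul0r; have [->|N0] := eqVneq N 0; first by rewrite expr0n.
  have := h ((s + 1) / (2 * N)); rewrite -K0 mulr0 addr0.
  have -> : 2 * ((s + 1) / (2 * N)) * N = s + 1 by field.
  by rewrite gerDl ler10.
have := h (N / K); rewrite -(ler_pM2r K0).
have -> : 2 * (N / K) * N * K = 2 * N ^+ 2 by field; rewrite gt_eqF.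
have -> : (s + (N / K) ^+ 2 * K) * K = K * s + N ^+ 2 by field; rewrite gt_eqF.
lra.
Qed.

(** For almost every outcome [w], the Cauchy-Schwarz inequality in time bounds the
    squared deviation of the estimate by [noise_energy] times the integral of the
    form [S], whose mean is at most 1. *)
Lemma noise_upper_bound (c : R) :
  ('E_P[(fun w => (c - M w) ^+ 2)%R] <= ((c - b) ^+ 2 + noise_energy)%:E)%E.
Proof.
have mS : measurable_fun setT (EFin \o S) by apply/measurable_EFinP; exact: noise_form_measurable.
have S0 tw : (0 <= (EFin \o S) tw)%E by rewrite lee_fin noise_form_ge0.
pose Sw w := (\int[mu]_t (S (t, w))%:E)%E.
have mSw : measurable_fun setT Sw by exact: (measurable_fun_fubini_tonelli_G (EFin \o S)).
have Sw0 w : (0 <= Sw w)%E by apply: integral_ge0 => t _; exact: S0.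
have Sw1 : (\int[P]_w Sw w <= 1)%E.
  have := @fubini_tonelli _ _ _ _ R mu P (EFin \o S) mS S0; rewrite /Sw /= => <-; exact: noise_form_total.
have Swfin : {ae P, forall w, Sw w \is a fin_num}.
  have : P.-integrable setT Sw.
    apply/integrableP; split => //; under eq_integral do rewrite gee0_abs //.
    exact: (le_lt_trans Sw1 (ltry _)).
  by move=> /integrable_ae => /(_ measurableT); apply: filterS => w; apply.
rewrite unlock; apply: (@second_moment_bound _ _ _ P M Sw b) => //;
  [exact: estimate_measurable|exact: noise_energy_ge0|..].
  under eq_integral do rewrite EFinB.
  rewrite (@integralB_EFin _ _ _ P setT M (fun=> b) measurableT estimate_integrable) //; last first.
    exact: finite_measure_integrable_cst.
  rewrite estimate_mean.
  have := expectation_cst P b; rewrite unlock => ->; exact: subee.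
apply: filterS2 estimate_ae Swfin => w [fi MG] Sfin.
rewrite -(fineK Sfin) -EFinM lee_fin; apply: discriminant noise_energy_ge0 => x.
have [iuy iuyE] := uy_int; have [iU iUE] := U_int.
have Si : mu.-integrable setT (EFin \o (fun t => S (t, w))).
  apply/integrableP; split; first by apply: (measurableT_comp mS); exact: msection2.
  rewrite (_ : (\int[mu]_t _)%E = Sw w); first by rewrite -ge0_fin_numE.
  by apply: eq_integral => t _; rewrite gee0_abs //; exact: S0.
have -> : M w - b = \int[mu]_t dotv (cut u t) (e (t, w)).
  rewrite /b -iuyE estimateE -/(Rintegral mu setT (fun t => f (t, w))) -RintegralB //.
  by apply: eq_Rintegral => t _; rewrite /f /= dotvDr addrC addKr.
have Ni : mu.-integrable setT (EFin \o (fun t => dotv (cut u t) (e (t, w)))).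
  have := integrable_add measurableT fi (integrable_scale measurableT (-1) iuy).
  apply: eq_integrable => // t _; congr _%:E; rewrite /f /= dotvDr; ring.
rewrite /noise_energy -iUE -!RintegralZl //.
rewrite -[fine (Sw w)]/(\int[mu]_t S (t, w)) -RintegralD //; last exact: integrable_scale.
apply: le_Rintegral => //.
- exact: integrable_scale.
- by apply: integrable_add => //; exact: integrable_scale.
by move=> t _; exact: pairing_young.
Qed.

End Process.
(** The Cauchy-Schwarz inequality above is an equality for the noise proportional
    to [invmx (Rn t) *m u t]; a fair random sign gives it zero mean. *)
Lemma noise_attained (c : R) :
  exists (d : measure_display) (Om : measurableType d) (P : probability Om R)
    (eta : R -> Om -> 'cV[R]_p),
  [/\ centered_process t0 T P eta, correlation_set t0 T Rn (correlation P eta) &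
    'E_P[(fun w => (c - estimate t0 T u (fun t => y t + eta t w)) ^+ 2)%R] =
      ((c - L2dot t0 T u y) ^+ 2 + noise_energy)%:E]%E.
Proof.
(* If the noise energy is zero, then so is k, and the noise below vanishes. *)
pose k := (Num.sqrt noise_energy)^-1.
have kE : k ^+ 2 * noise_energy = (noise_energy != 0)%:R.
  rewrite exprVn sqr_sqrtr ?noise_energy_ge0 //.
  by case: eqVneq => [->|?] /=; rewrite ?mulr0 ?mulVf.
pose v t := invmx (Rn t) *m u t; have sv : L2fun t0 T v := invu_L2.
pose s (w : bool) : R := if w then k else - k.
have s2 w : s w ^+ 2 = k ^+ 2 by rewrite /s; case: w; rewrite ?sqrrN.
pose eta t w := s w *: v t.
exists _, bool, (bernoulli_prob (2^-1 : R)), eta; split.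
- split=> [i|t i Dt|t i Dt].
  + have /L2funP/(_ i)[mv _] := sv.
    have /(measurableT_comp (cut_measurable mv)) :=
      @measurable_fst _ _ (measurableTypeR R) bool.
    move=> /(@measurable_funTS _ _ _ _ (D `*` setT)) mcut.
    apply: (@eq_measurable_fun _ _ _ _ _ (fun tw => s tw.2 * (cut v tw.1) i 0)).
      by move=> [t w] /set_mem[/= Dt _]; rewrite /= cut_in // /eta [RHS]mxE.
    apply: measurable_funM => //; apply: measurable_funTS.
    by apply: (@measurableT_comp _ _ _ _ _ _ s); [|exact: measurable_snd].
  + by rewrite unlock fair_coin ltry.
  + rewrite unlock fair_coin !mxE /s mulNr subrr mul0r //.
- have corrE t : D t -> \tr (Rn t *m correlation (bernoulli_prob (2^-1 : R)) eta t t) =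
      k ^+ 2 * dotv (v t) (u t).
    move=> Dt; have RvE : Rn t *m v t = u t by rewrite mulKVmx //; exact/posdef_unitmx/Rn_pos.
    rewrite -RvE dotvC /mxtrace /dotv mulr_sumr; apply: eq_bigr => i _.
    rewrite !mxE mulr_suml mulr_sumr; apply: eq_bigr => j _.
    by rewrite mxE unlock fair_coin /= !mxE /s; field.
  change (\int[mu]_(t in D) (\tr (Rn t *m correlation (bernoulli_prob (2^-1 : R)) eta t t))%:E <= 1)%E.
  under eq_integral => t tD do rewrite (corrE t (set_mem tD)).
  have vu := dotv_integrable sv u_L2.
  have i2 := integrable_scale mD (k ^+ 2) vu.
  rewrite -[leLHS]fineK; last exact: integrable_fin_num i2.
  rewrite -/(Rintegral mu D _) RintegralZl // -/(L2dot t0 T v u) -/noise_energy kE.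
  by rewrite lee_fin; case: (_ != 0).
have estE w : estimate t0 T u (fun t => y t + eta t w) = L2dot t0 T u y + s w * noise_energy.
  rewrite /estimate -/(L2dot t0 T u _) L2dotDr //; last exact: L2funZ.
  by rewrite L2dotZr //; congr (_ + _ * _); exact: L2dotC.
rewrite unlock fair_coin !estE /s; congr _%:E.
have KE : noise_energy = k ^+ 2 * noise_energy ^+ 2.
  rewrite [_ ^+ 2 in RHS]expr2 mulrA kE; by case: eqVneq => [->|]; rewrite ?mulr0 ?mul1r.
by rewrite [in RHS]KE; field.
Qed.

End NoiseBounds.

(** * Duality between the data and the adjoint solutions *)

Section QuadraticBounds.
Context (R : realType) (t0 T : R).
Local Notation mu := (@lebesgue_measure R).
Local Notation D := `[t0, T]%classic.

Lemma quadratic_form_bounded k (A : R -> 'M[R]_k) : {within D, continuous A} ->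
  exists2 M, 0 < M & forall t a, D t -> dotv (A t *m a) a <= M * dotv a a.
Proof.
move=> Ac.
have /choice[N NP] : forall ij : 'I_k * 'I_k, exists N, 0 < N /\ forall t, D t -> `|A t ij.1 ij.2| <= N.
  move=> [i j]; have [N N0 NP] := within_continuous_bounded (continuous_entry (i:=i) (j:=j) Ac).
  by exists N.
exists (1 + \sum_i \sum_j N (i, j)).
  by rewrite ltr_pwDl // sumr_ge0 // => i _; rewrite sumr_ge0 // => j _; case: (NP (i, j)) => /ltW.
move=> t a Dt; rewrite mulrDl mul1r -[leLHS]add0r; apply: lerD; first exact: dotv_ge0.
rewrite {1}/dotv mulr_suml; apply: ler_sum => i _; rewrite mxE !mulr_suml.
apply: ler_sum => j _; have [N0 /(_ t Dt) /= AN] := NP (i, j).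
apply: (le_trans (ler_norm _)); rewrite -mulrA normrM.
apply: (@le_trans _ _ (N (i, j) * `|a j 0 * a i 0|)); first by rewrite ler_wpM2r.
rewrite ler_wpM2l ?(ltW N0) //.
have sq r : a r 0 ^+ 2 <= dotv a a.
  rewrite /dotv (bigD1 r) //= -expr2 lerDl.
  by apply: sumr_ge0 => r' _; rewrite -expr2 sqr_ge0.
rewrite normrM; have := sq i; have := sq j.
rewrite -[a i 0 ^+ 2]real_normK ?num_real // -[a j 0 ^+ 2]real_normK ?num_real //.
by have := sqr_ge0 (`|a i 0| - `|a j 0|); nra.
Qed.

(** By Young's inequality, an upper bound on the inverse is a lower bound on the
    form itself. *)
Lemma quadratic_form_coercive k (A : R -> 'M[R]_k) :
  (forall t, t \in `[t0, T] -> posdefmx (A t)) ->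
  {within D, continuous (fun t => invmx (A t))} ->
  exists2 M, 0 < M & forall t a, D t -> dotv a a <= M * dotv (A t *m a) a.
Proof.
move=> posA /quadratic_form_bounded[M M0 MP]; exists M => // t a Dt.
have := posdef_young a a M^-1 (posA t Dt); have := MP t a Dt => h1 h2.
have M2 : M^-1 ^+ 2 * dotv (invmx (A t) *m a) a <= M^-1 * dotv a a.
  have : M^-1 ^+ 2 * dotv (invmx (A t) *m a) a <= M^-1 ^+ 2 * (M * dotv a a).
    by rewrite ler_wpM2l ?sqr_ge0.
  by rewrite mulrA expr2 -[_ * M]mulrA mulVf ?mulr1 // gt_eqF.
rewrite -(ler_pM2l (_ : 0 < M^-1)) ?invr_gt0 // mulrA mulVf ?mul1r ?gt_eqF //.
by move: h2 M2; rewrite -mulrA; lra.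
Qed.

Section InverseSquareRoot.
Context (k : nat) (A : R -> 'M[R]_k) (f : R -> 'cV[R]_k).
Hypothesis posA : forall t, t \in `[t0, T] -> posdefmx (A t).
Hypothesis contA : {within D, continuous (fun t => invmx (A t))}.
Hypothesis f_L2 : L2fun t0 T f.

Lemma invsqrtmx_integrable :
  mu.-integrable D (fun t => (enorm (invsqrtmx (A t) *m f t) ^+ 2)%:E).
Proof.
have sAf : L2fun t0 T (fun t => invmx (A t) *m f t) by exact: L2fun_mulmx.
apply: eq_integrable (dotv_integrable sAf f_L2) => // t /set_mem Dt.
by rewrite enorm_invsqrtmx //; exact: posA.
Qed.

Lemma integral_invsqrtmx :
  (\int[mu]_(t in D) (enorm (invsqrtmx (A t) *m f t) ^+ 2)%:E =
  (L2dot t0 T (fun t => invmx (A t) *m f t) f)%:E)%E.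
Proof.
have sAf : L2fun t0 T (fun t => invmx (A t) *m f t) by exact: L2fun_mulmx.
rewrite fineK; last exact/integrable_fin_num/dotv_integrable.
by apply: eq_integral => t /set_mem Dt; rewrite enorm_invsqrtmx //; exact: posA.
Qed.

End InverseSquareRoot.

End QuadraticBounds.

Lemma geometric_le0 (R : realType) (x c : R) :
  (forall k : nat, x <= c * 2^-1 ^+ k) -> x <= 0.
Proof.
move=> xc.
have half_cvg : (fun k => c * 2^-1 ^+ k : R) @ \oo --> 0.
  rewrite -[X in _ --> X](mulr0 c); apply: cvgMr.
  by apply: cvg_expr; rewrite ger0_norm ?invf_lt1 // ltr1n.
by apply: (@ler_cvg_to _ _ _ _ (fun=> x) _ _ _ (cvg_cst x) half_cvg); exact: nearW.
Qed.

Section Duality.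
Context (R : realType) (t0 T : R) (m n p : nat)
  (F : 'M[R]_(m, n)) (C : R -> 'M[R]_(m, n)) (H : R -> 'M[R]_(p, n))
  (Q0 : 'M[R]_m) (Q : R -> 'M[R]_m) (Rn : R -> 'M[R]_p).
Hypotheses (tT : t0 < T)
  (C_cont : {within `[t0, T], continuous C})
  (H_cont : {within `[t0, T], continuous H})
  (Q0_pos : posdefmx Q0)
  (Q_pos : forall t, t \in `[t0, T]%R -> posdefmx (Q t))
  (Rn_pos : forall t, t \in `[t0, T]%R -> posdefmx (Rn t))
  (Q_cont : {within `[t0, T], continuous Q})
  (Qinv_cont : {within `[t0, T], continuous (fun t => invmx (Q t))})
  (Rn_cont : {within `[t0, T], continuous Rn})
  (Rninv_cont : {within `[t0, T], continuous (fun t => invmx (Rn t))}).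
Local Notation mu := (@lebesgue_measure R).
Local Notation D := `[t0, T]%classic.
Local Notation L2 := (L2fun t0 T).
Local Notation ip := (L2dot t0 T).

(** The pairs [(x0, f)], and the pairs [((x0, f), (x, Fx))] of which the
    trajectories of the state equation form a subspace. Keeping the data as the
    first component makes it a linear function of the trajectory. *)
Definition data : lmodType R := ('cV[R]_m * (R -> 'cV[R]_m))%type.
Definition trajectory : lmodType R :=
  (('cV[R]_m * (R -> 'cV[R]_m)) * ((R -> 'cV[R]_n) * (R -> 'cV[R]_m)))%type.

Definition weight (a b : 'cV[R]_m * (R -> 'cV[R]_m)) : R :=
  dotv (Q0 *m a.1) b.1 + ip (fun t => Q t *m a.2 t) b.2.

Definition is_trajectory : set trajectory := [set h |
  L2 h.1.2 /\ state_solution t0 T F C h.1.1 h.1.2 h.2.1 h.2.2].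

Definition estimation_gap (l : 'cV[R]_m) (u : R -> 'cV[R]_p) (h : trajectory) : R :=
  dotv l (h.2.2 T) - ip u (fun t => H t *m h.2.1 t).

Lemma is_trajectoryP (x0 : 'cV[R]_m) f x Fx : L2 f ->
  is_trajectory ((x0, f), (x, Fx)) <->
  [/\ L2 x, abs_continuous t0 T Fx,
     {ae mu, forall t, D t -> Fx t = F *m x t},
     ae_derivative t0 T Fx (fun t => C t *m x t + f t) & Fx t0 = x0].
Proof.
move=> sf; split=> [[_ [[sx [acx _] ? ?] ?]]|[sx acx e dx i]] //.
split=> //; split=> //; apply/descriptor_solutionP => //.
exact: state_rate_L2.
Qed.

Lemma trajectory0 : is_trajectory 0.
Proof.
apply/is_trajectoryP; first exact: L2fun_cst.
split=> //; first exact: L2fun_cst.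
- by apply/abs_continuousP => i; apply: ac_cst.
- by apply: aeW => t _; rewrite mulmx0.
- have -> : (fun t => C t *m (0 : R -> 'cV[R]_n) t + (0 : R -> 'cV[R]_m) t) = fun=> 0.
    by apply/funext => t; rewrite mulmx0 addr0.
  exact: ae_derivative_cst.
Qed.

Lemma trajectoryD h k : is_trajectory h -> is_trajectory k -> is_trajectory (h + k).
Proof.
case: h => [[x0 f] [x Fx]]; case: k => [[y0 g] [y Fy]] hT kT.
have [/= sf _] := hT; have [/= sg _] := kT.
move: hT kT => /(is_trajectoryP _ _ _ sf)[sx acx ex dx ix] /(is_trajectoryP _ _ _ sg)[sy acy ey dy iy].
apply/is_trajectoryP; first exact: L2funD.
split; [exact: L2funD|exact: abs_continuousD| | |].
- by apply: ae_imply2 ex ey => t /[swap] eyt /[swap] Dt /(_ Dt) ext; rewrite /= mulmxDr -ext -(eyt Dt).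
- have := ae_derivativeD dx dy.
  congr ae_derivative; apply/funext => t; rewrite mulmxDr addrACA //.
- by rewrite -ix -iy.
Qed.

Lemma trajectoryZ a h : is_trajectory h -> is_trajectory (a *: h).
Proof.
case: h => [[x0 f] [x Fx]] hT; have [/= sf _] := hT.
move: hT => /(is_trajectoryP _ _ _ sf)[sx acx ex dx ix].
apply/is_trajectoryP; first exact: L2funZ.
split; [exact: L2funZ|exact: abs_continuousZ| | |].
- by apply: ae_imply ex => t ext Dt; rewrite /= -scalemxAr -(ext Dt).
- have := ae_derivativeZ a dx.
  by congr ae_derivative; apply/funext => t; rewrite scalerDr scalemxAr.
- by rewrite -ix.
Qed.

Lemma ip_Q_sym (f g : R -> 'cV[R]_m) : ip (fun t => Q t *m f t) g = ip (fun t => Q t *m g t) f.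
Proof.
apply: eq_Rintegral => t tD; have [symQ _] := Q_pos (set_mem tD).
by rewrite dotv_mul symQ dotvC.
Qed.

Lemma weightC a b : weight a b = weight b a.
Proof.
have [symQ0 _] := Q0_pos.
by rewrite /weight ip_Q_sym; congr (_ + _); rewrite dotv_mul symQ0 dotvC.
Qed.

Lemma weightD (a b c : data) : L2 a.2 -> L2 b.2 -> L2 c.2 ->
  weight (a + b) c = weight a c + weight b c.
Proof.
move=> sa sb sc; rewrite /weight mulmxDr dotvDl addrACA; congr (_ + _).
rewrite -L2dotDl //; try exact: L2fun_mulmx.
by congr ip; apply/funext => t; rewrite -mulmxDr.
Qed.

Lemma weightZ x (a c : data) : L2 a.2 -> L2 c.2 ->
  weight (x *: a) c = x * weight a c.
Proof.
move=> sa sc; rewrite /weight -scalemxAr dotvZl mulrDr; congr (_ + _).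
rewrite -L2dotZl //; last exact: L2fun_mulmx.
by congr ip; apply/funext => t; rewrite scalemxAr.
Qed.

Lemma weightB (a b c : data) : L2 a.2 -> L2 b.2 -> L2 c.2 ->
  weight (a - b) c = weight a c - weight b c.
Proof.
move=> sa sb sc; rewrite -scaleN1r weightD //; last exact: L2funZ.
by rewrite weightZ // mulN1r.
Qed.

Lemma weight_ge0 a : 0 <= weight a a.
Proof.
apply: addr_ge0; first exact: posdef_ge0.
by apply: Rintegral_ge0 => t Dt; exact/posdef_ge0/Q_pos.
Qed.

Lemma weight_sqrB (a b : data) : L2 a.2 -> L2 b.2 ->
  weight (a - b) (a - b) = weight a a - 2 * weight a b + weight b b.
Proof.
move=> sa sb; have sab : L2 (a - b).2 by exact: L2funB.
rewrite weightB // !(weightC _ (a - b)) !weightB // (weightC b a); ring.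
Qed.

Lemma weight_cauchy_schwarz (a b : data) : L2 a.2 -> L2 b.2 ->
  weight a b ^+ 2 <= weight a a * weight b b.
Proof.
move=> sa sb; apply: discriminant (weight_ge0 a) => x.
have sxa : L2 (x *: a).2 by exact: L2funZ.
have := weight_ge0 (b - x *: a); rewrite weight_sqrB //.
rewrite (weightC b) !weightZ // (weightC a (x *: a)) weightZ //; lra.
Qed.

(** The dual form of [weight]: it bounds the functional of the data given by
    [(a, z)], and it is the value of the dual cost. *)
Definition dual_weight (a : 'cV[R]_m) (z : R -> 'cV[R]_m) : R :=
  dotv (invmx Q0 *m a) a + ip (fun t => invmx (Q t) *m z t) z.

Lemma dual_weight_ge0 a z : 0 <= dual_weight a z.
Proof.
apply: addr_ge0; first exact/posdef_ge0/posdef_inv.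
by apply: Rintegral_ge0 => t Dt; exact/posdef_ge0/posdef_inv/Q_pos.
Qed.

Lemma dual_cauchy_schwarz a z (h : data) : L2 z -> L2 h.2 ->
  (dotv a h.1 + ip z h.2) ^+ 2 <= dual_weight a z * weight h h.
Proof.
move=> sz sh; apply: discriminant (dual_weight_ge0 a z) => x.
have sQh : L2 (fun t => Q t *m h.2 t) by exact: L2fun_mulmx.
have sQz : L2 (fun t => invmx (Q t) *m z t) by exact: L2fun_mulmx.
have y0 := posdef_young h.1 a x Q0_pos.
suff : 2 * x * ip z h.2 <= ip (fun t => Q t *m h.2 t) h.2 + x ^+ 2 * ip (fun t => invmx (Q t) *m z t) z.
  by move: y0; rewrite /weight /dual_weight (dotvC a); lra.
have i1 := dotv_integrable sz sh; have i2 := dotv_integrable sQh sh.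
have i3 := dotv_integrable sQz sz.
rewrite /L2dot -!RintegralZl // -RintegralD //; last exact: integrable_scale.
apply: le_Rintegral => //; first exact: integrable_scale.
  by apply: integrable_add => //; exact: integrable_scale.
by move=> t Dt; rewrite (dotvC (z t)); exact/posdef_young/Q_pos.
Qed.

Lemma dual_weightE (r : data) :
  dual_weight (Q0 *m r.1) (fun t => Q t *m r.2 t) = weight r r.
Proof.
rewrite /dual_weight /weight mulKmx ?posdef_unitmx // dotvC; congr (_ + _).
apply: eq_Rintegral => t tD; rewrite mulKmx 1?dotvC //.
exact/posdef_unitmx/Q_pos/set_mem.
Qed.

Lemma gapD l u h k : L2 u -> is_trajectory h -> is_trajectory k ->
  estimation_gap l u (h + k) = estimation_gap l u h + estimation_gap l u k.
Proof.
move=> su [_ [[sh _ _ _] _]] [_ [[sk _ _ _] _]]; rewrite /estimation_gap.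
have -> : ip u (fun t => H t *m (h + k).2.1 t) = ip u (fun t => H t *m h.2.1 t) + ip u (fun t => H t *m k.2.1 t).
  rewrite -L2dotDr //; try exact: L2fun_mulmx.
  by congr ip; apply/funext => t; rewrite -mulmxDr.
rewrite [dotv l _](_ : _ = dotv l (h.2.2 T) + dotv l (k.2.2 T)); last by rewrite -dotvDr.
ring.
Qed.

Lemma gapZ l u a h : L2 u -> is_trajectory h ->
  estimation_gap l u (a *: h) = a * estimation_gap l u h.
Proof.
move=> su [_ [[sh _ _ _] _]]; rewrite /estimation_gap.
have -> : ip u (fun t => H t *m (a *: h).2.1 t) = a * ip u (fun t => H t *m h.2.1 t).
  rewrite -L2dotZr //; last exact: L2fun_mulmx.
  by congr ip; apply/funext => t; rewrite -scalemxAr.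
rewrite [dotv l _](_ : _ = a * dotv l (h.2.2 T)); last by rewrite -dotvZr.
ring.
Qed.

Lemma weight_upper : exists2 c, 0 < c & forall a : data, L2 a.2 ->
  weight a a <= c * (dotv a.1 a.1 + ip a.2 a.2).
Proof.
have [M M0 MP] := quadratic_form_bounded Q_cont.
have [M' M'0 M'P] := @quadratic_form_bounded _ t0 T _ (fun=> Q0) (fun t => @cst_continuous _ _ Q0 t).
have Dt0 : D t0 by rewrite /= in_itv /= lexx ltW.
exists (M' + M) => [|a sa]; first exact: addr_gt0.
have sQ : L2 (fun t => Q t *m a.2 t) by exact: L2fun_mulmx.
have L2dotM : ip (fun t => Q t *m a.2 t) a.2 <= M * ip a.2 a.2.
  rewrite -L2dotZl //; apply: le_Rintegral => //; try exact: dotv_integrable.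
    by apply: dotv_integrable => //; exact: L2funZ.
  by move=> t Dt; rewrite dotvZl; exact: MP.
have := M'P _ a.1 Dt0; have := dotv_ge0 a.1; have := L2dot_ge0 t0 T a.2.
rewrite /weight; nra.
Qed.

Lemma weight_coercive : exists2 c, 0 < c & forall a : data, L2 a.2 ->
  dotv a.1 a.1 + ip a.2 a.2 <= c * weight a a.
Proof.
have [M M0 MP] := quadratic_form_coercive Q_pos Qinv_cont.
have [M' M'0 M'P] := @quadratic_form_coercive _ t0 T _ (fun=> Q0) (fun _ _ => Q0_pos)
  (fun t => @cst_continuous _ _ (invmx Q0) t).
have Dt0 : D t0 by rewrite /= in_itv /= lexx ltW.
exists (M' + M) => [|a sa]; first exact: addr_gt0.
have sQ : L2 (fun t => Q t *m a.2 t) by exact: L2fun_mulmx.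
have L2dotM : ip a.2 a.2 <= M * ip (fun t => Q t *m a.2 t) a.2.
  rewrite -L2dotZl //; apply: le_Rintegral => //; try exact: dotv_integrable.
    by apply: dotv_integrable => //; exact: L2funZ.
  by move=> t Dt; rewrite dotvZl; exact: MP.
have := M'P _ a.1 Dt0; have := posdef_ge0 a.1 Q0_pos.
have : 0 <= ip (fun t => Q t *m a.2 t) a.2.
  by apply: Rintegral_ge0 => t Dt; exact/posdef_ge0/Q_pos.
rewrite /weight; nra.
Qed.

Lemma L2dot_coord k (f : R -> 'cV[R]_k) : L2 f ->
  ip f f = \sum_i \int[mu]_(t in D) (f t i 0) ^+ 2.
Proof.
move=> /L2funP sf; rewrite /L2dot /dotv.
under eq_Rintegral do under eq_bigr do rewrite -expr2.
by rewrite Rintegral_sum // => i; exact: sqint_sqr.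
Qed.

(** The weight is equivalent to the unweighted norm, because [Q] and its inverse
    are bounded; so completeness follows coordinatewise from [riesz_fischer]. *)
Lemma weight_complete (a : nat -> data) (c : R) : (forall k, L2 (a k).2) ->
  (forall k, weight (a k.+1 - a k) (a k.+1 - a k) <= c * 8^-1 ^+ k) ->
  exists (r : data) (c' : R), [/\ L2 r.2, 0 <= c' &
    forall k, weight (a k - r) (a k - r) <= c' * (2^-1 ^+ k) ^+ 2].
Proof.
move=> sa ac; have [M M0 upM] := weight_upper; have [N N0 coN] := weight_coercive.
have c0 : 0 <= c.
  by have := ac 0%N; rewrite expr0 mulr1; apply: le_trans; exact: weight_ge0.
have sB k : L2 (a k.+1 - a k).2 by exact: L2funB.
pose b := N * c.
have b0 : 0 <= b by rewrite mulr_ge0 // ltW.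
have normB k : dotv (a k.+1 - a k).1 (a k.+1 - a k).1 + ip (a k.+1 - a k).2 (a k.+1 - a k).2
    <= b * 8^-1 ^+ k.
  by apply: (le_trans (coN _ (sB k))); rewrite /b -mulrA ler_pM2l.
have e8 k : (8^-1 : R) ^+ k <= (4^-1) ^+ k.
  by rewrite lerXn2r ?nnegrE // lef_pV2 ?posrE // ler_nat.
have /choice[x xP] i : exists x, forall k, ((a k).1 i 0 - x) ^+ 2 <= 4 * (2^-1 ^+ k) ^+ 2 * b.
  apply: geometric_nested_limit_sqr => // k.
  have h : ((a k.+1).1 i 0 - (a k).1 i 0) ^+ 2 <= b * 8^-1 ^+ k.
    apply: (le_trans _ (normB k)).
    have := enorm_coord (a k.+1 - a k).1 i; rewrite -ler_sqr ?nnegrE ?sqrtr_ge0 //.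
    rewrite real_normK ?num_real // enorm_sqr !mxE => h; apply: (le_trans h).
    by rewrite lerDl; exact: L2dot_ge0.
  apply: (@le_trans _ _ (4 ^+ k * (b * 4^-1 ^+ k))).
    by rewrite ler_wpM2l ?exprn_ge0 //; apply: (le_trans h); rewrite ler_wpM2l.
  by rewrite mulrCA -exprMn mulfV // expr1n mulr1.
have /choice[g gP] i : exists g, sqint t0 T g /\
    forall k, \int[mu]_(t in D) ((a k).2 t i 0 - g t) ^+ 2 <= 8 * b * 4^-1 ^+ k.
  have [k|k|g sg gk] := @riesz_fischer _ t0 T (fun k t => (a k).2 t i 0) b; last by exists g.
    by have /L2funP := sa k.
  apply: (le_trans _ (normB k)).
  rewrite L2dot_coord // (bigD1 i) //=.
  rewrite (_ : \int[mu]_(t in D) _ = \int[mu]_(t in D) ((a k.+1 - a k).2 t i 0) ^+ 2); last first.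
    by apply: eq_Rintegral => t _; rewrite !mxE.
  rewrite addrCA lerDl addr_ge0 ?dotv_ge0 ?sumr_ge0 // => j _.
  by apply: Rintegral_ge0 => t _; exact: sqr_ge0.
pose r : data := (\col_i x i, fun t => \col_i g i t).
have sr : L2 r.2.
  apply/L2funP => i; have [[mg Ig] _] := gP i.
  by under eq_fun do rewrite mxE; split.
exists r, (M * (m%:R * (4 * b) + m%:R * (8 * b))); split=> // [|k].
  by apply: mulr_ge0 (ltW M0) _; apply: addr_ge0; apply: mulr_ge0 => //; apply: mulr_ge0.
have q4 : (2^-1 ^+ k) ^+ 2 = (4^-1 : R) ^+ k.
  by rewrite -exprM mulnC exprM; congr (_ ^+ _); lra.
apply: (le_trans (upM _ _)); first exact: L2funB.
rewrite -mulrA ler_pM2l // mulrDl; apply: lerD.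
  rewrite /dotv; apply: (@le_trans _ _ (\sum_(i < m) 4 * b * (2^-1 ^+ k) ^+ 2)).
    apply: ler_sum => i _; rewrite -expr2 !mxE.
    by apply: (le_trans (xP i k)); rewrite mulrAC.
  by rewrite sumr_const card_ord -[_ *+ m]mulr_natl mulrA.
rewrite L2dot_coord; last exact: L2funB.
apply: (@le_trans _ _ (\sum_(i < m) 8 * b * (2^-1 ^+ k) ^+ 2)).
  apply: ler_sum => i _; have [_ /(_ k)] := gP i; rewrite q4.
  congr (_ <= _); apply: eq_Rintegral => t _; by rewrite !mxE.
by rewrite sumr_const card_ord -[_ *+ m]mulr_natl mulrA.
Qed.

(** The data of the minimizing trajectories [h] converge to [r], which represents
    the gap. The bound on [r] holds because [r] is a limit of admissible data:
    the gap of [h j] tends to [weight r r], while its square is at most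
    [s * weight (h j).1 (h j).1], which tends to [s * weight r r]. *)
Lemma gap_representation l u (s : R) : L2 u -> 0 <= s ->
  (forall h, is_trajectory h -> estimation_gap l u h ^+ 2 <= s * weight h.1 h.1) ->
  exists r : data, [/\ L2 r.2, weight r r <= s &
    forall h, is_trajectory h -> estimation_gap l u h = weight r h.1].
Proof.
move=> su s0 gap_s.
have e0 k : 0 < (8^-1 : R) ^+ k by rewrite exprn_gt0.
have e_ni k : (8^-1 : R) ^+ k.+1 <= 8^-1 ^+ k.
  by rewrite exprS ger_pMl // invf_le1 // ler1n.
have trL2 h : is_trajectory h -> L2 h.1.2 by case.
have [h [hT hC hphi]] := @riesz_minimizing_sequence R trajectory is_trajectory
  (fun h k => weight h.1 k.1) (estimation_gap l u) trajectory0 trajectoryD trajectoryZ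
  (fun h k => weightC h.1 k.1)
  (fun h k j hT kT jT => weightD (trL2 _ hT) (trL2 _ kT) (trL2 _ jT))
  (fun x h j hT jT => weightZ x (trL2 _ hT) (trL2 _ jT))
  (fun h _ => weight_ge0 h.1)
  (fun h k hT kT => gapD l su hT kT) (fun x h hT => gapZ l x su hT) s _ s0 gap_s e0 e_ni.
have sh k := trL2 _ (hT k).
have [r [c' [sr c'0 rP]]] := weight_complete sh hC.
have rep k : is_trajectory k -> estimation_gap l u k = weight r k.1.
  move=> kT; have sk := trL2 _ kT; set W := weight k.1 k.1.
  have W0 : 0 <= W by exact: weight_ge0.
  apply/eqP; rewrite -subr_eq0 -sqrf_eq0; apply/eqP/le_anti/andP; split; last exact: sqr_ge0.
  apply: (@geometric_le0 _ _ (2 * (c' + 2) * W)) => j.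
  have h1 : (weight (h j).1 k.1 - weight r k.1) ^+ 2 <= c' * (2^-1 ^+ j) ^+ 2 * W.
    rewrite -weightB //; apply: (le_trans (weight_cauchy_schwarz _ sk)); first exact: L2funB.
    by rewrite ler_wpM2r.
  have h2 := hphi j k kT.
  have q1 : (2^-1 ^+ j : R) ^+ 2 <= 2^-1 ^+ j.
    by rewrite expr2 ger_pMl ?exprn_gt0 // exprn_ile1 // invf_le1 // ler1n.
  have q2 : (8^-1 : R) ^+ j <= 2^-1 ^+ j.
    by rewrite lerXn2r ?nnegrE // lef_pV2 ?posrE // ler_nat.
  have h1' : c' * (2^-1 ^+ j) ^+ 2 * W <= c' * 2^-1 ^+ j * W by rewrite ler_wpM2r // ler_wpM2l.
  have h2' : 2 * 8^-1 ^+ j * W <= 2 * 2^-1 ^+ j * W by rewrite ler_wpM2r // ler_wpM2l.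
  rewrite -/W in h2.
  have := sqr_ge0 ((estimation_gap l u k - weight (h j).1 k.1) - (weight (h j).1 k.1 - weight r k.1)).
  by move: h1 h2 h1' h2'; lra.
exists r; split=> //.
set N := weight r r; have N0 : 0 <= N by exact: weight_ge0.
rewrite leNgt; apply/negP => sN.
suff : N * (N - s) <= 0 by rewrite leNgt mulr_gt0 ?subr_gt0 // (le_lt_trans s0 sN).
pose x := Num.sqrt c'.
have x0 : 0 <= x by exact: sqrtr_ge0.
apply: (@geometric_le0 _ _ (s * c' + 2 * (N + s) * (x * Num.sqrt N))) => j.
set e := 2^-1 ^+ j : R; have e00 : 0 <= e by rewrite exprn_ge0.
have e1 : e ^+ 2 <= e.
  by rewrite expr2 ger_pMl ?exprn_gt0 // exprn_ile1 // invf_le1 // ler1n.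
set d := weight ((h j).1 - r) ((h j).1 - r); have d0 : 0 <= d by exact: weight_ge0.
have dc : d <= c' * e ^+ 2 by exact: rP.
set w := weight (h j).1 r.
have hh : weight (h j).1 (h j).1 = d + 2 * w - N.
  by rewrite /d weight_sqrB // -/w -/N; ring.
have ws : w ^+ 2 <= s * (d + 2 * w - N).
  by rewrite -hh; apply: le_trans (gap_s _ (hT j)); rewrite rep // weightC.
have wN : `|w - N| <= x * Num.sqrt N * e.
  rewrite -ler_sqr ?nnegrE ?mulr_ge0 ?sqrtr_ge0 // real_normK ?num_real //.
  rewrite !exprMn !sqr_sqrtr // /w /N -weightB //.
  apply: (le_trans (weight_cauchy_schwarz _ sr)); first exact: L2funB.
  by rewrite mulrAC ler_wpM2r.
have sd : s * d <= s * c' * e.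
  by rewrite -mulrA ler_wpM2l //; apply: (le_trans dc); rewrite ler_wpM2l.
have Ns : 0 <= N + s by rewrite addr_ge0.
have wN' := ler_wpM2l Ns wN.
have q0 := sqr_ge0 (w - N).
have cross : (N - w) * (N + s) <= `|w - N| * (N + s).
  by rewrite ler_wpM2r // -normrN opprB ler_norm.
have cross' : 0 <= `|w - N| * (N + s) by rewrite mulr_ge0.
have sN' : s * (N - w) <= s * `|w - N|.
  by rewrite ler_wpM2l // -normrN opprB ler_norm.
(* The inequality for [h j], rewritten around the limit value [N] of [w]. *)
have key : N * (N - s) <= s * d + 2 * ((N + s) * `|w - N|).
  move: ws; rewrite mulrBr mulrDr; nra.
apply: (le_trans key); move: wN' sd; lra.
Qed.

Lemma adjoint_solutionP l u z Fz : L2 u ->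
  adjoint_solution t0 T F C H l u z Fz <->
  [/\ L2 z, abs_continuous t0 T Fz, {ae mu, forall t, D t -> Fz t = F^T *m z t},
     ae_derivative t0 T Fz (fun t => - ((C t)^T *m z t) + (H t)^T *m u t) &
     Fz T = F^T *m l].
Proof.
move=> su; split=> [[[sz [acz _] ? ?] ?]|[sz acz e dz i]] //.
split=> //; apply/descriptor_solutionP => //; exact: adjoint_rate_L2.
Qed.

Lemma adjoint_solutionB l l' u u' z z' Fz Fz' : L2 u -> L2 u' ->
  adjoint_solution t0 T F C H l u z Fz ->
  adjoint_solution t0 T F C H l' u' z' Fz' ->
  adjoint_solution t0 T F C H (l - l') (fun t => u t - u' t)
    (fun t => z t - z' t) (fun t => Fz t - Fz' t).
Proof.
move=> su su' /(adjoint_solutionP _ _ _ su)[sz acz ez dz iz].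
move=> /(adjoint_solutionP _ _ _ su')[sz' acz' ez' dz' iz'].
apply/adjoint_solutionP; first exact: L2funB.
split; [exact: L2funB| | | |by rewrite iz iz' mulmxBr].
- have := abs_continuousD acz (abs_continuousZ (-1) acz').
  by congr abs_continuous; apply/funext => t; rewrite scaleN1r.
- by apply: ae_imply2 ez ez' => t e e' Dt; rewrite mulmxBr (e Dt) (e' Dt).
- have := ae_derivativeD dz (ae_derivativeZ (-1) dz').
  rewrite (_ : (fun t => Fz t + -1 *: Fz' t) = fun t => Fz t - Fz' t).
    congr ae_derivative; apply/funext => t; rewrite !mulmxBr scaleN1r !opprD !opprK.
    by rewrite addrACA.
  by apply/funext => t; rewrite scaleN1r.
Qed.

(** Every primitive [x] of a square-integrable function is the state of a
    trajectory, whose data are read off the equation. On these trajectories the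
    representation of the gap is the weak form of the adjoint equation, with its
    boundary values. *)
Lemma representation_adjoint l u a z : L2 u -> L2 z ->
  (forall h, is_trajectory h -> estimation_gap l u h = dotv a h.1.1 + ip z h.1.2) ->
  exists Fz, adjoint_solution t0 T F C H l u z Fz /\ Fz t0 = F^T *m a.
Proof.
move=> su sz rep.
pose q t := F^T *m z t; pose w t := - ((C t)^T *m z t) + (H t)^T *m u t.
have sq : L2 q by exact: L2fun_cmulmx.
have sCz : L2 (fun t => (C t)^T *m z t) by exact: L2fun_trmulmx.
have sHu : L2 (fun t => (H t)^T *m u t) by exact: L2fun_trmulmx.
have sw : L2 w by exact: adjoint_rate_L2.
have [x xi acx sxi dx|Fz [acFz dFz eFz FzT Fzt0]] :=
    @du_bois_reymond R t0 T tT n q w (F^T *m l) (F^T *m a) sq sw; last first.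
  by exists Fz; split=> //; apply/adjoint_solutionP.
have sx := L2fun_ac acx; have sCx := L2fun_mulmx C_cont sx.
have sFxi : L2 (fun t => F *m xi t) by exact: L2fun_cmulmx.
pose f t := F *m xi t - C t *m x t; have sf : L2 f by exact: L2funB.
have := rep ((F *m x t0, f), (x, fun t => F *m x t)).
rewrite /estimation_gap /= => /(_ _)/wrap[].
  apply/is_trajectoryP => //; split=> //.
  - exact: abs_continuous_mulmx.
  - exact: aeW.
  - have := ae_derivative_mulmx F dx.
    by congr ae_derivative; apply/funext => t; rewrite /f addrC subrK.
rewrite !dotv_mul !trmxK /f L2dotBr // => E.
have -> : ip q xi = ip z (fun t => F *m xi t).
  by apply: eq_Rintegral => t _; rewrite /q dotv_mul trmxK.
have -> : ip w x = - ip z (fun t => C t *m x t) + ip u (fun t => H t *m x t).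
  rewrite /w L2dotDl //; last exact: L2funN.
  congr (_ + _).
    rewrite (_ : (fun t => - _) = fun t => (-1) *: ((C t)^T *m z t)).
      rewrite L2dotZl // mulN1r; congr (- _); apply: eq_Rintegral => t _.
      by rewrite dotv_mul trmxK.
    by apply/funext => t; rewrite scaleN1r.
  by apply: eq_Rintegral => t _; rewrite dotv_mul trmxK.
by move: E; lra.
Qed.

Lemma uncertainty_setP x0 f : uncertainty_set t0 T Q0 Q (x0, f) <->
  L2 f /\ weight (x0, f) (x0, f) <= 1.
Proof.
have E : L2 f -> ((dotv (Q0 *m x0) x0)%:E + \int[mu]_(t in D) (dotv (Q t *m f t) (f t))%:E)%E
    = (weight (x0, f) (x0, f))%:E.
  move=> sf; rewrite /weight EFinD; congr (_ + _)%E.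
  by rewrite fineK //; apply: integrable_fin_num => //; apply: dotv_integrable => //; exact: L2fun_mulmx.
by split=> -[/= sf]; rewrite ?E ?lee_fin // => h; split=> //=; rewrite E // lee_fin.
Qed.

Let K u := noise_energy t0 T Rn u.

(** With [worst_error_le]: the noise is independent of the trajectory, so the
    worst error splits into the largest squared gap and the noise energy. *)
Lemma worst_error_ge l u h : L2 u -> is_trajectory h -> weight h.1 h.1 <= 1 ->
  ((estimation_gap l u h ^+ 2 + K u)%:E <= worst_error t0 T F C H Q0 Q Rn l u)%E.
Proof.
case: h => [[x0 f] [x Fx]] su [/= sf hT] h1.
have [[sx _ _ _] _] := hT.
have sHx := L2fun_mulmx H_cont sx.
have [d [Om [P [eta [ceta keta Eeta]]]]] := noise_attained Rn_pos Rninv_cont su sHx (dotv l (Fx T)).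
apply: ereal_sup_ubound; exists x0, f, x, Fx, d, Om, P, eta; split=> //.
by apply/uncertainty_setP.
Qed.

Lemma worst_error_le l u (s : R) : L2 u ->
  (forall h, is_trajectory h -> weight h.1 h.1 <= 1 -> estimation_gap l u h ^+ 2 <= s) ->
  (worst_error t0 T F C H Q0 Q Rn l u <= (s + K u)%:E)%E.
Proof.
move=> su gap_s; apply: ge_ereal_sup => _ [x0 [f [x [Fx [d [Om [P [eta [/uncertainty_setP[sf f1] hT ceta keta ->]]]]]]]]].
have [[sx _ _ _] _] := hT.
have sHx := L2fun_mulmx H_cont sx.
apply: (le_trans (noise_upper_bound Rn_pos Rn_cont Rninv_cont su sHx ceta keta (dotv l (Fx T)))).
by rewrite lee_fin lerD2r; apply: (gap_s ((x0, f), (x, Fx))).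
Qed.

(** If [weight h.1 h.1] is zero, then every multiple of [h] is admissible, so the
    gap of [h] vanishes. *)
Lemma gap_homogeneous l u (s : R) : L2 u -> 0 <= s ->
  (forall h, is_trajectory h -> weight h.1 h.1 <= 1 -> estimation_gap l u h ^+ 2 <= s) ->
  forall h, is_trajectory h -> estimation_gap l u h ^+ 2 <= s * weight h.1 h.1.
Proof.
move=> su s0 gap_s h hT; have sh : L2 h.1.2 by case: hT.
have scaled x : x ^+ 2 * weight h.1 h.1 <= 1 -> x ^+ 2 * estimation_gap l u h ^+ 2 <= s.
  move=> x1; rewrite -exprMn -gapZ //; apply: gap_s; first exact: trajectoryZ.
  rewrite (_ : (x *: h).1 = x *: (h.1 : data)) // weightZ //; last exact: L2funZ.
  by rewrite weightC weightZ // mulrA -expr2.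
have := weight_ge0 h.1; rewrite le_eqVlt => /predU1P[W0|W0]; last first.
  have := scaled (Num.sqrt (weight h.1 h.1))^-1.
  by rewrite exprVn sqr_sqrtr ?(ltW W0) // mulVf ?gt_eqF // ler_pdivrMl // => /(_ (lexx 1)); rewrite mulrC.
rewrite -W0 mulr0; have [->|g0] := eqVneq (estimation_gap l u h) 0; first by rewrite expr0n.
have g2 : 0 < estimation_gap l u h ^+ 2 by rewrite exprn_even_gt0 //= g0.
have := scaled (Num.sqrt ((s + 1) / estimation_gap l u h ^+ 2)); rewrite -W0 mulr0 => /(_ ler01).
have q0 : 0 <= (s + 1) / estimation_gap l u h ^+ 2 by rewrite divr_ge0 ?(ltW g2) ?addr_ge0.
by rewrite sqr_sqrtr // divfK ?gt_eqF // gerDl ler10.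
Qed.

Lemma worst_error_ge_noise l u : L2 u ->
  ((K u)%:E <= worst_error t0 T F C H Q0 Q Rn l u)%E.
Proof.
move=> su; have := @worst_error_ge l u 0 su trajectory0.
have -> : weight (0 : trajectory).1 (0 : trajectory).1 = 0.
  have := @weightZ 0 0 0 (L2fun_cst _ _ _) (L2fun_cst _ _ _).
  by rewrite scale0r mul0r.
move=> /(_ ler01); apply: le_trans; rewrite lee_fin lerDr; exact: sqr_ge0.
Qed.

Lemma minimax_error_ge0 l : (0 <= minimax_error t0 T F C H Q0 Q Rn l)%E.
Proof.
apply: le_ereal_inf_tmp => _ [u su <-].
apply: (le_trans _ (worst_error_ge_noise l su)); rewrite lee_fin.
exact: (noise_energy_ge0 Rn_pos u).
Qed.

(** If the worst error is finite, then the gap is bounded by the data, and its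
    Riesz representative is turned by the weights into a solution of the adjoint
    equation. Its dual cost accounts for the whole worst error but the noise
    energy, so it is the least possible one. *)
Lemma finite_worst_error_adjoint l u : L2 u ->
  (worst_error t0 T F C H Q0 Q Rn l u < +oo)%E ->
  exists (r : data) Fz, [/\ L2 r.2,
    adjoint_solution t0 T F C H l u (fun t => Q t *m r.2 t) Fz,
    Fz t0 = F^T *m (Q0 *m r.1) &
    ((weight r r + K u)%:E <= worst_error t0 T F C H Q0 Q Rn l u)%E].
Proof.
move=> su wfin; have wK := worst_error_ge_noise l su.
have K0 : 0 <= K u by exact: (noise_energy_ge0 Rn_pos u).
have wnum : worst_error t0 T F C H Q0 Q Rn l u \is a fin_num.
  by rewrite ge0_fin_numE // (le_trans _ wK) // lee_fin.
rewrite -(fineK wnum) in wK *; set w := fine _ in wK *.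
rewrite lee_fin in wK.
have s0 : 0 <= w - K u by rewrite subr_ge0.
have [|r [sr rs rep]] := gap_representation su s0 (l := l).
  apply: gap_homogeneous => // h hT h1; rewrite lerBrDr -lee_fin fineK //.
  exact: worst_error_ge.
have sQr : L2 (fun t => Q t *m r.2 t) by exact: L2fun_mulmx.
have [Fz [aFz Fzt0]] := representation_adjoint su sQr rep.
exists r, Fz; split=> //.
by rewrite lee_fin -lerBrDr.
Qed.

(** The initial value lies in the range of [F], on which [d] vanishes. *)
Lemma state_initial_range (x0 : 'cV[R]_m) f x Fx d : L2 f ->
  state_solution t0 T F C x0 f x Fx -> F^T *m d = 0 -> dotv d x0 = 0.
Proof.
move=> sf hT Fd; have [[sx [acx _] ex dx] <-] := hT.
have [FGF _ _ symGF] := mppinvP F^T.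
have [Px _] := ae_derivative_projection tT (mppinv_tr_mulmx F) acx dx ex.
have Dt0 : D t0 by rewrite /= in_itv /= lexx ltW.
by rewrite -(Px _ Dt0) dotvC dotv_mul symGF -mulmxA Fd mulmx0 dotv0r.
Qed.

(** By Green's formula each adjoint solution, corrected by any [d] with
    [F^T *m d = 0], represents the gap as a functional of the data. Hence its dual
    cost is an upper bound. *)
Lemma adjoint_worst_error_le l u z Fz d : L2 u ->
  adjoint_solution t0 T F C H l u z Fz -> F^T *m d = 0 ->
  (worst_error t0 T F C H Q0 Q Rn l u <=
   (dual_weight (mppinv F^T *m Fz t0 - d) z + K u)%:E)%E.
Proof.
move=> su az Fd; have [[sz _ _ _] _] := az.
apply: worst_error_le => // -[[x0 f] [x Fx]] [/= sf hT] h1.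
rewrite /estimation_gap /= (green_formula tT C_cont H_cont su sf az hT).
have -> : dotv (mppinv F^T *m Fz t0) x0 = dotv (mppinv F^T *m Fz t0 - d) x0.
  by rewrite dotvBl (state_initial_range sf hT Fd) subr0.
apply: (le_trans (dual_cauchy_schwarz _ sz (h := (x0, f)) sf)).
by rewrite -[leRHS]mulr1 ler_wpM2l // dual_weight_ge0.
Qed.

Lemma dual_costE z Fz v Fv d : L2 z -> L2 v ->
  dual_cost t0 T F Q0 Q z Fz v Fv d =
  (dual_weight (mppinv F^T *m (Fz t0 - Fv t0) - d) (fun t => z t - v t))%:E.
Proof.
move=> sz sv; rewrite /dual_cost /dual_weight EFinD; congr (_ + _)%E.
  by rewrite /initial_cost -mulmxBr enorm_invsqrtmx.
by rewrite integral_invsqrtmx //; exact: L2funB.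
Qed.

End Duality.

Theorem theorem2 (R : realType) (t0 T : R) (m n p : nat)
  (F : 'M[R]_(m, n)) (C : R -> 'M[R]_(m, n)) (H : R -> 'M[R]_(p, n))
  (Q0 : 'M[R]_m) (Q : R -> 'M[R]_m) (Rn : R -> 'M[R]_p)
  (t0_lt_T : t0 < T)
  (C_cont : {within `[t0, T], continuous C})
  (H_cont : {within `[t0, T], continuous H})
  (Q0_pos : posdefmx Q0)
  (Q_pos : forall t, t \in `[t0, T]%R -> posdefmx (Q t))
  (Rn_pos : forall t, t \in `[t0, T]%R -> posdefmx (Rn t))
  (Q_cont : {within `[t0, T], continuous Q})
  (Qinv_cont : {within `[t0, T], continuous (fun t => invmx (Q t))})
  (Rn_cont : {within `[t0, T], continuous Rn})
  (Rninv_cont : {within `[t0, T], continuous (fun t => invmx (Rn t))})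
  (l : 'cV[R]_m) :
  (minimax_error t0 T F C H Q0 Q Rn l \is a fin_num <->
     exists (z : R -> 'cV[R]_m) (Fz : R -> 'cV[R]_n) (u : R -> 'cV[R]_p),
       L2fun t0 T u /\ adjoint_solution t0 T F C H l u z Fz) /\
  ((minimax_error t0 T F C H Q0 Q Rn l < +oo)%E ->
   forall (z : R -> 'cV[R]_m) (Fz : R -> 'cV[R]_n) (u : R -> 'cV[R]_p),
     L2fun t0 T u -> adjoint_solution t0 T F C H l u z Fz ->
     exists (v : R -> 'cV[R]_m) (Fv : R -> 'cV[R]_n) (d : 'cV[R]_m),
       [/\ dual_feasible t0 T F C H v Fv d,
           forall (v' : R -> 'cV[R]_m) (Fv' : R -> 'cV[R]_n) (d' : 'cV[R]_m),
             dual_feasible t0 T F C H v' Fv' d' ->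
             (dual_cost t0 T F Q0 Q z Fz v Fv d <=
              dual_cost t0 T F Q0 Q z Fz v' Fv' d')%E,
           worst_error t0 T F C H Q0 Q Rn l u =
             (dual_cost t0 T F Q0 Q z Fz v Fv d +
              \int[lebesgue_measure]_(t in `[t0, T])
                (enorm (invsqrtmx (Rn t) *m u t) ^+ 2)%:E)%E &
           worst_error t0 T F C H Q0 Q Rn l u =
             ((initial_cost F Q0 (Fz t0) (Fv t0) d)%:E +
              \int[lebesgue_measure]_(t in `[t0, T])
                (enorm (invsqrtmx (Q t) *m (z t - v t)) ^+ 2 +
                 enorm (invsqrtmx (Rn t) *m u t) ^+ 2)%:E)%E]).
Proof.
have dual_finite u z Fz : L2fun t0 T u -> adjoint_solution t0 T F C H l u z Fz ->
    (worst_error t0 T F C H Q0 Q Rn l u < +oo)%E.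
  move=> su az; apply: le_lt_trans (ltry _).
  exact: (adjoint_worst_error_le t0_lt_T C_cont H_cont Q0_pos Q_pos Rn_pos Q_cont
    Qinv_cont Rn_cont Rninv_cont su az (mulmx0 _ _)).
split; first split.
- rewrite ge0_fin_numE; last first.
    exact: minimax_error_ge0.
  move=> /ereal_inf_lt[_ [u su <-]] wfin.
  have [r [Fz [_ az _ _]]] := finite_worst_error_adjoint t0_lt_T C_cont H_cont Q0_pos Q_pos
    Rn_pos Q_cont Qinv_cont Rninv_cont su wfin.
  by exists (fun t => Q t *m r.2 t), Fz, u.
- move=> [z [Fz [u [su az]]]]; rewrite ge0_fin_numE; last first.
    exact: minimax_error_ge0.
  by apply: le_lt_trans (dual_finite u z Fz su az); apply: ereal_inf_lbound; exists u.
move=> _ z Fz u su az; have wfin := dual_finite u z Fz su az.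
have [r [Fr [sr ar Fr0 rw]]] := finite_worst_error_adjoint t0_lt_T C_cont H_cont Q0_pos Q_pos
  Rn_pos Q_cont Qinv_cont Rninv_cont su wfin.
have [[sz _ _ _] _] := az; have [[sQr _ _ _] _] := ar.
pose G := mppinv F^T; have [FGF _ _ _] := mppinvP F^T; rewrite -/G in FGF.
(* The minimizer is the difference between the given solution and the one that
   comes from the Riesz representative; d corrects the initial value. *)
pose v t := z t - Q t *m r.2 t; pose Fv t := Fz t - Fr t.
pose d := G *m Fr t0 - Q0 *m r.1.
have sv : L2fun t0 T v by exact: L2funB.
have feasible : dual_feasible t0 T F C H v Fv d.
  split; last by rewrite mulmxBr (_ : F^T *m (G *m _) = F^T *m (Q0 *m r.1)) ?subrr // Fr0 !mulmxA FGF.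
  have := adjoint_solutionB C_cont H_cont su su az ar.
  by rewrite subrr; under [fun t => u t - u t]eq_fun do rewrite subrr.
have s0 : L2fun t0 T (fun=> 0 : 'cV[R]_p) by exact: L2fun_cst.
have cost_ge v' Fv' d' : dual_feasible t0 T F C H v' Fv' d' ->
    (worst_error t0 T F C H Q0 Q Rn l u <=
     dual_cost t0 T F Q0 Q z Fz v' Fv' d' + (noise_energy t0 T Rn u)%:E)%E.
  move=> [av' Fd']; have [[sv' _ _ _] _] := av'.
  have := adjoint_solutionB C_cont H_cont su s0 az av'.
  rewrite subr0 (_ : (fun t => u t - 0) = u); last by apply/funext => t; rewrite subr0.
  move=> adiff; rewrite (dual_costE _ Q0_pos Q_pos Qinv_cont) // -EFinD.
  exact: (adjoint_worst_error_le t0_lt_T C_cont H_cont Q0_pos Q_pos Rn_pos Q_cont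
    Qinv_cont Rn_cont Rninv_cont su adiff Fd').
have costE : dual_cost t0 T F Q0 Q z Fz v Fv d = (weight t0 T Q0 Q r r)%:E.
  rewrite (dual_costE _ Q0_pos Q_pos Qinv_cont) //; congr _%:E; rewrite -(dual_weightE Q0_pos Q_pos); congr dual_weight.
    by rewrite -/G /Fv subKr /d subKr.
  by apply/funext => t; rewrite /v subKr.
have wE : worst_error t0 T F C H Q0 Q Rn l u =
    (dual_cost t0 T F Q0 Q z Fz v Fv d + (noise_energy t0 T Rn u)%:E)%E.
  by apply/le_anti; rewrite cost_ge // costE -EFinD rw.
have noiseE := integral_invsqrtmx Rn_pos Rninv_cont su.
exists v, Fv, d; split => //.
- move=> v' Fv' d' /cost_ge; rewrite {1}wE.
  by rewrite leeD2rE.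
- by rewrite noiseE.
have szv : L2fun t0 T (fun t => z t - v t) by exact: L2funB.
have zv_int := invsqrtmx_integrable Q_pos Qinv_cont szv.
have u_int := invsqrtmx_integrable Rn_pos Rninv_cont su.
rewrite wE /dual_cost -addeA; congr (_ + _)%E.
rewrite -[(noise_energy _ _ _ _)%:E]noiseE -ge0_integralD //.
- by move=> t _; rewrite lee_fin sqr_ge0.
- exact: measurable_int zv_int.
- by move=> t _; rewrite lee_fin sqr_ge0.
- exact: measurable_int u_int.
Qed.
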